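(* Let $n$ be a positive integer, $\mathbf{u}=(u_0,\dots,u_n)$ with $u_k\in H(\mathbb{D})$, and $\varphi$ an analytic self-map of $\mathbb{D}$. Then $L_{\mathbf{u},\varphi}^{(n)}:A^2\to A^2$ is Hilbert–Schmidt if and only if each $W_{u_k,\varphi}^{(k)}:A^2\to A^2$, $k=0,1,\dots,n$, is Hilbert–Schmidt.
   Context: $\mathbb{D}$ is the open unit disc, $H(\mathbb{D})$ the analytic functions on $\mathbb{D}$, $dA=\frac{dx\,dy}{\pi}$, and $A^2=\{f\in H(\mathbb{D}):\int_{\mathbb{D}}|f|^2\,dA<\infty\}$ with inner product $\langle f,g\rangle=\int_{\mathbb{D}}f\bar g\,dA$. For $u\in H(\mathbb{D})$ and integer $k\ge0$, $W_{u,\varphi}^{(k)}f=u\cdot(f^{(k)}\circ\varphi)$, and $L_{\mathbf{u},\varphi}^{(n)}=\sum_{k=0}^nW_{u_k,\varphi}^{(k)}$. *)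

(* Defs.v *)
(* MathComp-Analysis over an abstract R : realType,
   complex numbers C = R[i] (mathcomp-real-closed), viewed as a normed
   module over itself via the regular structure C^o. *)
From HB Require Import structures.
From mathcomp Require Import all_boot all_order all_algebra.
From mathcomp Require Import complex.
From mathcomp Require Import all_classical all_reals all_analysis.
Set Implicit Arguments. Unset Strict Implicit. Unset Printing Implicit Defensive.
Import Order.TTheory GRing.Theory Num.Theory.
Import numFieldNormedType.Exports.
Local Open Scope classical_set_scope.
Local Open Scope ring_scope.

Section Bergman.
Variable R : realType.

(* the complex plane, as a normed module over itself *)
Definition Cplx : Type := (R[i])^o.

(* analytic (= holomorphic) on the open unit disc: complex differentiable at
   every point z with |z| < 1 *)
Definition holo_disc (f : Cplx -> Cplx) : Prop :=
  forall z : Cplx, `|z| < 1 -> derivable f z (1 : Cplx).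

(* analytic self-map of the disc *)
Definition analytic_selfmap (phi : Cplx -> Cplx) : Prop :=
  holo_disc phi /\ forall z : Cplx, `|z| < 1 -> `|phi z| < 1.

(* k-th complex derivative *)
Definition cderiv (k : nat) (f : Cplx -> Cplx) : Cplx -> Cplx := derive1n k f.

(* W^{(k)}_{u,phi} f = u * (f^{(k)} o phi) *)
Definition Wop (u phi : Cplx -> Cplx) (k : nat) (f : Cplx -> Cplx) : Cplx -> Cplx :=
  fun z => u z * cderiv k f (phi z).

(* L^{(n)}_{u,phi} = sum_{k=0}^n W^{(k)}_{u_k,phi} *)
Definition Lop (u : nat -> Cplx -> Cplx) (phi : Cplx -> Cplx) (n : nat)
    (f : Cplx -> Cplx) : Cplx -> Cplx :=
  fun z => \sum_(k < n.+1) Wop (u k) phi k f z.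

(* identification R x R = C and the unit disc in R x R *)
Definition toC (p : R * R) : Cplx := Complex p.1 p.2.
Definition Ddisc : set (R * R) := [set p | p.1 ^+ 2 + p.2 ^+ 2 < 1].

(* Lebesgue (area) measure dx dy on R x R *)
Definition area := ((@lebesgue_measure R) \x (@lebesgue_measure R))%E.

(* |z|^2 as a real number *)
Definition sqmod (z : Cplx) : R := (complex.Re z) ^+ 2 + (complex.Im z) ^+ 2.

(* ||f||^2 = int_D |f|^2 dA, with dA = dx dy / pi *)
Definition A2normsq (f : Cplx -> Cplx) : \bar R :=
  ((\int[area]_(p in Ddisc) (sqmod (f (toC p)))%:E) * (pi^-1)%:E)%E.

(* f in A^2 *)
Definition inA2 (f : Cplx -> Cplx) : Prop :=
  holo_disc f /\ (A2normsq f < +oo)%E.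

(* <f, g> = int_D f conj(g) dA, computed through real and imaginary parts *)
Definition A2ip (f g : Cplx -> Cplx) : Cplx :=
  Complex (Rintegral area Ddisc (fun p => complex.Re (f (toC p) * (g (toC p))^*)) / pi)
          (Rintegral area Ddisc (fun p => complex.Im (f (toC p) * (g (toC p))^*)) / pi).

(* e is an orthonormal basis of the (separable) Hilbert space A^2 *)
Definition A2_ONB (e : nat -> Cplx -> Cplx) : Prop :=
  [/\ forall i, inA2 (e i),
      forall i j, A2ip (e i) (e j) = (i == j)%:R &
      forall f, inA2 f -> (forall i, A2ip f (e i) = 0) ->
        forall z : Cplx, `|z| < 1 -> f z = 0].

(* T is a bounded operator A^2 -> A^2 *)
Definition bounded_A2 (T : (Cplx -> Cplx) -> (Cplx -> Cplx)) : Prop :=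
  (forall f, inA2 f -> inA2 (T f)) /\
  exists M : R, forall f, inA2 f -> (A2normsq (T f) <= M%:E * A2normsq f)%E.

(* T : A^2 -> A^2 is Hilbert-Schmidt: bounded, and sum_i ||T e_i||^2 < oo
   for an orthonormal basis (e_i) of A^2 *)
Definition hilbert_schmidt_A2 (T : (Cplx -> Cplx) -> (Cplx -> Cplx)) : Prop :=
  bounded_A2 T /\
  exists e, A2_ONB e /\ (\sum_(0 <= i <oo) A2normsq (T (e i)) < +oo)%E.

End Bergman.

(* Main.v *)
(* Let l_z be the functional f |-> sum_k u_k(z) f^(k)(phi(z)) on A^2. For an orthonormal basis
   (e_i), Tonelli turns sum_i ||L e_i||^2 into the integral over the disc of
   sum_i |l_z(e_i)|^2 = ||l_z||^2 (Bessel, and the Riesz-Fischer theorem for the converse), so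
   that being Hilbert-Schmidt depends neither on the basis nor on anything but ||l_z||.
   Boundedness of the operator follows from the convergence of that integral.

   It remains to see that the functionals f |-> f^(k)(w), 0 <= k <= n, normalised by
   (1 - |w|)^(k+1), are bounded and linearly independent uniformly in w. Boundedness is the
   subharmonic estimate |f(w)|^2 r^2 <= K ||f||^2 combined with Cauchy's estimates. Independence is
   tested on (z - w)^j (1 - |w|) / (1 - w^* z)^(j+2), whose norms are bounded uniformly in w and
   whose derivatives at w of order less than j vanish while the one of order j is
   j! (1 - |w|) / (1 - |w|^2)^(j+2). Hence |u_k(z)|^2 ||f |-> f^(k)(phi(z))||^2 is at most
   C ||l_z||^2 for every k, with C depending only on n; the converse implication is the
   triangle inequality.

   Cauchy's formula is used on rectangles only, where Goursat's bisection and Fubini apply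
   directly: a rectangle around w with sides of small mean square is found by averaging. *)
Require Import Defs.
From mathcomp Require Import all_boot all_order all_algebra.
From mathcomp Require Import complex.
From mathcomp Require Import all_classical all_reals all_analysis.
From mathcomp Require Import measurable_realfun ring lra.
Set Implicit Arguments. Unset Strict Implicit. Unset Printing Implicit Defensive.
Import Order.TTheory GRing.Theory Num.Theory.
Import numFieldNormedType.Exports.
Local Open Scope classical_set_scope.
Local Open Scope ring_scope.

(** * Complex numbers as pairs of reals *)

(** The definition of a Hilbert-Schmidt operator supplies some orthonormal basis, and in the
    converse implication each [Wop (u k) phi k] arrives with its own. The pointwise comparison
    ([frame_compare]) is therefore stated for two bases at once, the hypothesis in one and the
    conclusion in the other: with the coefficients of [Lop] it isolates one term, with a single
    nonzero coefficient it changes the basis. No basis is ever constructed, since each implication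
    receives one from its hypotheses.

    Writing T g (a) for the integral of g(z)/(z - a) over a rectangle, Cauchy's formula is kept in
    the form f = T f / T 1. Differentiating this quotient shows that f' is again holomorphic, and
    the same quotient passes to uniform limits; all it takes is that T 1 stays away from 0.

    The formula is applied to f^2 rather than f in the mean value estimate: the sides then
    contribute integrals of |f|^2, which are exactly what averaging over parallel sides controls.

    All constants are crude but explicit, because they must be uniform up to the unit circle: the
    weights (1 - |w|)^(k+1) in the upper and lower bounds have to cancel exactly. *)

Section ComplexPlane.
Variable R : realType.
Local Notation C := (Cplx R).
Local Notation nm := (@Normc.normc R).

Lemma lt_norm (z : C) (e : R) : (`|z| < Complex e 0) = (nm z < e).
Proof. by rewrite normc_def; case: z => a b; rewrite ltcE /= eqxx. Qed.

Lemma lt1_norm (z : C) : (`|z| < 1) = (nm z < 1).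
Proof. exact: lt_norm. Qed.

Lemma nmE (z : C) : nm z = Num.sqrt (complex.Re z ^+ 2 + complex.Im z ^+ 2).
Proof. by case: z. Qed.

Lemma nm_ge0 (z : C) : 0 <= nm z.
Proof. by rewrite nmE sqrtr_ge0. Qed.
Hint Resolve nm_ge0 : core.

Lemma nm_sq (z : C) : nm z ^+ 2 = sqmod z.
Proof. by rewrite nmE sqr_sqrtr// addr_ge0// sqr_ge0. Qed.

Lemma nmM (z w : C) : nm (z * w) = nm z * nm w. Proof. exact: Normc.normcM. Qed.
Lemma nmV (z : C) : nm (z^-1) = (nm z)^-1. Proof. exact: Normc.normcV. Qed.
Lemma nmN (z : C) : nm (- z) = nm z. Proof. exact: normcN. Qed.
Lemma nmD (z w : C) : nm (z + w) <= nm z + nm w. Proof. exact: le_normcD. Qed.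
Lemma nm0 : nm (0 : C) = 0. Proof. exact: Normc.normc0. Qed.
Lemma nm1 : nm (1 : C) = 1. Proof. exact: Normc.normc1. Qed.
Lemma nm_eq0 (z : C) : (nm z == 0) = (z == 0).
Proof. by apply/eqP/eqP => [/Normc.eq0_normc//|->]; exact: nm0. Qed.
Lemma nm_gt0 (z : C) : (0 < nm z) = (z != 0).
Proof. by rewrite lt0r nm_eq0 nm_ge0 andbT. Qed.
Lemma nmBC (z w : C) : nm (z - w) = nm (w - z). Proof. by rewrite -nmN opprB. Qed.
Lemma nmX (z : C) n : nm (z ^+ n) = nm z ^+ n.
Proof. by elim: n => [|n ih]; rewrite ?expr0 ?nm1// !exprS nmM ih. Qed.
Lemma nm_sum (I : Type) (s : seq I) (F : I -> C) :
  nm (\sum_(i <- s) F i) <= \sum_(i <- s) nm (F i).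
Proof.
by elim: s => [|i s ih]; rewrite ?big_nil ?nm0// !big_cons (le_trans (nmD _ _))// lerD2l.
Qed.
Lemma nmB_ge (z w : C) : nm z - nm w <= nm (z - w).
Proof. by rewrite lerBlDr; apply: le_trans (nmD _ _); rewrite subrK. Qed.
Lemma nm_real (x : R) : nm (x%:C)%C = `|x|.
Proof. by rewrite nmE /= expr0n addr0 sqrtr_sqr. Qed.
Lemma ler_Re (z : C) : `|complex.Re z| <= nm z.
Proof. by rewrite nmE -sqrtr_sqr ler_wsqrtr// lerDl sqr_ge0. Qed.
Lemma ler_Im (z : C) : `|complex.Im z| <= nm z.
Proof. by rewrite nmE -sqrtr_sqr ler_wsqrtr// lerDr sqr_ge0. Qed.
Lemma nm_le_ReIm (z : C) : nm z <= `|complex.Re z| + `|complex.Im z|.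
Proof.
rewrite nmE -[leRHS]ger0_norm; last by rewrite addr_ge0.
rewrite -sqrtr_sqr ler_wsqrtr// -(real_normK (num_real (complex.Re z))).
rewrite -(real_normK (num_real (complex.Im z))).
have := normr_ge0 (complex.Re z); have := normr_ge0 (complex.Im z).
by move: `|_| `|_| => x y x0 y0; nra.
Qed.

Lemma ReB (z w : C) : complex.Re (z - w) = complex.Re z - complex.Re w.
Proof. by case: z; case: w. Qed.
Lemma ImB (z w : C) : complex.Im (z - w) = complex.Im z - complex.Im w.
Proof. by case: z; case: w. Qed.
Lemma ReD (z w : C) : complex.Re (z + w) = complex.Re z + complex.Re w.
Proof. by case: z; case: w. Qed.
Lemma ImD (z w : C) : complex.Im (z + w) = complex.Im z + complex.Im w.
Proof. by case: z; case: w. Qed.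
Lemma ReM (z w : C) : complex.Re (z * w) =
  complex.Re z * complex.Re w - complex.Im z * complex.Im w.
Proof. by case: z; case: w. Qed.
Lemma ImM (z w : C) : complex.Im (z * w) =
  complex.Re z * complex.Im w + complex.Im z * complex.Re w.
Proof. by case: z => a b; case: w => c d /=; rewrite [b * c]mulrC. Qed.
Lemma ReN (z : C) : complex.Re (- z) = - complex.Re z. Proof. by case: z. Qed.
Lemma complex_ext (z w : C) : complex.Re z = complex.Re w -> complex.Im z = complex.Im w -> z = w.
Proof. by case: z => a b; case: w => c d /= -> ->. Qed.

(** Balls of [C] have radii in [C] itself, and a positive complex number is a positive real. Trading
    them for real radii lets every later estimate take place in [R]. *)
Lemma nbhsCP (z : C) (A : set C) :
  nbhs z A <-> exists2 e : R, 0 < e & forall w, nm (w - z) < e -> A w.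
Proof.
split=> [/nbhs_ballP[e /= e0 H]|[e e0 H]].
  have /complex_realP[k ek] : e \is Num.real by apply: gtr0_real.
  exists k; first by move: e0; rewrite ek ltcR.
  by move=> w wk; apply: H; rewrite ek /ball /= -opprB normrN lt_norm.
apply/nbhs_ballP; exists (e%:C)%C; first by rewrite /= ltcR.
by move=> w; rewrite /ball /= distrC => H1; apply: H; rewrite -lt_norm.
Qed.

(** Multiplying the difference quotient by [h] gives a first-order remainder bound without division,
    valid also at [h = 0]; this is the form that can be integrated. *)
Lemma is_derivecP (f : C -> C) (z d : C) : is_derive z (1 : C) f d <->
  (forall e, 0 < e -> exists2 del : R, 0 < del & forall h, nm h < del ->
    nm (f (h + z) - f z - h * d) <= e * nm h).
Proof.
have E (l h : C) : h != 0 -> nm (l - h^-1 *: ((f \o shift z) (h *: (1 : C)) - f z)) =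
    nm (f (h + z) - f z - h * l) / nm h.
  move=> h0; rewrite -nmV -nmM nmBC /=; congr nm.
  rewrite /GRing.scale /= mulr1 mulrBl mulrC; congr (_ - _).
  by rewrite mulrAC divff// mul1r.
split=> [[dv <-] e e0|H].
  move: dv; rewrite /derivable /derive => /cvg_ball H.
  set l := lim _ in H *.
  have ec0 : 0 < (e%:C)%C :> C by rewrite ltcR.
  have := H _ ec0; rewrite /= near_withinE near_simpl => /nbhsCP[del del0 K].
  exists del => // h hd; have [->|h0] := eqVneq h 0.
    by rewrite add0r subrr mul0r subr0 nm0 mulr0.
  have {}K := K h; rewrite subr0 in K; have := K hd h0.
  rewrite /ball /= lt_norm.
  by rewrite E// ltr_pdivrMr ?nm_gt0// => /ltW.
have cv : (fun h : C => h^-1 *: ((f \o shift z) (h *: (1 : C)) - f z)) @ (0 : C)^' --> d.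
  apply/cvg_ballP => eps eps0.
  have /complex_realP[k ek] : eps \is Num.real by apply: gtr0_real.
  have k0 : 0 < k by move: eps0; rewrite ek ltcR.
  (* Half of [k], because the remainder bound is weak while the ball is strict. *)
  have [del del0 K] := H (k / 2) (divr_gt0 k0 (ltr0n _ 2)).
  rewrite near_withinE; apply/nbhsCP; exists del => // h.
  rewrite subr0 => hd h0; rewrite /ball /= ek lt_norm E//.
  rewrite ltr_pdivrMr ?nm_gt0//; apply: (le_lt_trans (K _ hd)).
  by rewrite ltr_pM2r ?nm_gt0// ltr_pdivrMr// ltr_pMr// ltr1n.
split; first by apply/cvg_ex; exists d.
by apply/cvg_lim.
Qed.
End ComplexPlane.
#[global] Arguments Normc.normc : simpl never.
#[global] Hint Resolve nm_ge0 : core.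

(** * Complex-valued integrals *)

Section ComplexIntegral.
Context d (T : measurableType d) (R : realType) (mu : {measure set T -> \bar R}).
Local Notation C := (Cplx R).
Local Notation nm := (@Normc.normc R).
Implicit Types (D : set T) (F G : T -> C).

(** Componentwise, like [A2ip], which is then this integral up to the factor [pi^-1] ([A2ipE]). *)
Definition cint D F : C :=
  Complex (Rintegral mu D (fun t => complex.Re (F t)))
          (Rintegral mu D (fun t => complex.Im (F t))).

Definition cintegrable D F :=
  mu.-integrable D (EFin \o (fun t => complex.Re (F t))) /\
  mu.-integrable D (EFin \o (fun t => complex.Im (F t))).

Lemma eq_cint D F G : (forall t, D t -> F t = G t) -> cint D F = cint D G.
Proof.
by move=> FG; congr Complex; apply: eq_Rintegral => t /set_mem Dt; rewrite FG.
Qed.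

Lemma eq_cintegrable D F G : measurable D -> (forall t, D t -> F t = G t) ->
  cintegrable D F -> cintegrable D G.
Proof.
by move=> mD FG [iR iI]; split; [move: iR|move: iI]; apply: eq_integrable => // t /set_mem Dt /=;
  rewrite FG.
Qed.

Lemma cintD D F G : measurable D -> cintegrable D F -> cintegrable D G ->
  cint D (fun t => F t + G t) = cint D F + cint D G.
Proof.
move=> mD [FR FI] [GR GI]; apply: complex_ext; rewrite /= -RintegralD//;
  by apply: eq_Rintegral => t _; rewrite ?ReD ?ImD.
Qed.

Lemma cintegrableZ D F (c : C) : measurable D -> cintegrable D F ->
  cintegrable D (fun t => c * F t).
Proof.
move=> mD [FR FI]; split.
- under [X in _.-integrable _ X]eq_fun do rewrite /= ReM EFinB 2!EFinM.
  by apply: integrableB => //; exact: integrableZl.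
- under [X in _.-integrable _ X]eq_fun do rewrite /= ImM EFinD 2!EFinM.
  by apply: integrableD => //; exact: integrableZl.
Qed.

Lemma integrable_EFinZl D (f : T -> R) (r : R) : measurable D -> mu.-integrable D (EFin \o f) ->
  mu.-integrable D (EFin \o (fun t => r * f t)).
Proof.
by move=> mD fi; under [X in _.-integrable _ X]eq_fun do rewrite /= EFinM; exact: integrableZl.
Qed.

Lemma cintZ D F (c : C) : measurable D -> cintegrable D F ->
  cint D (fun t => c * F t) = c * cint D F.
Proof.
move=> mD [FR FI]; apply: complex_ext; rewrite ?ReM ?ImM /= -!RintegralZl//.
- rewrite -RintegralB//; [|exact: integrable_EFinZl|exact: integrable_EFinZl].
  by apply: eq_Rintegral => t _; rewrite ReM.
- rewrite -RintegralD//; [|exact: integrable_EFinZl|exact: integrable_EFinZl].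
  by apply: eq_Rintegral => t _; rewrite ImM.
Qed.

Lemma cintegrableN D F : measurable D -> cintegrable D F -> cintegrable D (fun t => - F t).
Proof.
by move=> mD /(cintegrableZ (-1) mD); apply: eq_cintegrable => // t _; rewrite mulN1r.
Qed.

Lemma cintN D F : measurable D -> cintegrable D F -> cint D (fun t => - F t) = - cint D F.
Proof.
by move=> mD iF; rewrite -mulN1r -cintZ//; apply: eq_cint => t _; rewrite mulN1r.
Qed.

Lemma cintB D F G : measurable D -> cintegrable D F -> cintegrable D G ->
  cint D (fun t => F t - G t) = cint D F - cint D G.
Proof. by move=> mD iF iG; rewrite cintD//; [rewrite cintN|exact: cintegrableN]. Qed.

(** The factor 2 comes from bounding the real and imaginary parts separately; it is harmless here
    and avoids rotating the integral to the real axis. *)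
Lemma nm_cint_le D F (g : T -> R) : measurable D -> cintegrable D F ->
  mu.-integrable D (EFin \o g) -> (forall t, D t -> nm (F t) <= g t) ->
  nm (cint D F) <= 2 * Rintegral mu D g.
Proof.
move=> mD [FR FI] ig Fg; apply: (le_trans (nm_le_ReIm _)).
rewrite mulr_natl mulr2n lerD//= (le_trans (le_normr_Rintegral _ _))//;
  apply: le_Rintegral => //; try exact: integrable_norm.
- by move=> t Dt; apply: le_trans (Fg t Dt); exact: ler_Re.
- by move=> t Dt; apply: le_trans (Fg t Dt); exact: ler_Im.
Qed.

End ComplexIntegral.

(** * Contour integrals over the boundary of a rectangle *)

Section Rectangles.
Variable R : realType.
Local Notation C := (Cplx R).
Local Notation nm := (@Normc.normc R).
Local Notation leb := (@lebesgue_measure R).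

Lemma continuousCP (f : C -> C) (z : C) : {for z, continuous f} <->
  forall e, 0 < e -> exists2 d : R, 0 < d & forall w, nm (w - z) < d -> nm (f w - f z) < e.
Proof.
split=> [H e e0|H].
  have : nbhs (f z) [set w | nm (w - f z) < e] by apply/nbhsCP; exists e.
  by move=> /H /nbhsCP.
by move=> A /nbhsCP[e e0 eA]; have [d d0 dH] := H e e0; apply/nbhsCP; exists d => // w /dH /eA.
Qed.

Lemma derivable_continuousC (f : C -> C) (z : C) : derivable f z (1 : C) -> {for z, continuous f}.
Proof. by move=> /derivable1_diffP /differentiable_continuous. Qed.

Lemma continuous_Re : continuous (@complex.Re R : C -> R).
Proof.
move=> z A /nbhs_ballP[e /= e0 eA]; apply/nbhsCP; exists e => // w we; apply: eA.
by rewrite /ball /= distrC -ReB; apply: le_lt_trans (ler_Re _) we.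
Qed.

Lemma continuous_Im : continuous (@complex.Im R : C -> R).
Proof.
move=> z A /nbhs_ballP[e /= e0 eA]; apply/nbhsCP; exists e => // w we; apply: eA.
by rewrite /ball /= distrC -ImB; apply: le_lt_trans (ler_Im _) we.
Qed.

Lemma continuous_affine (c d : C) : continuous (fun z : C => c + d * z).
Proof.
move=> z; apply: (@continuousD _ _ _ (cst c) (fun z => d * z)); first exact: cst_continuous.
apply: (@continuousM _ _ (cst d) id); [exact: cst_continuous|exact: cvg_id].
Qed.

(** The fixed coordinate comes first, so that [hline y] and [vline x] are paths to be composed with
    [f]. *)
Definition hline (y x : R) : C := Complex x y.
Definition vline (x y : R) : C := Complex x y.

Lemma nm_hlineB y x x' : nm (hline y x - hline y x') = `|x - x'|.
Proof. by rewrite nmE /= subrr expr0n addr0 sqrtr_sqr. Qed.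
Lemma nm_vlineB x y y' : nm (vline x y - vline x y') = `|y - y'|.
Proof. by rewrite nmE /= subrr expr0n add0r sqrtr_sqr. Qed.

Lemma continuous_hline y : continuous (hline y).
Proof.
move=> x A /nbhsCP[e e0 eA]; apply/nbhs_ballP; exists e => // x' xx'; apply: eA.
by rewrite nm_hlineB distrC.
Qed.

Lemma continuous_vline y : continuous (vline y).
Proof.
move=> x A /nbhsCP[e e0 eA]; apply/nbhs_ballP; exists e => // x' xx'; apply: eA.
by rewrite nm_vlineB distrC.
Qed.

Definition ci (p q : R) (F : R -> C) : C := cint leb `[p, q] F.

(** Two-sided continuity even at the end points: it composes pointwise, and the integrands of
    interest are continuous around the whole segment. *)
Definition con (p q : R) (F : R -> C) := forall t, p <= t <= q -> {for t, continuous F}.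

Lemma cintegrable_con p q F : con p q F -> cintegrable leb `[p, q] F.
Proof.
move=> H; split; apply: continuous_compact_integrable => //; try exact: segment_compact;
  apply: continuous_in_subspaceT => t; rewrite inE /= in_itv /= => tpq;
  apply: continuous_comp; [exact: H| |exact: H|].
- exact: continuous_Re.
- exact: continuous_Im.
Qed.

Lemma ci_split p m q F : p <= m -> m <= q -> con p q F ->
  ci p q F = ci p m F + ci m q F.
Proof.
move=> pm mq /cintegrable_con [iR iI].
by apply: complex_ext; rewrite /= addrC; apply/eqP; rewrite -subr_eq; apply/eqP;
  rewrite Rintegral_itvB ?bnd_simp// Rintegral_itv_obnd_cbnd//;
  [move: iR|move: iI]; apply: integrableS => //; apply: subset_itvr; rewrite bnd_simp.
Qed.

Lemma Rintegral_itv_cst p q (c : R) : p <= q -> Rintegral leb `[p, q] (fun=> c) = c * (q - p).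
Proof.
move=> pq; rewrite Rintegral_cst//= lebesgue_measure_itv /= lte_fin.
by case: ltP => //= qp; rewrite (le_anti (introT andP (conj pq qp))) subrr.
Qed.

Lemma integrable_itv_cst p q (c : R) : leb.-integrable `[p, q] (EFin \o (fun=> c)).
Proof.
apply: continuous_compact_integrable; first exact: segment_compact.
by apply: continuous_in_subspaceT => t _; exact: cvg_cst.
Qed.

Lemma ci_cst p q (c : C) : p <= q -> ci p q (fun=> c) = c * ((q - p)%:C)%C.
Proof.
move=> pq; apply: complex_ext; rewrite /= Rintegral_itv_cst// ?ReM ?ImM /=; ring.
Qed.

Lemma ci_le p q F (M : R) : p <= q -> con p q F -> (forall t, p <= t <= q -> nm (F t) <= M) ->
  nm (ci p q F) <= 2 * M * (q - p).
Proof.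
move=> pq cF FM; rewrite -mulrA -Rintegral_itv_cst//; apply: nm_cint_le => //.
- exact: cintegrable_con.
- exact: integrable_itv_cst.
Qed.

Lemma ciB p q F G : con p q F -> con p q G ->
  ci p q (fun t => F t - G t) = ci p q F - ci p q G.
Proof. by move=> cF cG; apply: cintB => //; exact: cintegrable_con. Qed.

Lemma ciZ p q F c : con p q F -> ci p q (fun t => c * F t) = c * ci p q F.
Proof. by move=> cF; apply: cintZ => //; exact: cintegrable_con. Qed.

Lemma eq_ci p q F G : (forall t, p <= t <= q -> F t = G t) -> ci p q F = ci p q G.
Proof. by move=> FG; apply: eq_cint => t /=; rewrite in_itv /= => /FG. Qed.

(** The counterclockwise integral of f(z) dz: dz is dx on the horizontal sides and i dy on the
    vertical ones, and the top and left sides are run backwards. *)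
Definition rectI (f : C -> C) (x0 x1 y0 y1 : R) : C :=
  (ci x0 x1 (f \o hline y0) - ci x0 x1 (f \o hline y1)) +
  'i%C * (ci y0 y1 (f \o vline x1) - ci y0 y1 (f \o vline x0)).

Definition bdry (x0 x1 y0 y1 : R) (z : C) : Prop :=
  [/\ x0 <= complex.Re z <= x1, y0 <= complex.Im z <= y1 &
   [\/ complex.Re z = x0, complex.Re z = x1, complex.Im z = y0 | complex.Im z = y1]].

Definition bcont (f : C -> C) x0 x1 y0 y1 :=
  forall z, bdry x0 x1 y0 y1 z -> {for z, continuous f}.

Lemma con_hline (f : C -> C) y p q : (forall x, p <= x <= q -> {for Complex x y, continuous f}) ->
  con p q (f \o hline y).
Proof. by move=> H x xpq; apply: continuous_comp; [exact: continuous_hline|exact: H]. Qed.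

Lemma con_vline (f : C -> C) x p q : (forall y, p <= y <= q -> {for Complex x y, continuous f}) ->
  con p q (f \o vline x).
Proof. by move=> H y ypq; apply: continuous_comp; [exact: continuous_vline|exact: H]. Qed.

Section boundary.
Variables (x0 x1 y0 y1 : R).
Hypotheses (x01 : x0 <= x1) (y01 : y0 <= y1).

Lemma bdry_h0 x : x0 <= x <= x1 -> bdry x0 x1 y0 y1 (hline y0 x).
Proof. by move=> xx; split => //=; [rewrite lexx|constructor 3]. Qed.
Lemma bdry_h1 x : x0 <= x <= x1 -> bdry x0 x1 y0 y1 (hline y1 x).
Proof. by move=> xx; split => //=; [rewrite lexx y01|constructor 4]. Qed.
Lemma bdry_v0 y : y0 <= y <= y1 -> bdry x0 x1 y0 y1 (vline x0 y).
Proof. by move=> xx; split => //=; [rewrite lexx|constructor 1]. Qed.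
Lemma bdry_v1 y : y0 <= y <= y1 -> bdry x0 x1 y0 y1 (vline x1 y).
Proof. by move=> xx; split => //=; [rewrite lexx x01|constructor 2]. Qed.

Lemma bcontP f : bcont f x0 x1 y0 y1 ->
  [/\ con x0 x1 (f \o hline y0), con x0 x1 (f \o hline y1),
      con y0 y1 (f \o vline x0) & con y0 y1 (f \o vline x1)].
Proof.
move=> H; split; [apply: con_hline|apply: con_hline|apply: con_vline|apply: con_vline];
  move=> t tt; apply: H; [exact: bdry_h0|exact: bdry_h1|exact: bdry_v0|exact: bdry_v1].
Qed.

Lemma eq_rectI f g : (forall z, bdry x0 x1 y0 y1 z -> f z = g z) ->
  rectI f x0 x1 y0 y1 = rectI g x0 x1 y0 y1.
Proof.
move=> fg; rewrite /rectI; congr (_ - _ + _ * (_ - _)); apply: eq_ci => t tt /=; apply: fg.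
- exact: bdry_h0.
- exact: bdry_h1.
- exact: bdry_v1.
- exact: bdry_v0.
Qed.

Lemma rectIB f g : bcont f x0 x1 y0 y1 -> bcont g x0 x1 y0 y1 ->
  rectI (fun z => f z - g z) x0 x1 y0 y1 = rectI f x0 x1 y0 y1 - rectI g x0 x1 y0 y1.
Proof.
move=> /bcontP[f1 f2 f3 f4] /bcontP[g1 g2 g3 g4].
rewrite /rectI.
have -> : ci x0 x1 ((fun z => f z - g z) \o hline y0) = _ := ciB f1 g1.
have -> : ci x0 x1 ((fun z => f z - g z) \o hline y1) = _ := ciB f2 g2.
have -> : ci y0 y1 ((fun z => f z - g z) \o vline x0) = _ := ciB f3 g3.
have -> : ci y0 y1 ((fun z => f z - g z) \o vline x1) = _ := ciB f4 g4.
ring.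
Qed.

Lemma rectIZ f c : bcont f x0 x1 y0 y1 ->
  rectI (fun z => c * f z) x0 x1 y0 y1 = c * rectI f x0 x1 y0 y1.
Proof.
move=> /bcontP[f1 f2 f3 f4].
rewrite /rectI.
have -> : ci x0 x1 ((fun z => c * f z) \o hline y0) = _ := ciZ c f1.
have -> : ci x0 x1 ((fun z => c * f z) \o hline y1) = _ := ciZ c f2.
have -> : ci y0 y1 ((fun z => c * f z) \o vline x0) = _ := ciZ c f3.
have -> : ci y0 y1 ((fun z => c * f z) \o vline x1) = _ := ciZ c f4.
ring.
Qed.

Lemma nm_i : nm ('i%C : C) = 1.
Proof. by rewrite nmE /= expr0n expr1n add0r sqrtr1. Qed.

(** Each side costs the factor 2 of [ci_le], and opposite sides have equal length; hence 4 times the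
    half perimeter. *)
Lemma rectI_le f (M : R) : bcont f x0 x1 y0 y1 ->
  (forall z, bdry x0 x1 y0 y1 z -> nm (f z) <= M) ->
  nm (rectI f x0 x1 y0 y1) <= 4 * M * ((x1 - x0) + (y1 - y0)).
Proof.
move=> /bcontP[f1 f2 f3 f4] fM; rewrite /rectI.
apply: (le_trans (nmD _ _)); rewrite nmM nm_i mul1r.
have := nmD (ci x0 x1 (f \o hline y0)) (- ci x0 x1 (f \o hline y1)).
have := nmD (ci y0 y1 (f \o vline x1)) (- ci y0 y1 (f \o vline x0)).
rewrite !nmN.
have := ci_le x01 f1 (fun t tt => fM _ (bdry_h0 tt)).
have := ci_le x01 f2 (fun t tt => fM _ (bdry_h1 tt)).
have := ci_le y01 f3 (fun t tt => fM _ (bdry_v0 tt)).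
have := ci_le y01 f4 (fun t tt => fM _ (bdry_v1 tt)).
by move=> h1 h2 h3 h4 h5 h6; lra.
Qed.

(** Opposite sides differ by a constant, so both differences integrate to the same product of side
    lengths with opposite signs. No antiderivative is involved. *)
Lemma rectI_affine (c d : C) : rectI (fun z => c + d * z) x0 x1 y0 y1 = 0.
Proof.
have ch y : con x0 x1 ((fun z => c + d * z) \o hline y).
  by apply: con_hline => x _; exact: continuous_affine.
have cv x : con y0 y1 ((fun z => c + d * z) \o vline x).
  by apply: con_vline => y _; exact: continuous_affine.
rewrite /rectI -(ciB (ch y0) (ch y1)) -(ciB (cv x1) (cv x0)).
rewrite (@eq_ci _ _ _ (fun=> d * Complex 0 (y0 - y1))); last first.
  move=> t _ /=; rewrite opprD addrACA subrr add0r -mulrBr; congr (_ * _).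
  by apply: complex_ext; rewrite /= ?subrr.
rewrite [X in _ + _ * X](@eq_ci _ _ _ (fun=> d * Complex (x1 - x0) 0)); last first.
  move=> t _ /=; rewrite opprD addrACA subrr add0r -mulrBr; congr (_ * _).
  by apply: complex_ext; rewrite /= ?subrr.
rewrite !ci_cst//; apply: complex_ext; rewrite !(ReM, ImM, ReD, ImD) /=; ring.
Qed.
End boundary.

(** The common vertical side cancels as an expression; continuity serves to cut the two horizontal
    sides. *)
Lemma rectI_splitx (f : C -> C) x0 x1 x2 y0 y1 : x0 <= x1 -> x1 <= x2 ->
  (forall x, x0 <= x <= x2 ->
     {for Complex x y0, continuous f} /\ {for Complex x y1, continuous f}) ->
  rectI f x0 x2 y0 y1 = rectI f x0 x1 y0 y1 + rectI f x1 x2 y0 y1.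
Proof.
move=> x01 x12 H; rewrite /rectI !(@ci_split x0 x1 x2)//; first by ring.
- by apply: con_hline => x /H[].
- by apply: con_hline => x /H[].
Qed.

Lemma rectI_splity (f : C -> C) x0 x1 y0 y1 y2 : y0 <= y1 -> y1 <= y2 ->
  (forall y, y0 <= y <= y2 ->
     {for Complex x0 y, continuous f} /\ {for Complex x1 y, continuous f}) ->
  rectI f x0 x1 y0 y2 = rectI f x0 x1 y0 y1 + rectI f x0 x1 y1 y2.
Proof.
move=> x01 x12 H; rewrite /rectI !(@ci_split y0 y1 y2)//; first by ring.
- by apply: con_vline => x /H[].
- by apply: con_vline => x /H[].
Qed.
End Rectangles.
#[global] Arguments rectI : simpl never.

(** * Goursat's theorem on rectangles *)

Section Goursat.
Variable R : realType.
Local Notation C := (Cplx R).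
Local Notation nm := (@Normc.normc R).

Definition cbox (x0 x1 y0 y1 : R) (z : C) : Prop :=
  x0 <= complex.Re z <= x1 /\ y0 <= complex.Im z <= y1.

Lemma bdry_cbox x0 x1 y0 y1 z : bdry x0 x1 y0 y1 z -> cbox x0 x1 y0 y1 z.
Proof. by case. Qed.

Lemma nmB_cbox x0 x1 y0 y1 z w : cbox x0 x1 y0 y1 z -> cbox x0 x1 y0 y1 w ->
  nm (z - w) <= (x1 - x0) + (y1 - y0).
Proof.
move=> [/andP[a b] /andP[c d]] [/andP[a' b'] /andP[c' d']].
apply: (le_trans (nm_le_ReIm _)); rewrite ReB ImB lerD// ler_norml; apply/andP; split; lra.
Qed.

Section bisection.
Variables (f : C -> C) (x0 x1 y0 y1 eps : R).
Hypotheses (x01 : x0 <= x1) (y01 : y0 <= y1) (eps0 : 0 < eps).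
Hypothesis df : forall z, cbox x0 x1 y0 y1 z -> derivable f z (1 : C).
Let a := x1 - x0.
Let b := y1 - y0.
Let h (n : nat) : R := 2^-1 ^+ n.

(** [p] is the lower left corner of a rectangle of the [n]-th generation. The threshold is
    proportional to the squared half perimeter, which is divided by 4 at each bisection. *)
Let bad n (p : R * R) := [/\ x0 <= p.1, p.1 + a * h n <= x1, y0 <= p.2, p.2 + b * h n <= y1 &
  eps * ((a + b) * h n) ^+ 2 <
    nm (rectI f p.1 (p.1 + a * h n) p.2 (p.2 + b * h n))].

Let h_gt0 n : 0 < h n. Proof. by rewrite exprn_gt0// invr_gt0. Qed.
Let hS n : h n = 2 * h n.+1. Proof. by rewrite /h exprS mulrA divff// mul1r. Qed.
Let a0 : 0 <= a. Proof. by rewrite subr_ge0. Qed.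
Let b0 : 0 <= b. Proof. by rewrite subr_ge0. Qed.

(** The integral is the sum over the four quarters. If each quarter were below the threshold, which
    is a quarter of the old one, the sum would be below the old one. *)
Let bad_step n p : bad n p -> exists q, [/\ bad n.+1 q, p.1 <= q.1,
  q.1 + a * h n.+1 <= p.1 + a * h n, p.2 <= q.2 & q.2 + b * h n.+1 <= p.2 + b * h n].
Proof.
case: p => x y [/= xa xb ya yb big].
have ah : 0 <= a * h n.+1 by rewrite mulr_ge0// ltW.
have bh : 0 <= b * h n.+1 by rewrite mulr_ge0// ltW.
have aE : a * h n = a * h n.+1 + a * h n.+1 by rewrite hS; ring.
have bE : b * h n = b * h n.+1 + b * h n.+1 by rewrite hS; ring.
have abE : (a + b) * h n = 2 * ((a + b) * h n.+1) by rewrite hS; ring.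
rewrite aE bE abE in big xb yb *.
rewrite /bad.
move: (a * h n.+1) (b * h n.+1) ah bh big xb yb {aE bE abE} => A B A0 B0 big xb yb.
have cf x' y' : x <= x' <= x + (A + A) -> y <= y' <= y + (B + B) ->
    {for Complex x' y', continuous f}.
  move=> /andP[u1 u2] /andP[v1 v2]; apply: derivable_continuousC; apply: df.
  by split => /=; apply/andP; split; lra.
have sum : rectI f x (x + (A + A)) y (y + (B + B)) =
    (rectI f x (x + A) y (y + B) + rectI f x (x + A) (y + B) (y + B + B)) +
    (rectI f (x + A) (x + A + A) y (y + B) + rectI f (x + A) (x + A + A) (y + B) (y + B + B)).
  rewrite !addrA.
  rewrite (@rectI_splitx _ f x (x + A) (x + A + A) y (y + B + B)); [|lra|lra|]; last first.
    by move=> x' /andP[u1 u2]; split; apply: cf; apply/andP; split; lra.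
  rewrite (@rectI_splity _ f x (x + A) y (y + B) (y + B + B)); [|lra|lra|]; last first.
    by move=> y' /andP[u1 u2]; split; apply: cf; apply/andP; split; lra.
  rewrite (@rectI_splity _ f (x + A) (x + A + A) y (y + B) (y + B + B)); [|lra|lra|]; last first.
    by move=> y' /andP[u1 u2]; split; apply: cf; apply/andP; split; lra.
  by rewrite !addrA.
apply: contrapT => noq.
have small x' y' : x <= x' -> x' + A <= x + (A + A) -> y <= y' -> y' + B <= y + (B + B) ->
    nm (rectI f x' (x' + A) y' (y' + B)) <= eps * ((a + b) * h n.+1) ^+ 2.
  move=> q1 q2 q3 q4; rewrite leNgt; apply/negP => qbig; apply: noq.
  exists (x', y'); split; [split|exact: q1|exact: q2|exact: q3|exact: q4].
  - exact: le_trans xa q1.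
  - exact: le_trans q2 xb.
  - exact: le_trans ya q3.
  - exact: le_trans q4 yb.
  - exact: qbig.
have s1 : nm (rectI f x (x + A) y (y + B)) <= eps * ((a + b) * h n.+1) ^+ 2.
  by apply: small; rewrite ?lexx ?lerD2l ?lerDl.
have s2 : nm (rectI f (x + A) (x + A + A) y (y + B)) <= eps * ((a + b) * h n.+1) ^+ 2.
  by apply: small; rewrite -?addrA ?lexx ?lerD2l ?lerDl.
have s3 : nm (rectI f x (x + A) (y + B) (y + B + B)) <= eps * ((a + b) * h n.+1) ^+ 2.
  by apply: small; rewrite -?addrA ?lexx ?lerD2l ?lerDl.
have s4 : nm (rectI f (x + A) (x + A + A) (y + B) (y + B + B)) <= eps * ((a + b) * h n.+1) ^+ 2.
  by apply: small; rewrite -?addrA ?lexx ?lerD2l ?lerDl.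
rewrite sum in big; clear small.
have t1 := nmD (rectI f x (x + A) y (y + B) + rectI f x (x + A) (y + B) (y + B + B))
  (rectI f (x + A) (x + A + A) y (y + B) + rectI f (x + A) (x + A + A) (y + B) (y + B + B)).
have t2 := nmD (rectI f x (x + A) y (y + B)) (rectI f x (x + A) (y + B) (y + B + B)).
have t3 := nmD (rectI f (x + A) (x + A + A) y (y + B))
  (rectI f (x + A) (x + A + A) (y + B) (y + B + B)).
move: big s1 s2 s3 s4 t1 t2 t3; rewrite exprMn mulrCA.
move: (eps * _) => E; lra.
Qed.

(** Otherwise nested bad rectangles shrink to a point [z]. Near [z] the function is affine up to a
    small multiple of the distance, and affine functions integrate to 0, which contradicts
    badness. *)
Lemma goursat_bisection : nm (rectI f x0 x1 y0 y1) <= eps * (a + b) ^+ 2.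
Proof.
rewrite leNgt; apply/negP => big.
(* The successor is chosen for every pair; at a rectangle that is not bad it is an arbitrary
   default. *)
have /choice[g gP] : forall np : nat * (R * R), exists q, bad np.1 np.2 ->
    [/\ bad np.1.+1 q, np.2.1 <= q.1, q.1 + a * h np.1.+1 <= np.2.1 + a * h np.1,
     np.2.2 <= q.2 & q.2 + b * h np.1.+1 <= np.2.2 + b * h np.1].
  move=> [n p] /=; have [/bad_step[q]|nb] := pselect (bad n p); first by exists q.
  by exists p.
pose s := fix s n := if n is n.+1 then g (n, s n) else (x0, y0).
have sbad n : bad n (s n).
  elim: n => [|n ih]; last by have [] := gP (n, s n) ih.
  by split => /=; rewrite ?lexx// /h expr0 !mulr1 /a /b ?subrKC.
have nest n m : [/\ (s n).1 <= (s (n + m)%N).1,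
   (s (n + m)%N).1 + a * h (n + m)%N <= (s n).1 + a * h n,
   (s n).2 <= (s (n + m)%N).2 & (s (n + m)%N).2 + b * h (n + m)%N <= (s n).2 + b * h n].
  elim: m => [|m [i1 i2 i3 i4]]; first by rewrite addn0.
  rewrite addnS; have [_ /= j1 j2 j3 j4] := gP ((n + m)%N, s (n + m)%N) (sbad _).
  by split; [exact: le_trans i1 j1|exact: le_trans j2 i2|
    exact: le_trans i3 j3|exact: le_trans j4 i4].
have ubd n m : (s m).1 <= (s n).1 + a * h n /\ (s m).2 <= (s n).2 + b * h n.
  have ah k : 0 <= a * h k by rewrite mulr_ge0// ltW.
  have bh k : 0 <= b * h k by rewrite mulr_ge0// ltW.
  have [nm|mn] := leqP n m.
    by have := nest n (m - n)%N; rewrite subnKC// => -[_ + _ +];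
      have := ah m; have := bh m; split; lra.
  by have := nest m (n - m)%N; rewrite subnKC 1?ltnW// => -[+ _ + _];
      have := ah n; have := bh n; split; lra.
(* The lower left corners increase and remain below every upper right corner, so their suprema give
   a point common to all the rectangles. *)
pose X := sup (range (fun n => (s n).1)); pose Y := sup (range (fun n => (s n).2)).
have sX n : (s n).1 <= X <= (s n).1 + a * h n.
  apply/andP; split.
    apply: sup_ubound; last by exists n.
    by exists ((s 0%N).1 + a * h 0%N) => _ [m _ <-]; have [] := ubd 0%N m.
  apply: ge_sup; first by exists (s 0%N).1; exists 0%N.
  by move=> _ [m _ <-]; have [] := ubd n m.
have sY n : (s n).2 <= Y <= (s n).2 + b * h n.
  apply/andP; split.
    apply: sup_ubound; last by exists n.
    by exists ((s 0%N).2 + b * h 0%N) => _ [m _ <-]; have [] := ubd 0%N m.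
  apply: ge_sup; first by exists (s 0%N).2; exists 0%N.
  by move=> _ [m _ <-]; have [] := ubd n m.
pose z : C := Complex X Y.
have boxsub n w : cbox (s n).1 ((s n).1 + a * h n) (s n).2 ((s n).2 + b * h n) w ->
    cbox x0 x1 y0 y1 w.
  have [? ? ? ? _] := sbad n.
  by move=> [/andP[? ?] /andP[? ?]]; split; apply/andP; split; lra.
have zbox n : cbox (s n).1 ((s n).1 + a * h n) (s n).2 ((s n).2 + b * h n) z.
  by split; [exact: sX|exact: sY].
have /derivableP /is_derivecP dz := df (boxsub 0%N _ (zbox 0%N)).
set d := 'D_1 f z in dz.
(* [eps / 4] offsets the factor 4 of [rectI_le]; the two factors of the half perimeter come from the
   length of the contour and from the distance to [z]. *)
have [del del0 delP] := dz (eps / 4) (divr_gt0 eps0 (ltr0n _ 4)).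
have [n hn] : exists n, (a + b) * h n < del.
  have ab0 : 0 <= a + b by rewrite addr_ge0.
  have : (fun n => (a + b) * h n) @ \oo --> (a + b) * 0.
    apply: cvgM; first exact: cvg_cst.
    by apply: cvg_expr; rewrite ger0_norm ?invr_ge0// invf_lt1// ltr1n.
  rewrite mulr0 => /cvgr0_norm_lt /(_ del del0) [n _ nP].
  by exists n; apply: le_lt_trans (nP n (leqnn n)); exact: ler_norm.
have [xa xb ya yb bign] := sbad n.
have xx : (s n).1 <= (s n).1 + a * h n by rewrite lerDl mulr_ge0// ltW.
have yy : (s n).2 <= (s n).2 + b * h n by rewrite lerDl mulr_ge0// ltW.
have bf : bcont f (s n).1 ((s n).1 + a * h n) (s n).2 ((s n).2 + b * h n).
  by move=> w /bdry_cbox /boxsub /df /derivable_continuousC.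
pose aff (w : C) := (f z - d * z) + d * w.
have baff : bcont aff (s n).1 ((s n).1 + a * h n) (s n).2 ((s n).2 + b * h n).
  by move=> w _; exact: continuous_affine.
have := rectIB xx yy bf baff; rewrite rectI_affine// subr0 => E.
move: bign; apply/negP; rewrite -leNgt -E.
have side : ((s n).1 + a * h n - (s n).1) + ((s n).2 + b * h n - (s n).2) = (a + b) * h n.
  by ring.
have -> : eps * ((a + b) * h n) ^+ 2 = 4 * (eps / 4 * ((a + b) * h n)) *
   (((s n).1 + a * h n - (s n).1) + ((s n).2 + b * h n - (s n).2)).
  by rewrite side; field.
apply: rectI_le; [exact: xx|exact: yy| |].
  by move=> w wb; apply: (@continuousB _ _ _ f aff); [exact: bf|exact: baff].
move=> w /bdry_cbox wb.
have dist : nm (w - z) <= (a + b) * h n by rewrite -side; exact: nmB_cbox.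
have := delP (w - z) (le_lt_trans dist hn); rewrite subrK.
have -> : f w - f z - (w - z) * d = f w - aff w by rewrite /aff; ring.
move=> /le_trans; apply; rewrite ler_wpM2l// ltW// divr_gt0//.
Qed.
End bisection.

Lemma goursat (f : C -> C) (x0 x1 y0 y1 : R) : x0 <= x1 -> y0 <= y1 ->
  (forall z, cbox x0 x1 y0 y1 z -> derivable f z (1 : C)) -> rectI f x0 x1 y0 y1 = 0.
Proof.
move=> x01 y01 df; apply/eqP; rewrite -nm_eq0 eq_le nm_ge0 andbT.
set K := (x1 - x0 + (y1 - y0)) ^+ 2.
(* [K] vanishes for a rectangle reduced to a point, hence the division by [K + 1]. *)
have K1 : 0 < K + 1 by rewrite ltr_wpDl// sqr_ge0.
apply/ler_addgt0Pl => e e0; rewrite addr0.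
apply: (le_trans (goursat_bisection x01 y01 (divr_gt0 e0 K1) df)).
by rewrite -/K mulrAC ler_pdivrMr// ler_pM2l// lerDl.
Qed.
End Goursat.

(** * Rules of complex differentiation *)

Section Calculus.
Variable R : realType.
Local Notation C := (Cplx R).
Local Notation nm := (@Normc.normc R).

Definition hol (f : C -> C) (z : C) := derivable f z (1 : C).

Lemma holM (f g : C -> C) z : hol f z -> hol g z -> hol (fun x => f x * g x) z.
Proof. by move=> hf hg; exact: (derivableM hf hg). Qed.
Lemma holD (f g : C -> C) z : hol f z -> hol g z -> hol (fun x => f x + g x) z.
Proof. by move=> hf hg; exact: (derivableD hf hg). Qed.
Lemma holB (f g : C -> C) z : hol f z -> hol g z -> hol (fun x => f x - g x) z.
Proof. by move=> hf hg; exact: (derivableB hf hg). Qed.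
Lemma holV (f : C -> C) z : hol f z -> f z != 0 -> hol (fun x => (f x)^-1) z.
Proof. by move=> hf f0; exact: (derivableV f0 hf). Qed.
Lemma hol_id z : hol id z.
Proof. by apply: derivable_id. Qed.
Lemma hol_cst c z : hol (fun=> c) z.
Proof. by apply: derivable_cst. Qed.
Lemma holX (f : C -> C) n z : hol f z -> hol (fun x => f x ^+ n) z.
Proof.
move=> hf; elim: n => [|n ih]; first exact: hol_cst.
have -> : (fun x => f x ^+ n.+1) = (fun x => f x * f x ^+ n) by apply/funext => x; rewrite exprS.
exact: holM.
Qed.
Lemma hol_sum n (f : nat -> C -> C) z : (forall k, (k < n)%N -> hol (f k) z) ->
  hol (fun x => \sum_(k < n) f k x) z.
Proof.
elim: n => [|n ih] H.
  by have -> : (fun x => \sum_(k < 0) f k x) = (fun=> 0 : C);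
    [apply/funext => x; rewrite big_ord0|exact: hol_cst].
have -> : (fun x => \sum_(k < n.+1) f k x) = (fun x => \sum_(k < n) f k x + f n x).
  by apply/funext => x; rewrite big_ord_recr.
by apply: holD; [apply: ih => k kn; apply: H; rewrite ltnS ltnW|apply: H].
Qed.
Lemma hol_comp (f g : C -> C) z : hol f z -> hol g (f z) -> hol (fun x => g (f x)) z.
Proof.
move=> /derivable1_diffP hf /derivable1_diffP hg; apply/derivable1_diffP.
exact: (@differentiable_comp _ _ _ _ f g z hf hg).
Qed.

Lemma derive1M (f g : C -> C) z : hol f z -> hol g z ->
  derive1 (fun x => f x * g x) z = f z * derive1 g z + g z * derive1 f z.
Proof. by move=> hf hg; rewrite !derive1E; exact: (deriveM hf hg). Qed.
Lemma derive1D (f g : C -> C) z : hol f z -> hol g z ->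
  derive1 (fun x => f x + g x) z = derive1 f z + derive1 g z.
Proof. by move=> hf hg; rewrite !derive1E; exact: (deriveD hf hg). Qed.
Lemma derive1_csthol (c z : C) : derive1 (fun=> c) z = 0.
Proof. by rewrite derive1E; apply: derive_cst. Qed.
Lemma derive1_idhol (z : C) : derive1 id z = 1.
Proof. by rewrite derive1E; apply: derive_id. Qed.
Lemma is_derive_derive1 (f : C -> C) z d : is_derive z (1 : C) f d -> derive1 f z = d.
Proof. by move=> [_ <-]; rewrite derive1E. Qed.
Lemma hol_is_derive (f : C -> C) z : hol f z -> is_derive z (1 : C) f (derive1 f z).
Proof. by move=> hf; rewrite derive1E; exact: (derivableP hf). Qed.

Lemma near_hol (f g : C -> C) z e : 0 < e -> (forall w, nm (w - z) < e -> f w = g w) ->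
  hol f z -> hol g z.
Proof. by move=> e0 fg; apply: near_eq_derivable; apply/nbhsCP; exists e. Qed.

Lemma near_derive1 (f g : C -> C) z e : 0 < e -> (forall w, nm (w - z) < e -> f w = g w) ->
  derive1 f z = derive1 g z.
Proof.
by move=> e0 fg; rewrite !derive1E; apply: near_eq_derive; apply/nbhsCP; exists e.
Qed.
End Calculus.

Lemma contB (R : realType) (f g : Cplx R -> Cplx R) z : {for z, continuous f} ->
  {for z, continuous g} -> {for z, continuous (fun x => f x - g x)}.
Proof. by move=> cf cg; exact: (continuousB cf cg). Qed.

Lemma contM (R : realType) (f g : Cplx R -> Cplx R) z : {for z, continuous f} ->
  {for z, continuous g} -> {for z, continuous (fun x => f x * g x)}.
Proof. by move=> cf cg; exact: (continuousM cf cg). Qed.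

(** * Cauchy's formula on rectangles *)

Section CauchyKernel.
Variable R : realType.
Local Notation C := (Cplx R).
Local Notation nm := (@Normc.normc R).
Variables (x0 x1 y0 y1 : R).
Hypotheses (x01 : x0 <= x1) (y01 : y0 <= y1).

(** A quantitative interior: on the boundary the kernel at [a] is bounded by powers of [d^-1], and a
    move of [a] by at most [d / 2] keeps the margin [d / 2]. *)
Definition within (d : R) (a : C) := [/\ d <= complex.Re a - x0, d <= x1 - complex.Re a,
  d <= complex.Im a - y0 & d <= y1 - complex.Im a].

Lemma within_dist d a z : within d a -> bdry x0 x1 y0 y1 z -> d <= nm (z - a).
Proof.
move=> [d1 d2 d3 d4] [_ _ b]; have := ler_Re (z - a); have := ler_Im (z - a).
rewrite ReB ImB !ler_norml => /andP[i1 i2] /andP[r1 r2].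
by case: b => e; lra.
Qed.

Lemma within_near d a h : within d a -> nm h <= d / 2 -> within (d / 2) (h + a).
Proof.
move=> [d1 d2 d3 d4] hd; have := ler_Re h; have := ler_Im h.
rewrite !ler_norml => /andP[i1 i2] /andP[r1 r2].
by split; rewrite ?ReD ?ImD; lra.
Qed.

(* The normalising factor is omitted: at [m = 1], [g = 1] this is [2 pi i], but only a lower
   bound on its modulus is needed (see [winding_ge]), never its value. *)
Definition cauchyT (m : nat) (g : C -> C) (a : C) : C :=
  rectI (fun z => (z - a)^-1 ^+ m * g z) x0 x1 y0 y1.

Lemma bcont_kernel m g d a : 0 < d -> within d a -> bcont g x0 x1 y0 y1 ->
  bcont (fun z => (z - a)^-1 ^+ m * g z) x0 x1 y0 y1.
Proof.
move=> d0 wa bg z zb; apply: (@continuousM _ _ (fun z => (z - a)^-1 ^+ m) g); last exact: bg.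
apply: derivable_continuousC; apply: holX; apply: holV.
  by apply: holB; [exact: hol_id|exact: hol_cst].
by rewrite -nm_gt0; apply: lt_le_trans (within_dist wa zb).
Qed.

Lemma nm_kernel_le m d a z : 0 < d -> within d a -> bdry x0 x1 y0 y1 z ->
  nm ((z - a)^-1 ^+ m) <= d^-1 ^+ m.
Proof.
move=> d0 wa zb; rewrite nmX nmV.
have dz := within_dist wa zb.
apply: lerXn2r; rewrite ?nnegrE ?invr_ge0 ?(ltW d0)//.
by rewrite lef_pV2// posrE// (lt_le_trans d0).
Qed.

Lemma cauchyT_le m g d a M : 0 < d -> within d a -> bcont g x0 x1 y0 y1 ->
  (forall z, bdry x0 x1 y0 y1 z -> nm (g z) <= M) ->
  nm (cauchyT m g a) <= 4 * (d^-1 ^+ m * M) * ((x1 - x0) + (y1 - y0)).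
Proof.
move=> d0 wa bg gM; apply: rectI_le; [exact: x01|exact: y01|exact: bcont_kernel wa bg|].
move=> z zb; rewrite nmM; apply: ler_pM; [exact: nm_ge0|exact: nm_ge0|exact: nm_kernel_le wa zb|].
exact: gM.
Qed.

Lemma bcont_bounded g : bcont g x0 x1 y0 y1 ->
  exists M, forall z, bdry x0 x1 y0 y1 z -> nm (g z) <= M.
Proof.
have seg p q (F : R -> C) : con p q F -> exists M, forall t, p <= t <= q -> nm (F t) <= M.
  move=> cF.
  have cn : {within `[p, q], continuous (fun t => `|complex.Re (F t)| + `|complex.Im (F t)|)}.
    apply: continuous_in_subspaceT => t; rewrite inE /= in_itv /= => tpq.
    apply: (@continuousD _ _ _ (fun t => `|complex.Re (F t)|) (fun t => `|complex.Im (F t)|)).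
    - apply: (@continuous_comp _ _ _ (fun t => complex.Re (F t)) (fun x => `|x|)).
        by apply: (@continuous_comp _ _ _ F); [exact: cF|exact: continuous_Re].
      exact: norm_continuous.
    - apply: (@continuous_comp _ _ _ (fun t => complex.Im (F t)) (fun x => `|x|)).
        by apply: (@continuous_comp _ _ _ F); [exact: cF|exact: continuous_Im].
      exact: norm_continuous.
  have [pq|qp] := leP p q; last first.
    by exists 0 => t /andP[t1 t2]; have := le_trans t1 t2; rewrite leNgt qp.
  have [c _ cM] := EVT_max pq cn.
  exists (`|complex.Re (F c)| + `|complex.Im (F c)|) => t tpq.
  by apply: le_trans (nm_le_ReIm _) (cM t _); rewrite in_itv.
move=> /(bcontP x01 y01)[/seg[M1 h1] /seg[M2 h2] /seg[M3 h3] /seg[M4 h4]].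
have m1 : M1 <= `|M1| + `|M2| + `|M3| + `|M4|.
  have := ler_norm M1; have := normr_ge0 M2; have := normr_ge0 M3; have := normr_ge0 M4; lra.
have m2 : M2 <= `|M1| + `|M2| + `|M3| + `|M4|.
  have := ler_norm M2; have := normr_ge0 M1; have := normr_ge0 M3; have := normr_ge0 M4; lra.
have m3 : M3 <= `|M1| + `|M2| + `|M3| + `|M4|.
  have := ler_norm M3; have := normr_ge0 M2; have := normr_ge0 M1; have := normr_ge0 M4; lra.
have m4 : M4 <= `|M1| + `|M2| + `|M3| + `|M4|.
  have := ler_norm M4; have := normr_ge0 M2; have := normr_ge0 M3; have := normr_ge0 M1; lra.
exists (`|M1| + `|M2| + `|M3| + `|M4|) => -[x y] [/= xx yy [] e]; rewrite e.
- exact: le_trans (h3 _ yy) m3.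
- exact: le_trans (h4 _ yy) m4.
- exact: le_trans (h1 _ xx) m1.
- exact: le_trans (h2 _ xx) m2.
Qed.

(** First-order Taylor remainder of the kernel, by explicit algebra. Exponent 1 serves to
    differentiate Cauchy's integral once, exponent 2 to differentiate the result again. The worse
    case is 2, with factors 1, 4 and 4, whence 16. *)
Lemma kernel_remainder (m : nat) (u h : C) (d : R) : 0 < d -> d <= nm u -> nm h <= d / 2 ->
  (m = 1%N \/ m = 2%N) ->
  nm ((u - h)^-1 ^+ m - u^-1 ^+ m - h * (m%:R * u^-1 ^+ m.+1)) <= 16 * (d^-1 ^+ m.+2) * nm h ^+ 2.
Proof.
move=> d0 du hd m12.
have u0 : u != 0 by rewrite -nm_gt0 (lt_le_trans d0).
have uh : d / 2 <= nm (u - h).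
  by apply: le_trans (nmB_ge u h); lra.
have uh0 : u - h != 0 by rewrite -nm_gt0; apply: lt_le_trans uh; rewrite divr_gt0.
have iu : nm (u^-1) <= d^-1 by rewrite nmV lef_pV2// posrE// (lt_le_trans d0).
have iuh : nm ((u - h)^-1) <= 2 * d^-1.
  rewrite nmV -[2 * _]invrK invfM invrK mulrC lef_pV2// posrE ?divr_gt0//.
  by rewrite nm_gt0.
have dV0 : 0 <= d^-1 by rewrite invr_ge0 ltW.
have hdV : nm h * d^-1 <= 1 / 2 by rewrite ler_pdivrMr//; lra.
have nh2 : 0 <= nm h ^+ 2 by rewrite exprn_ge0.
case: m12 => ->.
  have -> : (u - h)^-1 ^+ 1 - u^-1 ^+ 1 - h * (1%:R * u^-1 ^+ 2) =
      h ^+ 2 * (u^-1 ^+ 2 * (u - h)^-1).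
    by field; rewrite u0 uh0.
  rewrite nmM nmX mulrC ler_wpM2r// nmM nmX.
  have : nm u^-1 ^+ 2 * nm (u - h)^-1 <= d^-1 ^+ 2 * (2 * d^-1).
    by apply: ler_pM => //; [rewrite exprn_ge0|apply: lerXn2r; rewrite ?nnegrE].
  move=> /le_trans; apply; have : 0 <= d^-1 ^+ 3 by rewrite exprn_ge0.
  by rewrite (exprSr _ 2); lra.
have -> : (u - h)^-1 ^+ 2 - u^-1 ^+ 2 - h * (2%:R * u^-1 ^+ 3) =
    h ^+ 2 * (u^-1 ^+ 2 * (u - h)^-1 ^+ 2 * (3%:R - 2%:R * (h * u^-1))).
  by field; rewrite u0 uh0.
rewrite nmM nmX mulrC ler_wpM2r// (nmM (_ * _)) (nmM (u^-1 ^+ 2)) !nmX.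
have b3 : nm (3%:R - 2%:R * (h * u^-1)) <= 4.
  apply: le_trans (nmD _ _) _; rewrite nmN !nmM.
  have -> : nm (3%:R : C) = 3 by have := @nm_real R 3; rewrite ger0_norm// rmorph_nat.
  have -> : nm (2%:R : C) = 2 by have := @nm_real R 2; rewrite ger0_norm// rmorph_nat.
  have : nm h * nm u^-1 <= nm h * d^-1 by rewrite ler_wpM2l.
  lra.
have : nm u^-1 ^+ 2 * nm (u - h)^-1 ^+ 2 * nm (3%:R - 2%:R * (h * u^-1)) <=
    d^-1 ^+ 2 * (2 * d^-1) ^+ 2 * 4.
  apply: ler_pM => //; first by rewrite mulr_ge0// exprn_ge0.
  by apply: ler_pM; rewrite ?exprn_ge0//; apply: lerXn2r; rewrite ?nnegrE// mulr_ge0.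
move=> /le_trans; apply; rewrite exprMn.
by have -> : d^-1 ^+ 2 * (2 ^+ 2 * d^-1 ^+ 2) * 4 = 16 * d^-1 ^+ 4 by ring.
Qed.

(** Differentiation under the integral sign: the kernel remainder is of order |h|^2 uniformly on the
    boundary, so its integral is too. *)
Lemma is_derive_cauchyT m g d a : 0 < d -> within d a -> bcont g x0 x1 y0 y1 ->
  (m = 1%N \/ m = 2%N) ->
  is_derive a (1 : C) (cauchyT m g) (m%:R * cauchyT m.+1 g a).
Proof.
move=> d0 wa bg m12; have [M gM] := bcont_bounded bg.
have d20 : 0 < d / 2 by rewrite divr_gt0.
set P := (x1 - x0) + (y1 - y0).
have P0 : 0 <= P by rewrite addr_ge0// subr_ge0.
set K := 16 * (d^-1 ^+ m.+2).
have K0 : 0 <= K by rewrite mulr_ge0// exprn_ge0// invr_ge0 ltW.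
apply/is_derivecP => e e0.
set L := 4 * (K * `|M|) * P.
have L0 : 0 <= L.
  by apply: mulr_ge0 P0; apply: mulr_ge0 => //; exact: mulr_ge0.
have L1 : 0 < L + 1 by rewrite ltr_wpDl.
exists (Num.min (d / 2) (e / (L + 1))); first by rewrite lt_min d20 divr_gt0.
move=> h; rewrite lt_min => /andP[h1 h2].
have wh := within_near wa (ltW h1).
have b1 := @bcont_kernel m _ _ _ d20 wh bg.
have b2 := @bcont_kernel m _ _ _ d0 wa bg.
have b3 := @bcont_kernel m.+1 _ _ _ d0 wa bg.
have b4 : bcont (fun z => (h * m%:R) * ((z - a)^-1 ^+ m.+1 * g z)) x0 x1 y0 y1.
  by move=> z zb; apply: contM (b3 z zb); exact: cst_continuous.
have b12 : bcont (fun z => (z - (h + a))^-1 ^+ m * g z - (z - a)^-1 ^+ m * g z) x0 x1 y0 y1.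
  by move=> z zb; exact: (contB (b1 z zb) (b2 z zb)).
have -> : cauchyT m g (h + a) - cauchyT m g a - h * (m%:R * cauchyT m.+1 g a) =
    rectI (fun z => ((z - (h + a))^-1 ^+ m * g z - (z - a)^-1 ^+ m * g z) -
      (h * m%:R) * ((z - a)^-1 ^+ m.+1 * g z)) x0 x1 y0 y1.
  rewrite (rectIB x01 y01 b12 b4) (rectIB x01 y01 b1 b2) (rectIZ x01 y01 _ b3).
  by rewrite /cauchyT mulrA.
apply: (@le_trans _ _ (4 * (K * nm h ^+ 2 * `|M|) * P)).
  apply: rectI_le; [exact: x01|exact: y01| |].
    by move=> z zb; exact: (contB (b12 z zb) (b4 z zb)).
  move=> z zb.
  have -> : (z - (h + a))^-1 ^+ m * g z - (z - a)^-1 ^+ m * g z -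
      (h * m%:R) * ((z - a)^-1 ^+ m.+1 * g z) =
      ((z - a - h)^-1 ^+ m - (z - a)^-1 ^+ m - h * (m%:R * (z - a)^-1 ^+ m.+1)) * g z.
    by rewrite (_ : z - (h + a) = z - a - h); ring.
  rewrite nmM; apply: ler_pM; [exact: nm_ge0|exact: nm_ge0| |].
    by apply: kernel_remainder => //; [exact: within_dist wa zb|exact: ltW].
  exact: le_trans (gM z zb) (ler_norm M).
have -> : 4 * (K * nm h ^+ 2 * `|M|) * P = (L * nm h) * nm h by rewrite /L; ring.
apply: ler_wpM2r; first exact: nm_ge0.
move: h2; rewrite ltr_pdivlMr; last exact: L1.
move=> h2.
have := nm_ge0 h; move: h2 L0; clear; move: (nm h) => x; nra.
Qed.
End CauchyKernel.

Section CauchyFormula.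
Variable R : realType.
Local Notation C := (Cplx R).
Local Notation nm := (@Normc.normc R).

(** Goursat's theorem disposes of the four rectangles around a small square centred at [a]. On that
    square [h] is bounded, so its integral tends to 0 with the side. *)
Lemma rectI_punctured (h : C -> C) a x0 x1 y0 y1 d M del : 0 < d -> within x0 x1 y0 y1 d a ->
  (forall z, cbox x0 x1 y0 y1 z -> z != a -> hol h z) ->
  0 < del -> (forall z, z != a -> nm (z - a) < del -> nm (h z) <= M) ->
  rectI h x0 x1 y0 y1 = 0.
Proof.
move=> d0 [d1 d2 d3 d4] hh del0 hM.
set ax := complex.Re a in d1 d2 *; set ay := complex.Im a in d3 d4 *.
have M0 : 0 <= M.
  pose w : C := a + Complex (del / 2) 0.
  have wa : w - a = Complex (del / 2) 0 by rewrite /w addrAC subrr add0r.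
  have nwa : nm (w - a) = del / 2.
    by rewrite wa nmE /= expr0n addr0 sqrtr_sqr ger0_norm// divr_ge0// ltW.
  apply: le_trans (hM w _ _); first exact: nm_ge0.
    by rewrite -subr_eq0 -nm_eq0 nwa gt_eqF// divr_gt0.
  by rewrite nwa; lra.
apply/eqP; rewrite -nm_eq0 eq_le nm_ge0 andbT.
apply/ler_addgt0Pl => e e0; rewrite addr0.
(* [d / 2] keeps the square inside the rectangle; [del / 8] keeps its points within [4 * r < del] of
   [a]; the last bound makes the estimate [16 * M * r] at most [e]. *)
pose r := Num.min (d / 2) (Num.min (del / 8) (e / (16 * (M + 1)))).
have M1 : 0 < 16 * (M + 1) by rewrite mulr_gt0// ltr_wpDl.
have r0 : 0 < r by rewrite !lt_min !divr_gt0.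
have [rd rdel re] : [/\ r <= d / 2, r <= del / 8 & r <= e / (16 * (M + 1))].
  by split; rewrite ?ge_min ?lexx ?orbT.
have off x y : (x != ax \/ y != ay) -> (Complex x y : C) != a.
  by move=> xy; apply/eqP => e1; case: xy => /eqP; apply; rewrite /ax /ay -e1.
have hc x y : x0 <= x <= x1 -> y0 <= y <= y1 -> (x != ax \/ y != ay) ->
    hol h (Complex x y).
  by move=> xx yy xy; apply: hh; [split|exact: off].
have cont x y : x0 <= x <= x1 -> y0 <= y <= y1 -> (x != ax \/ y != ay) ->
    {for (Complex x y : C), continuous h}.
  by move=> xx yy xy; apply: derivable_continuousC; exact: hc.
have Y0 : y0 != ay by rewrite lt_eqF//; lra.
have Y1 : y1 != ay by rewrite gt_eqF//; lra.
have X0 : ax - r != ax by rewrite lt_eqF//; lra.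
have X1 : ax + r != ax by rewrite gt_eqF//; lra.
have [x0l xlr xr1] : [/\ x0 <= ax - r, ax - r <= ax + r & ax + r <= x1] by split; lra.
have [y0l ylr yr1] : [/\ y0 <= ay - r, ay - r <= ay + r & ay + r <= y1] by split; lra.
have [y01 y0r yl1] : [/\ y0 <= y1, y0 <= ay + r & ay - r <= y1] by split; lra.
have xl1 := le_trans xlr xr1.
have xrange x : ax - r <= x <= ax + r -> x0 <= x <= x1.
  by move=> /andP[u1 u2]; rewrite (le_trans x0l u1) (le_trans u2 xr1).
have yrange y : ay - r <= y <= ay + r -> y0 <= y <= y1.
  by move=> /andP[u1 u2]; rewrite (le_trans y0l u1) (le_trans u2 yr1).
have xrange1 x : ax - r <= x <= x1 -> x0 <= x <= x1.
  by move=> /andP[u1 u2]; rewrite (le_trans x0l u1).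
have yrange1 y : ay - r <= y <= y1 -> y0 <= y <= y1.
  by move=> /andP[u1 u2]; rewrite (le_trans y0l u1).
rewrite (rectI_splitx x0l xl1); last first.
  by move=> x xx; split; apply: cont => //; rewrite ?lexx ?y01//; right.
have -> : rectI h x0 (ax - r) y0 y1 = 0.
  apply: goursat => // -[x y] [/= /andP[u1 u2] yy]; apply: hc => //.
    by rewrite u1 (le_trans u2 xl1).
  by left; rewrite lt_eqF// (le_lt_trans u2)// ltrBlDr ltrDl.
rewrite add0r (rectI_splitx xlr xr1); last first.
  by move=> x /xrange1 xx; split; apply: cont => //; rewrite ?lexx ?y01//; right.
have -> : rectI h (ax + r) x1 y0 y1 = 0.
  apply: goursat => // -[x y] [/= /andP[u1 u2] yy]; apply: hc => //.
    by rewrite u2 (le_trans (le_trans x0l xlr) u1).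
  by left; rewrite gt_eqF// (lt_le_trans _ u1)// ltrDl.
rewrite addr0 (rectI_splity y0l yl1); last first.
  by move=> y yy; split; apply: cont; rewrite ?xrange ?lexx ?xlr//; left.
have -> : rectI h (ax - r) (ax + r) y0 (ay - r) = 0.
  apply: goursat => // -[x y] [/= /xrange xx /andP[v1 v2]]; apply: hc => //.
    by rewrite v1 (le_trans v2 yl1).
  by right; rewrite lt_eqF// (le_lt_trans v2)// ltrBlDr ltrDl.
rewrite add0r (rectI_splity ylr yr1); last first.
  by move=> y /yrange1 yy; split; apply: cont; rewrite ?xrange ?lexx ?xlr//; left.
have -> : rectI h (ax - r) (ax + r) (ay + r) y1 = 0.
  apply: goursat => // -[x y] [/= /xrange xx /andP[v1 v2]]; apply: hc => //.
    by rewrite v2 (le_trans y0r v1).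
  by right; rewrite gt_eqF// (lt_le_trans _ v1)// ltrDl.
rewrite addr0.
apply: (@le_trans _ _ (4 * M * ((ax + r - (ax - r)) + (ay + r - (ay - r))))).
  have in_off z : bdry (ax - r) (ax + r) (ay - r) (ay + r) z -> z != a /\ cbox x0 x1 y0 y1 z.
    case: z => x y [/= xx yy b]; split; last by split; [exact: xrange|exact: yrange].
    have [yl yr] : ay - r != ay /\ ay + r != ay.
      by rewrite lt_eqF ?gt_eqF// ?ltrDl// ltrBlDr ltrDl.
    by apply: off; case: b => ->; [left|left|right|right].
  apply: rectI_le; [exact: xlr|exact: ylr| |].
    by move=> z /in_off[za zb]; apply: derivable_continuousC; exact: hh.
  move=> z zb; have [za _] := in_off _ zb; apply: hM => //.
  have ab : cbox (ax - r) (ax + r) (ay - r) (ay + r) a.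
    by split; rewrite -/ax -/ay lerBlDr !lerDl ltW.
  by apply: le_lt_trans (nmB_cbox (bdry_cbox zb) ab) _; lra.
have -> : 4 * M * ((ax + r - (ax - r)) + (ay + r - (ay - r))) = r * (16 * M) by ring.
move: re; rewrite ler_pdivlMr// => re; apply: le_trans re.
by rewrite ler_wpM2l ?(ltW r0)//; lra.
Qed.

(** The quotient (f z - f a) / (z - a) is holomorphic off [a] and bounded near it by |f'(a)| + 1, so
    its contour integral vanishes. *)
Lemma cauchy_formula (f : C -> C) x0 x1 y0 y1 d a : 0 < d -> within x0 x1 y0 y1 d a ->
  (forall z, cbox x0 x1 y0 y1 z -> hol f z) ->
  cauchyT x0 x1 y0 y1 1 f a = f a * cauchyT x0 x1 y0 y1 1 (fun=> 1) a.
Proof.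
move=> d0 wa df; have [d1 d2 d3 d4] := wa.
have x01 : x0 <= x1 by lra.
have y01 : y0 <= y1 by lra.
have ab : cbox x0 x1 y0 y1 a by split; apply/andP; split; lra.
have bf : bcont f x0 x1 y0 y1 by move=> z /bdry_cbox /df; exact: derivable_continuousC.
have b1 : bcont (fun=> 1 : C) x0 x1 y0 y1 by move=> z _; exact: cst_continuous.
have kf := @bcont_kernel _ _ _ _ _ 1 _ _ _ d0 wa bf.
have k1 := @bcont_kernel _ _ _ _ _ 1 _ _ _ d0 wa b1.
apply/eqP; rewrite -subr_eq0; apply/eqP.
rewrite /cauchyT -(rectIZ x01 y01 _ k1) -(rectIB x01 y01 kf); last first.
  by move=> z zb; apply: contM (k1 z zb); exact: cst_continuous.
have /hol_is_derive /is_derivecP /(_ 1 ltr01) [del del0 dH] := df _ ab.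
apply: (@rectI_punctured _ a _ _ _ _ d (nm (derive1 f a) + 1) del d0 wa _ del0).
  move=> z zb za; have hk : hol (fun z => (z - a)^-1 ^+ 1) z.
    apply: holX; apply: holV; last by rewrite subr_eq0.
    by apply: holB; [exact: hol_id|exact: hol_cst].
  apply: holB; first by apply: holM; [exact: hk|exact: df].
  apply: holM; first exact: hol_cst.
  by apply: holM; [exact: hk|exact: hol_cst].
move=> z za zd; rewrite expr1 mulr1.
have za0 : z - a != 0 by rewrite subr_eq0.
have := dH _ zd; rewrite subrK mul1r => H.
have -> : (z - a)^-1 * f z - f a * (z - a)^-1 =
   (f z - f a - (z - a) * derive1 f a) * (z - a)^-1 + derive1 f a.
  by field.
apply: le_trans (nmD _ _) _; rewrite addrC lerD2l nmM nmV ler_pdivrMr ?nm_gt0// mul1r.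
exact: H.
Qed.

Lemma ci_Re_ge p q (F : R -> C) c : p <= q -> con p q F ->
  (forall t, p <= t <= q -> c <= complex.Re (F t)) -> c * (q - p) <= complex.Re (ci p q F).
Proof.
move=> pq /cintegrable_con[iR iI] cF; rewrite -Rintegral_itv_cst//=.
apply: le_Rintegral => //; try exact: integrable_itv_cst.
Qed.

Lemma ci_Re_le0 p q (F : R -> C) : p <= q -> con p q F ->
  (forall t, p <= t <= q -> complex.Re (F t) <= 0) -> complex.Re (ci p q F) <= 0.
Proof.
move=> pq /cintegrable_con[iR iI] cF; rewrite -[leRHS](mul0r (q - p)) -Rintegral_itv_cst//=.
apply: le_Rintegral => //; try exact: integrable_itv_cst.
Qed.

Lemma ci_Im_ge0 p q (F : R -> C) : p <= q -> con p q F ->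
  (forall t, p <= t <= q -> 0 <= complex.Im (F t)) -> 0 <= complex.Im (ci p q F).
Proof.
move=> pq /cintegrable_con[iR iI] cF; rewrite -[leLHS](mul0r (q - p)) -Rintegral_itv_cst//=.
apply: le_Rintegral => //; try exact: integrable_itv_cst.
Qed.

Lemma ci_Im_le0 p q (F : R -> C) : p <= q -> con p q F ->
  (forall t, p <= t <= q -> complex.Im (F t) <= 0) -> complex.Im (ci p q F) <= 0.
Proof.
move=> pq /cintegrable_con[iR iI] cF; rewrite -[leRHS](mul0r (q - p)) -Rintegral_itv_cst//=.
apply: le_Rintegral => //; try exact: integrable_itv_cst.
Qed.

Lemma Re_inv (u v : R) : complex.Re ((Complex u v : C)^-1) = u / (u ^+ 2 + v ^+ 2).
Proof. by []. Qed.

Lemma Im_inv (u v : R) : complex.Im ((Complex u v : C)^-1) = - (v / (u ^+ 2 + v ^+ 2)).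
Proof. by []. Qed.

(** All four sides contribute a nonnegative imaginary part. On the right side the real part of the
    kernel is at least [d / (2 * L ^+ 2)], and that side has length at least [2 * d]. *)
Lemma winding_ge x0 x1 y0 y1 (a : C) d L : 0 < d -> within x0 x1 y0 y1 d a ->
  x1 - complex.Re a <= L -> complex.Im a - y0 <= L -> y1 - complex.Im a <= L ->
  d ^+ 2 / L ^+ 2 <= nm (cauchyT x0 x1 y0 y1 1 (fun=> 1) a).
Proof.
move=> d0 wa; have [d1 d2 d3 d4] := wa; move=> L1 L2 L3.
have x01 : x0 <= x1 by lra.
have y01 : y0 <= y1 by lra.
have L0 : 0 < L by lra.
have b1 : bcont (fun=> 1 : C) x0 x1 y0 y1 by move=> z _; exact: cst_continuous.
have kb := @bcont_kernel _ _ _ _ _ 1 _ _ _ d0 wa b1.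
apply: le_trans (ler_Im _); apply: le_trans (ler_norm _).
rewrite /cauchyT /rectI; set k := (fun z : C => _).
have kE x y : k (Complex x y) = (Complex (x - complex.Re a) (y - complex.Im a))^-1.
  by rewrite /k expr1 mulr1; congr (_^-1); case: (a).
have [c1 c2 c3 c4] := bcontP x01 y01 kb.
rewrite ImD ImB ImM !ReB !ImB [complex.Re 'i%C]/= [complex.Im 'i%C]/= mul0r add0r mul1r.
have s1 : 0 <= complex.Im (ci x0 x1 (k \o hline y0)).
  apply: (ci_Im_ge0 x01 c1) => t tt; rewrite (kE t y0 : (k \o hline y0) t = _).
  rewrite Im_inv -mulNr divr_ge0//; first lra.
  by rewrite addr_ge0// sqr_ge0.
have s2 : complex.Im (ci x0 x1 (k \o hline y1)) <= 0.
  apply: (ci_Im_le0 x01 c2) => t tt; rewrite (kE t y1 : (k \o hline y1) t = _).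
  rewrite Im_inv oppr_le0 divr_ge0//; first lra.
  by rewrite addr_ge0// sqr_ge0.
have s3 : complex.Re (ci y0 y1 (k \o vline x0)) <= 0.
  apply: (ci_Re_le0 y01 c3) => t tt; rewrite (kE x0 t : (k \o vline x0) t = _).
  rewrite Re_inv -oppr_ge0 -mulNr divr_ge0//; first lra.
  by rewrite addr_ge0// sqr_ge0.
have s4 : d / (2 * L ^+ 2) * (y1 - y0) <= complex.Re (ci y0 y1 (k \o vline x1)).
  apply: (ci_Re_ge y01 c4) => t /andP[t1 t2]; rewrite (kE x1 t : (k \o vline x1) t = _).
  rewrite Re_inv.
  set u := x1 - _; set v := t - _.
  have u0 : d <= u by [].
  have uL : u ^+ 2 <= L ^+ 2 by rewrite ler_sqr ?nnegrE; rewrite /u; lra.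
  have vL : v ^+ 2 <= L ^+ 2.
    have : - L <= v <= L by rewrite /v; apply/andP; split; lra.
    by move=> /andP[v1 v2]; nra.
  have L20 : 0 < 2 * L ^+ 2 by rewrite mulr_gt0// exprn_gt0.
  have uv0 : 0 < u ^+ 2 + v ^+ 2.
    have : 0 < u ^+ 2 by apply: exprn_gt0; exact: lt_le_trans d0 u0.
    by have := sqr_ge0 v; lra.
  apply: ler_pM; [exact: ltW|by rewrite invr_ge0 ltW|exact: u0|].
  by rewrite lef_pV2//; lra.
have : d ^+ 2 / L ^+ 2 <= d / (2 * L ^+ 2) * (y1 - y0).
  have -> : d ^+ 2 / L ^+ 2 = d / (2 * L ^+ 2) * (2 * d) by field; rewrite gt_eqF.
  apply: ler_wpM2l; last lra.
  by rewrite divr_ge0 ?(ltW d0)// mulr_ge0// sqr_ge0.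
lra.
Qed.
End CauchyFormula.

(** * Higher derivatives of holomorphic functions and Cauchy's estimates *)

Section Regularity.
Variable R : realType.
Local Notation C := (Cplx R).
Local Notation nm := (@Normc.normc R).

Definition sqbox (w : C) (r : R) : C -> Prop :=
  cbox (complex.Re w - r) (complex.Re w + r) (complex.Im w - r) (complex.Im w + r).

Lemma sqbox_dist (w : C) r z : sqbox w r z -> nm (z - w) <= 2 * r.
Proof.
move=> [/andP[a b] /andP[c d]]; apply: le_trans (nm_le_ReIm _) _.
have : `|complex.Re (z - w)| <= r by rewrite ReB ler_norml; apply/andP; split; lra.
have : `|complex.Im (z - w)| <= r by rewrite ImB ler_norml; apply/andP; split; lra.
lra.
Qed.

Lemma sqbox_disc (w : C) r z : nm w + 2 * r < 1 -> sqbox w r z -> nm z < 1.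
Proof.
move=> wr /sqbox_dist zw; apply: le_lt_trans wr.
by rewrite -[z](subrK w); apply: le_trans (nmD _ _) _; lra.
Qed.

Lemma within_sqbox (w : C) r : within (complex.Re w - r) (complex.Re w + r)
  (complex.Im w - r) (complex.Im w + r) r w.
Proof. by split; lra. Qed.

Lemma sqbox_center (w : C) r : 0 < r -> sqbox w r w.
Proof. by move=> r0; split; apply/andP; split; lra. Qed.

Section local.
Variables (f : C -> C) (w : C) (r : R).
Hypotheses (r0 : 0 < r) (hf : forall z, sqbox w r z -> hol f z).
Local Notation T := (cauchyT (complex.Re w - r) (complex.Re w + r)
  (complex.Im w - r) (complex.Im w + r)).
Let x01 : complex.Re w - r <= complex.Re w + r.
Proof. by move: r0 => ?; lra. Qed.
Let y01 : complex.Im w - r <= complex.Im w + r.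
Proof. by move: r0 => ?; lra. Qed.
Let bf : bcont f (complex.Re w - r) (complex.Re w + r) (complex.Im w - r) (complex.Im w + r).
Proof. by move=> z /bdry_cbox /hf; exact: derivable_continuousC. Qed.
Let b1 : bcont (fun=> 1 : C)
  (complex.Re w - r) (complex.Re w + r) (complex.Im w - r) (complex.Im w + r).
Proof. by move=> z _; exact: cst_continuous. Qed.

Let kappa_neq0 d b : 0 < d -> within (complex.Re w - r) (complex.Re w + r)
  (complex.Im w - r) (complex.Im w + r) d b -> T 1 (fun=> 1) b != 0.
Proof.
move=> d0 wb; have [d1 d2 d3 d4] := wb.
(* [L = 2 * r]: a point inside the square is at most [2 * r] away from each side. *)
rewrite -nm_gt0; apply: lt_le_trans (@winding_ge _ _ _ _ _ _ _ (2 * r) d0 wb _ _ _); last 3 first.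
- lra.
- lra.
- lra.
by rewrite divr_gt0// exprn_gt0// mulr_gt0.
Qed.

(** Near [b] Cauchy's formula reads T 1 f = f * T 1 1. Differentiating both sides and solving for f'
    gives the quotient, whatever the value of the winding factor. *)
Lemma derive1_cauchyT d b : 0 < d -> within (complex.Re w - r) (complex.Re w + r)
  (complex.Im w - r) (complex.Im w + r) d b ->
  derive1 f b = (T 2 f b - f b * T 2 (fun=> 1) b) / T 1 (fun=> 1) b.
Proof.
move=> d0 wb; have [d1 d2 d3 d4] := wb.
have k0 := kappa_neq0 d0 wb.
have hb : hol f b by apply: hf; split; apply/andP; split; lra.
have [hN N'] : hol (T 1 f) b /\ derive1 (T 1 f) b = T 2 f b.
  have H := is_derive_cauchyT x01 y01 d0 wb bf (or_introl erefl).
  by rewrite (is_derive_derive1 H) mul1r; split; [by case: H|exact: erefl].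
have [hk k'] : hol (T 1 (fun=> 1)) b /\ derive1 (T 1 (fun=> 1)) b = T 2 (fun=> 1) b.
  have H := is_derive_cauchyT x01 y01 d0 wb b1 (or_introl erefl).
  by rewrite (is_derive_derive1 H) mul1r; split; [by case: H|exact: erefl].
have d20 : 0 < d / 2 by rewrite divr_gt0.
have NE : derive1 (T 1 f) b = derive1 (fun x => f x * T 1 (fun=> 1) x) b.
  apply: (near_derive1 d20) => b' b'b.
  apply: (@cauchy_formula _ _ _ _ _ _ _ _ d20).
    by have := within_near wb (ltW b'b); rewrite subrK.
  exact: hf.
move: NE; rewrite N' (derive1M hb hk) k' => ->.
by rewrite addrAC subrr add0r mulrAC (divff k0) mul1r.
Qed.

(** Every ingredient of the formula of [derive1_cauchyT] is itself differentiable. *)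
Lemma hol_derive1_local : hol (derive1 f) w.
Proof.
have r20 : 0 < r / 2 by rewrite divr_gt0.
have wr := within_sqbox w r.
apply: (@near_hol _ (fun b => (T 2 f b - f b * T 2 (fun=> 1) b) / T 1 (fun=> 1) b) _ _ _ r20).
  move=> b bw; rewrite (@derive1_cauchyT _ _ r20); [exact: erefl|].
  by have := within_near wr (ltW bw); rewrite subrK.
apply: holM; last first.
  apply: holV; last exact: kappa_neq0 r0 wr.
  by case: (is_derive_cauchyT x01 y01 r0 wr b1 (or_introl erefl)).
apply: holB; first by case: (is_derive_cauchyT x01 y01 r0 wr bf (or_intror erefl)).
apply: holM; last by case: (is_derive_cauchyT x01 y01 r0 wr b1 (or_intror erefl)).
by apply: hf; exact: sqbox_center.
Qed.

(** At the centre of the square the winding factor has modulus at least 1 (take [d = L = r]), and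
    each of the two terms of the numerator is at most [16 * M / r]. *)
Lemma derive1_bound M : (forall z, sqbox w r z -> nm (f z) <= M) ->
  nm (derive1 f w) <= 32 * M / r.
Proof.
move=> fM; have wr := within_sqbox w r.
have M0 : 0 <= M.
  by apply: le_trans (fM w _); [exact: nm_ge0|exact: sqbox_center].
have k1 : 1 <= nm (T 1 (fun=> 1) w).
  have := @winding_ge _ _ _ _ _ _ _ r r0 wr _ _ _.
  rewrite divff ?expf_neq0 ?gt_eqF//; apply; move: r0 => r0'; lra.
have e1 := @cauchyT_le _ _ _ _ _ x01 y01 2 _ _ _ M r0 wr bf (fun z zb => fM z (bdry_cbox zb)).
have e2 := @cauchyT_le _ _ _ _ _ x01 y01 2 _ _ _ 1 r0 wr b1
  (fun z zb => eq_ind_r (fun t => is_true (t <= 1)) (lexx 1) (@nm1 R)).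
rewrite (@derive1_cauchyT r w r0 wr) nmM nmV.
apply: (@le_trans _ _ (nm (T 2 f w - f w * T 2 (fun=> 1) w) * 1)).
  by rewrite ler_wpM2l// invf_le1// (lt_le_trans ltr01).
rewrite mulr1; apply: le_trans (nmD _ _) _; rewrite nmN nmM.
have sE : complex.Re w + r - (complex.Re w - r) + (complex.Im w + r - (complex.Im w - r)) = 4 * r.
  by ring.
rewrite sE in e1 e2.
have -> : 32 * M / r = 4 * (r^-1 ^+ 2 * M) * (4 * r) + M * (4 * (r^-1 ^+ 2 * 1) * (4 * r)).
  by field; rewrite gt_eqF.
apply: lerD; first exact: e1.
apply: ler_pM; [exact: nm_ge0|exact: nm_ge0| |exact: e2].
by apply: fM; exact: sqbox_center.
Qed.
End local.

Lemma holo_discP (f : C -> C) : holo_disc f <-> forall z, nm z < 1 -> hol f z.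
Proof. by split => H z; [rewrite -lt1_norm|rewrite lt1_norm]; exact: H. Qed.

Lemma holo_disc_derive1 (f : C -> C) : holo_disc f -> holo_disc (derive1 f).
Proof.
move=> /holo_discP hf; apply/holo_discP => z z1.
have r0 : 0 < (1 - nm z) / 4 by rewrite divr_gt0// subr_gt0.
apply: (hol_derive1_local r0) => w wz; apply: hf; apply: sqbox_disc wz; lra.
Qed.

Lemma holo_disc_cderiv k (f : C -> C) : holo_disc f -> holo_disc (cderiv k f).
Proof.
rewrite /cderiv; elim: k => [|k ih] hf; first by rewrite derive1n0.
by rewrite derive1nS; apply: holo_disc_derive1; exact: ih.
Qed.

(** One derivative is taken first, at the cost of halving the square: f' is bounded by [64 * M / r]
    on the smaller one. The halved radius brings the factor [2 ^+ k]. *)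
Lemma cderiv_bound k : exists2 K : R, 0 <= K & forall f w r M, holo_disc f -> 0 < r ->
  nm w + 2 * r < 1 -> (forall z, sqbox w r z -> nm (f z) <= M) ->
  nm (cderiv k f w) <= K * M / r ^+ k.
Proof.
elim: k => [|k [K K0 IH]].
  exists 1 => // f w r M hf r0 wr fM.
  rewrite /cderiv derive1n0 expr0 divr1 mul1r; apply: fM; exact: sqbox_center.
exists (K * 2 ^+ k * 64); first by rewrite !mulr_ge0// exprn_ge0.
move=> f w r M hf r0 wr fM.
have r20 : 0 < r / 2 by rewrite divr_gt0.
have -> : cderiv k.+1 f w = cderiv k (derive1 f) w by rewrite /cderiv derive1Sn.
have H := IH (derive1 f) w (r / 2) (64 * M / r) (holo_disc_derive1 hf) r20.
have {}H : nm (cderiv k (derive1 f) w) <= K * (64 * M / r) / (r / 2) ^+ k.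
  apply: H; first lra.
  move=> z zb.
  have sub u : sqbox z (r / 2) u -> sqbox w r u.
    move: zb => [/andP[a1 a2] /andP[a3 a4]] [/andP[c1 c2] /andP[c3 c4]].
    by split; apply/andP; split; lra.
  have -> : 64 * M / r = 32 * M / (r / 2) by field; rewrite gt_eqF.
  apply: derive1_bound => // u /sub ub; last exact: fM.
  by move/holo_discP: hf; apply; exact: sqbox_disc ub.
apply: le_trans H _; rewrite le_eqVlt; apply/orP; left; apply/eqP.
by rewrite exprMn exprVn exprS; field; rewrite ?expf_neq0 ?gt_eqF.
Qed.

(** Functions are total but only controlled on the disc. The identity of the previous order holds on
    a whole neighbourhood of [z] in the disc, which is what allows differentiating it. *)
Lemma cderivD k (f g : C -> C) : holo_disc f -> holo_disc g -> forall z, nm z < 1 ->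
  cderiv k (fun x => f x + g x) z = cderiv k f z + cderiv k g z.
Proof.
move=> hf hg; elim: k => [|k ih] z z1; first by rewrite /cderiv !derive1n0.
rewrite /cderiv !derive1nS -derive1D.
- have r0 : 0 < 1 - nm z by lra.
  apply: (near_derive1 r0) => w wz; apply: ih.
  by rewrite -[w](subrK z); apply: le_lt_trans (nmD _ _) _; lra.
- by have /holo_discP := @holo_disc_cderiv k _ hf; apply.
- by have /holo_discP := @holo_disc_cderiv k _ hg; apply.
Qed.

Lemma cderivZ k (c : C) (f : C -> C) : holo_disc f -> forall z, nm z < 1 ->
  cderiv k (fun x => c * f x) z = c * cderiv k f z.
Proof.
move=> hf; elim: k => [|k ih] z z1; first by rewrite /cderiv !derive1n0.
have h : hol (cderiv k f) z by have /holo_discP := @holo_disc_cderiv k _ hf; apply.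
rewrite /cderiv !derive1nS.
have -> : c * derive1 (derive1n k f) z = derive1 (fun x => c * derive1n k f x) z.
  rewrite derive1M; [|exact: hol_cst|exact: h].
  by rewrite derive1_csthol mulr0 addr0.
have r0 : 0 < 1 - nm z by lra.
apply: (near_derive1 r0) => w wz; apply: ih.
by rewrite -[w](subrK z); apply: le_lt_trans (nmD _ _) _; lra.
Qed.
End Regularity.

(** * The Bergman space *)

Section Measurability.
Variable R : realType.
Local Notation C := (Cplx R).
Local Notation nm := (@Normc.normc R).

Definition open2 (U : set (R * R)) := forall p, U p ->
  exists2 e : R, 0 < e & forall q, `|q.1 - p.1| < e -> `|q.2 - p.2| < e -> U q.

(** The measurable sets of the plane are those of the product sigma-algebra: an open set is a
    countable union of the rational boxes that it contains. *)
Lemma open2_measurable (U : set (R * R)) : open2 U -> measurable U.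
Proof.
move=> oU.
pose box (a b c : rat) : set (R * R) :=
  `]ratr a - ratr c, ratr a + ratr c[ `*` `]ratr b - ratr c, ratr b + ratr c[.
have -> : U = \bigcup_a \bigcup_b \bigcup_c
    (if `[< box a b c `<=` U >] then box a b c else set0).
  apply/seteqP; split => [p Up|p [a _ [b _ [c _]]]]; last first.
    by case: asboolP => // sub /sub.
  have [e e0 eU] := oU _ Up.
  have /rat_in_itvoo[c] : 0 < e / 2 by rewrite divr_gt0.
  rewrite in_itv /= => /andP[c0 ce].
  have /rat_in_itvoo[a] : p.1 - ratr c < p.1 by lra.
  rewrite in_itv /= => /andP[a1 a2].
  have /rat_in_itvoo[b] : p.2 - ratr c < p.2 by lra.
  rewrite in_itv /= => /andP[b1 b2].
  exists a => //; exists b => //; exists c => //.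
  rewrite asboolT; last first.
    move=> q [/=]; rewrite !in_itv /= => /andP[q1 q2] /andP[q3 q4].
    by apply: eU; rewrite ltr_norml; apply/andP; split; lra.
  by split => /=; rewrite in_itv /=; apply/andP; split; lra.
apply: bigcupT_measurable_rat => a; apply: bigcupT_measurable_rat => b.
apply: bigcupT_measurable_rat => c; case: ifP => // _.
by apply: measurableX; exact: measurable_itv.
Qed.

Lemma open2_measurable_fun (D : set (R * R)) (g : R * R -> R) : open2 D ->
  (forall p, D p -> forall e, 0 < e -> exists2 d : R, 0 < d &
    forall q, `|q.1 - p.1| < d -> `|q.2 - p.2| < d -> `|g q - g p| < e) ->
  measurable_fun D g.
Proof.
move=> oD cg; apply: (measurability _ (measurable_realfun.RGenOpens.measurableE R)).
move=> _ [_ [a [b ->]] <-]; apply: open2_measurable => p [Dp].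
rewrite /= in_itv /= => /andP[ap pb].
have [e1 e10 D1] := oD _ Dp.
have m0 : 0 < Num.min (g p - a) (b - g p) by rewrite lt_min !subr_gt0 ap pb.
have [e2 e20 g2] := cg _ Dp _ m0.
exists (Num.min e1 e2); first by rewrite lt_min e10 e20.
move=> q; rewrite !lt_min => /andP[q1 q1'] /andP[q2 q2']; split; first exact: D1.
have := g2 q q1' q2'; rewrite /= in_itv /= lt_min !ltr_norml => /andP[/andP[h1 h2] /andP[h3 h4]].
by apply/andP; split; lra.
Qed.

Lemma toC_dist (p q : R * R) : nm (toC q - toC p) <= `|q.1 - p.1| + `|q.2 - p.2|.
Proof. by apply: le_trans (nm_le_ReIm _) _; rewrite ReB ImB. Qed.

Lemma DdiscE (p : R * R) : Ddisc p <-> nm (toC p) < 1.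
Proof.
rewrite /Ddisc /= nmE /= -[X in _ <-> (_ < X)]sqrtr1; split => h; first by rewrite ltr_sqrt.
by move: h; rewrite ltr_sqrt.
Qed.

Lemma open2_Ddisc : open2 (@Ddisc R).
Proof.
move=> p /DdiscE p1; have r0 : 0 < (1 - nm (toC p)) / 2 by rewrite divr_gt0// subr_gt0.
exists ((1 - nm (toC p)) / 2) => // q q1 q2; apply/DdiscE.
have := toC_dist p q; have := nmD (toC q - toC p) (toC p); rewrite subrK.
lra.
Qed.

Lemma measurable_Ddisc : measurable (@Ddisc R).
Proof. exact: open2_measurable open2_Ddisc. Qed.

Definition contD (f : C -> C) := forall z : C, nm z < 1 -> {for z, continuous f}.

Lemma contD_toC (f : C -> C) : contD f -> forall p, Ddisc p -> forall e, 0 < e ->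
  exists2 d : R, 0 < d & forall q, `|q.1 - p.1| < d -> `|q.2 - p.2| < d ->
    nm (f (toC q) - f (toC p)) < e.
Proof.
move=> cf p /DdiscE /cf /continuousCP H e /H[d d0 dH].
exists (d / 2); first by rewrite divr_gt0.
by move=> q q1 q2; apply: dH; apply: le_lt_trans (toC_dist _ _) _; lra.
Qed.

Lemma measurable_Re (f : C -> C) : contD f ->
  measurable_fun (@Ddisc R) (fun p => complex.Re (f (toC p))).
Proof.
move=> cf; apply: open2_measurable_fun; first exact: open2_Ddisc.
move=> p Dp e /(contD_toC cf Dp)[d d0 dH]; exists d => // q q1 q2.
by rewrite -ReB; apply: le_lt_trans (ler_Re _) _; exact: dH.
Qed.

Lemma measurable_Im (f : C -> C) : contD f ->
  measurable_fun (@Ddisc R) (fun p => complex.Im (f (toC p))).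
Proof.
move=> cf; apply: open2_measurable_fun; first exact: open2_Ddisc.
move=> p Dp e /(contD_toC cf Dp)[d d0 dH]; exists d => // q q1 q2.
by rewrite -ImB; apply: le_lt_trans (ler_Im _) _; exact: dH.
Qed.

Lemma measurable_sqmod (f : C -> C) : contD f ->
  measurable_fun (@Ddisc R) (fun p => sqmod (f (toC p))).
Proof.
move=> cf; apply: measurable_funD.
- by apply: measurable_funX; exact: measurable_Re.
- by apply: measurable_funX; exact: measurable_Im.
Qed.

Lemma measurable_sqmodE (f : C -> C) : contD f ->
  measurable_fun (@Ddisc R) (fun p => (sqmod (f (toC p)))%:E).
Proof. by move=> cf; apply/measurable_EFinP; exact: measurable_sqmod. Qed.

Lemma sqmod_ge0 (z : C) : 0 <= sqmod z.
Proof. by rewrite addr_ge0// sqr_ge0. Qed.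

Lemma holo_contD (f : C -> C) : holo_disc f -> contD f.
Proof. by move=> /holo_discP hf z /hf; exact: derivable_continuousC. Qed.

End Measurability.
#[global] Hint Resolve measurable_Ddisc sqmod_ge0 : core.

(** * Values of a holomorphic function bounded by its area integral *)

Section AreaBound.
Variable R : realType.
Local Notation C := (Cplx R).
Local Notation nm := (@Normc.normc R).
Local Notation leb := (@lebesgue_measure R).

(** If [V] exceeded its average on all of the segment, its integral would be at least [B]; the
    strict bound on the integral excludes this. *)
Lemma exists_le_average (V : R -> \bar R) (p q B : R) : p < q ->
  measurable_fun setT V -> (forall x, (0 <= V x)%E) -> (\int[leb]_x V x < B%:E)%E ->
  exists2 x, p <= x <= q & (V x <= (B / (q - p))%:E)%E.
Proof.
move=> pq mV V0 intV; apply: contrapT => nex.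
have big x : p <= x <= q -> ((B / (q - p))%:E < V x)%E.
  by move=> xpq; rewrite ltNge; apply/negP => le; apply: nex; exists x.
have : (\int[leb]_(x in `[p, q]) (B / (q - p))%:E <= \int[leb]_x V x)%E.
  apply: (@le_trans _ _ (\int[leb]_(x in `[p, q]) V x)%E); last first.
    by apply: ge0_subset_integral.
  have B0 : 0 < B by rewrite -lte_fin; apply: le_lt_trans intV; exact: integral_ge0.
  apply: ge0_le_integral => //.
  - by move=> x _; rewrite lee_fin; apply: divr_ge0; rewrite ?subr_ge0; exact: ltW.
  - exact: measurable_funS mV.
  - by move=> x /=; rewrite in_itv /= => /big /ltW.
rewrite integral_cst//= lebesgue_measure_itv /= lte_fin pq -EFinB -EFinM.
rewrite mulrVK ?unitfE ?subr_eq0 ?gt_eqF// leNgt => /negP; exact.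
Qed.

(** A bridge from Tonelli's slices, extended-real integrals of a function extended by 0, to real
    integrals along the sides of a smaller rectangle. *)
Lemma Rintegral_le_restrict (S : R -> R) (a b p q c : R) : a <= p -> q <= b ->
  (forall t, a <= t <= b -> {for t, continuous S}) -> (forall t, 0 <= S t) ->
  (\int[leb]_y ((EFin \o S) \_ `[a, b]) y <= c%:E)%E ->
  Rintegral leb `[p, q] S <= c.
Proof.
move=> ap qb cS S0 H.
have iS u v : a <= u -> v <= b -> leb.-integrable `[u, v] (EFin \o S).
  move=> au vb; apply: continuous_compact_integrable; first exact: segment_compact.
  apply: continuous_in_subspaceT => t; rewrite inE /= in_itv /= => /andP[t1 t2].
  by apply: cS; rewrite (le_trans au t1) (le_trans t2 vb).
rewrite -lee_fin /Rintegral fineK; last by apply: integrable_fin_num => //; exact: iS.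
apply: le_trans H; rewrite -integral_mkcond; apply: ge0_subset_integral => //.
- by have /integrableP[] := iS a b (lexx _) (lexx _).
- by move=> x _; rewrite lee_fin.
- by apply: subset_itv; rewrite bnd_simp.
Qed.

Lemma nm_ci_kernel_le (g : R -> C) (k : R -> C) p q K c : p <= q ->
  con p q k -> con p q g -> 0 <= K -> (forall t, p <= t <= q -> nm (k t) <= K) ->
  Rintegral leb `[p, q] (fun t => sqmod (g t)) <= c ->
  nm (ci p q (fun t => k t * g t ^+ 2)) <= 2 * (K * c).
Proof.
move=> pq ck cg K0 kK H.
have csq : forall t, p <= t <= q -> {for t, continuous (fun t => sqmod (g t))}.
  move=> t tpq; rewrite /sqmod.
  have cR : {for t, continuous (fun t => complex.Re (g t))}.
    by apply: (@continuous_comp _ _ _ g); [exact: cg|exact: continuous_Re].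
  have cI : {for t, continuous (fun t => complex.Im (g t))}.
    by apply: (@continuous_comp _ _ _ g); [exact: cg|exact: continuous_Im].
  by apply: (@continuousD _ _ _ (fun t => complex.Re (g t) ^+ 2) (fun t => complex.Im (g t) ^+ 2));
    apply: continuousM.
have isq : leb.-integrable `[p, q] (EFin \o (fun t => sqmod (g t))).
  apply: continuous_compact_integrable; first exact: segment_compact.
  by apply: continuous_in_subspaceT => t; rewrite inE /= in_itv /=; exact: csq.
have cF : con p q (fun t => k t * g t ^+ 2).
  move=> t tpq; apply: (@continuousM _ _ k (fun t => g t ^+ 2)); first exact: ck.
  by apply: (@continuousM _ _ g g); exact: cg.
apply: (@le_trans _ _ (2 * Rintegral leb `[p, q] (fun t => K * sqmod (g t)))).
  apply: nm_cint_le => //; first exact: cintegrable_con.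
    exact: integrable_EFinZl.
  move=> t; rewrite /= in_itv /= => tpq; rewrite (nmM (k t)) (nmX (g t)) nm_sq.
  by apply: ler_wpM2r; [exact: sqmod_ge0|exact: kK].
by rewrite ler_pM2l// RintegralZl// ler_wpM2l.
Qed.

(** Cauchy's formula for f^2: the kernel is at most [2 / r] as each side is at least [r / 2] away,
    the four sides together give [8 * (2 / r * c)], and the winding factor is at least 1/4. *)
Lemma square_mean_bound (f : C -> C) (w : C) (r c x0 x1 y0 y1 : R) :
  holo_disc f -> 0 < r -> nm w + 2 * r < 1 ->
  complex.Re w - r <= x0 <= complex.Re w - r / 2 ->
  complex.Re w + r / 2 <= x1 <= complex.Re w + r ->
  complex.Im w - r <= y0 <= complex.Im w - r / 2 ->
  complex.Im w + r / 2 <= y1 <= complex.Im w + r ->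
  Rintegral leb `[y0, y1] (fun y => sqmod ((f \o vline x0) y)) <= c ->
  Rintegral leb `[y0, y1] (fun y => sqmod ((f \o vline x1) y)) <= c ->
  Rintegral leb `[x0, x1] (fun x => sqmod ((f \o hline y0) x)) <= c ->
  Rintegral leb `[x0, x1] (fun x => sqmod ((f \o hline y1) x)) <= c ->
  nm (f w) ^+ 2 <= 32 * (2 / r * c).
Proof.
move=> hf r0 wr /andP[x0a x0b] /andP[x1a x1b] /andP[y0a y0b] /andP[y1a y1b] v0 v1 h0 h1.
have r20 : 0 < r / 2 by rewrite divr_gt0.
have wi : within x0 x1 y0 y1 (r / 2) w by clear -x0a x0b x1a x1b y0a y0b y1a y1b r0; split; lra.
have x01 : x0 <= x1 by lra.
have y01 : y0 <= y1 by lra.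
have W : 1 / 4 <= nm (cauchyT x0 x1 y0 y1 1 (fun=> 1) w).
  have -> : 1 / 4 = (r / 2) ^+ 2 / r ^+ 2 :> R by field; rewrite gt_eqF.
  by apply: (@winding_ge _ _ _ _ _ _ _ r r20 wi _ _ _); lra.
have box z : cbox x0 x1 y0 y1 z -> nm z < 1.
  move=> [/andP[z1 z2] /andP[z3 z4]]; apply: (sqbox_disc wr).
  by split; apply/andP; split; lra.
have hf2 z : cbox x0 x1 y0 y1 z -> hol (fun z => f z ^+ 2) z.
  by move=> zb; apply: holX; move/holo_discP: hf; apply; exact: box.
have b1 : bcont (fun=> 1 : C) x0 x1 y0 y1 by move=> z _; exact: cst_continuous.
pose k := fun z : C => (z - w)^-1 ^+ 1 * (1 : C).
have bk : bcont k x0 x1 y0 y1 := @bcont_kernel _ _ _ _ _ 1 _ _ _ r20 wi b1.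
have bf : bcont f x0 x1 y0 y1.
  by move=> z [z1 z2 _]; apply: (holo_contD hf); apply: box; split.
have kK z : bdry x0 x1 y0 y1 z -> nm (k z) <= 2 / r.
  move=> zb; rewrite /k mulr1; have := nm_kernel_le 1 r20 wi zb.
  by rewrite expr1 invf_div.
have [k1 k2 k3 k4] := bcontP x01 y01 bk.
have [f1 f2 f3 f4] := bcontP x01 y01 bf.
have K0 : 0 <= 2 / r by rewrite divr_ge0// ltW.
have e1 : nm (ci x0 x1 ((fun z => k z * f z ^+ 2) \o hline y0)) <= 2 * (2 / r * c).
  apply: (nm_ci_kernel_le x01 k1 f1 K0) => [t tt|]; last exact: h0.
  by apply: kK; exact: bdry_h0.
have e2 : nm (ci x0 x1 ((fun z => k z * f z ^+ 2) \o hline y1)) <= 2 * (2 / r * c).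
  apply: (nm_ci_kernel_le x01 k2 f2 K0) => [t tt|]; last exact: h1.
  by apply: kK; exact: bdry_h1.
have e3 : nm (ci y0 y1 ((fun z => k z * f z ^+ 2) \o vline x0)) <= 2 * (2 / r * c).
  apply: (nm_ci_kernel_le y01 k3 f3 K0) => [t tt|]; last exact: v0.
  by apply: kK; exact: bdry_v0.
have e4 : nm (ci y0 y1 ((fun z => k z * f z ^+ 2) \o vline x1)) <= 2 * (2 / r * c).
  apply: (nm_ci_kernel_le y01 k4 f4 K0) => [t tt|]; last exact: v1.
  by apply: kK; exact: bdry_v1.
have up : nm (rectI (fun z => k z * f z ^+ 2) x0 x1 y0 y1) <= 8 * (2 / r * c).
  have -> : 8 * (2 / r * c) = (2 * (2 / r * c) + 2 * (2 / r * c)) +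
      (2 * (2 / r * c) + 2 * (2 / r * c)) by ring.
  rewrite /rectI; apply: le_trans (nmD _ _) _; rewrite nmM nm_i mul1r.
  apply: lerD; apply: le_trans (nmD _ _) _; rewrite nmN.
    exact: lerD e1 e2.
  exact: lerD e4 e3.
have low : nm (f w) ^+ 2 * (1 / 4) <= 8 * (2 / r * c).
  apply: le_trans up; rewrite -nmX.
  apply: (@le_trans _ _ (nm (f w ^+ 2) * nm (cauchyT x0 x1 y0 y1 1 (fun=> 1) w))).
    by apply: ler_wpM2l W; exact: nm_ge0.
  rewrite -nmM -(cauchy_formula r20 wi hf2) le_eqVlt; apply/orP; left; apply/eqP; congr nm.
  by apply: (eq_rectI x01 y01) => z _; rewrite /k mulr1.
by clear -low; lra.
Qed.

Lemma area_bound : exists2 K : R, 0 < K &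
  forall (f : C -> C) (w : C) (r : R), holo_disc f -> 0 < r ->
  nm w + 2 * r < 1 ->
  ((nm (f w) ^+ 2 * r ^+ 2)%:E <= K%:E * \int[@area R]_(p in @Ddisc R) (sqmod (f (toC p)))%:E)%E.
Proof.
(* With [c = 2 * B / r], the bound [32 * (2 / r * c)] of [square_mean_bound] equals
   [128 * B / r ^+ 2]. *)
exists 128 => // f w r hf r0 wr.
set I := (\int[@area R]_(p in _) _)%E.
have I0 : (0 <= I)%E by apply: integral_ge0 => p _; rewrite lee_fin; exact: sqmod_ge0.
have [Ify|If] := eqVneq I +oo%E; first by rewrite Ify gt0_muley// leey.
have {If} IE : I = (fine I)%:E by rewrite fineK// ge0_fin_numE// ltey.
move: (fine I) IE => A IE.
rewrite IE -EFinM lee_fin; apply/ler_addgt0Pl => eta eta0.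
(* [exists_le_average] requires the integral to be strictly less than [B]. *)
pose B := A + eta / 128.
have AB : A < B by rewrite /B ltrDl divr_gt0.
have -> : eta + 128 * A = 128 * B by rewrite /B; field.
clearbody B.
set wx := complex.Re w; set wy := complex.Im w.
pose Q : set (R * R) := `[wx - r, wx + r] `*` `[wy - r, wy + r].
have mQ : measurable Q by apply: measurableX; exact: measurable_itv.
have QD : Q `<=` @Ddisc R.
  move=> p [/=]; rewrite !in_itv /= => p1 p2; apply/DdiscE.
  by apply: (sqbox_disc wr); split.
have mS := measurable_sqmodE (holo_contD hf).
pose F := (fun p : R * R => (sqmod (f (toC p)))%:E) \_ Q.
have mF : measurable_fun setT F.
  apply: (measurable_restrictT _ mQ).1; exact: (measurable_funS (@measurable_Ddisc R) QD mS).
have F0 p : (0 <= F p)%E by rewrite /F patchE; case: ifP => // _; rewrite lee_fin; exact: sqmod_ge0.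
have intF : (\int[@area R]_p F p < B%:E)%E.
  rewrite -integral_mkcond; apply: (@le_lt_trans _ _ I); last by rewrite IE lte_fin.
  apply: ge0_subset_integral; [exact: mQ|exact: measurable_Ddisc|exact: mS| |exact: QD].
  by move=> p _; rewrite lee_fin; exact: sqmod_ge0.
have mV := measurable_fun_fubini_tonelli_F (m2 := leb) F mF F0.
have mH := measurable_fun_fubini_tonelli_G (m1 := leb) F mF F0.
have intV : (\int[leb]_x fubini_F leb F x < B%:E)%E.
  have E : (\int[@area R]_p F p = \int[leb]_x fubini_F leb F x)%E :=
    fubini_tonelli1 (m1 := leb) (m2 := leb) F mF F0.
  by rewrite -E.
have intH : (\int[leb]_y fubini_G leb F y < B%:E)%E.
  have E : (\int[@area R]_p F p = \int[leb]_x fubini_G leb F x)%E :=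
    fubini_tonelli2 (m1 := leb) (m2 := leb) F mF F0.
  by rewrite -E.
have V0 x : (0 <= fubini_F leb F x)%E by apply: integral_ge0 => t _; exact: F0.
have H0 y : (0 <= fubini_G leb F y)%E by apply: integral_ge0 => t _; exact: F0.
have avV p : exists2 x, p <= x <= p + r / 2 & (fubini_F leb F x <= (B / (r / 2))%:E)%E.
  have pr : p < p + r / 2 by rewrite ltrDl divr_gt0.
  by have := exists_le_average pr mV V0 intV; rewrite [p + r / 2 - p]addrC addKr.
have avH p : exists2 x, p <= x <= p + r / 2 & (fubini_G leb F x <= (B / (r / 2))%:E)%E.
  have pr : p < p + r / 2 by rewrite ltrDl divr_gt0.
  by have := exists_le_average pr mH H0 intH; rewrite [p + r / 2 - p]addrC addKr.
(* Each side is chosen in a strip of width [r / 2] along the border of the square, so that all of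
   them stay at least [r / 2] away from [w]. *)
have [x0 /andP[x0a x0b] Vx0] := avV (wx - r).
have [x1 /andP[x1a x1b] Vx1] := avV (wx + r / 2).
have [y0 /andP[y0a y0b] Hy0] := avH (wy - r).
have [y1 /andP[y1a y1b] Hy1] := avH (wy + r / 2).
clear avV avH.
have inD x y : wx - r <= x <= wx + r -> wy - r <= y <= wy + r -> nm (Complex x y : C) < 1.
  by move=> xx yy; apply: (sqbox_disc wr); split.
have contf x y : wx - r <= x <= wx + r -> wy - r <= y <= wy + r ->
    {for (Complex x y : C), continuous f}.
  by move=> xx yy; apply: (holo_contD hf); exact: inD.
set c := B / (r / 2).
have contS (g : R -> C) t : {for t, continuous g} -> {for t, continuous (fun t => sqmod (g t))}.
  move=> cg.
  have cR : {for t, continuous (fun t => complex.Re (g t))}.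
    by apply: (@continuous_comp _ _ _ g); [exact: cg|exact: continuous_Re].
  have cI : {for t, continuous (fun t => complex.Im (g t))}.
    by apply: (@continuous_comp _ _ _ g); [exact: cg|exact: continuous_Im].
  by apply: (@continuousD _ _ _ (fun t => complex.Re (g t) ^+ 2) (fun t => complex.Im (g t) ^+ 2));
    apply: continuousM.
have vert x : wx - r <= x <= wx + r -> (fubini_F leb F x <= c%:E)%E ->
    Rintegral leb `[y0, y1] (fun y => sqmod ((f \o vline x) y)) <= c.
  move=> xx; rewrite /fubini_F => Vx.
  apply: (@Rintegral_le_restrict _ (wy - r) (wy + r));
    [clear -y0a; lra|clear -y1b r0; lra| |by move=> t; exact: sqmod_ge0|].
    move=> t tt; apply: contS; apply: (@continuous_comp _ _ _ (vline x)).
      exact: continuous_vline.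
    exact: contf.
  apply: le_trans Vx; rewrite le_eqVlt; apply/orP; left; apply/eqP.
  apply: eq_integral => y _; rewrite /F !patchE !mem_setE in_setX !mem_setE /=.
  by rewrite [x \in _]in_itv /= xx.
have horz y : wy - r <= y <= wy + r -> (fubini_G leb F y <= c%:E)%E ->
    Rintegral leb `[x0, x1] (fun x => sqmod ((f \o hline y) x)) <= c.
  move=> yy; rewrite /fubini_G => Vy.
  apply: (@Rintegral_le_restrict _ (wx - r) (wx + r));
    [clear -x0a; lra|clear -x1b r0; lra| |by move=> t; exact: sqmod_ge0|].
    move=> t tt; apply: contS; apply: (@continuous_comp _ _ _ (hline y)).
      exact: continuous_hline.
    exact: contf.
  apply: le_trans Vy; rewrite le_eqVlt; apply/orP; left; apply/eqP.
  apply: eq_integral => x _; rewrite /F !patchE !mem_setE in_setX !mem_setE /=.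
  by rewrite [y \in _]in_itv /= yy andbT.
have low : nm (f w) ^+ 2 <= 32 * (2 / r * c).
  have xa : wx - r <= x0 <= wx + r by clear -r0 x0a x0b; lra.
  have xb : wx - r <= x1 <= wx + r by clear -r0 x1a x1b; lra.
  have ya : wy - r <= y0 <= wy + r by clear -r0 y0a y0b; lra.
  have yb : wy - r <= y1 <= wy + r by clear -r0 y1a y1b; lra.
  apply: (@square_mean_bound f w r c x0 x1 y0 y1 hf r0 wr).
  - by rewrite -/wx x0a; clear -x0b r0; lra.
  - by rewrite -/wx x1a; clear -x1b r0; lra.
  - by rewrite -/wy y0a; clear -y0b r0; lra.
  - by rewrite -/wy y1a; clear -y1b r0; lra.
  - exact: (vert _ xa Vx0).
  - exact: (vert _ xb Vx1).
  - exact: (horz _ ya Hy0).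
  - exact: (horz _ yb Hy1).
have -> : 128 * B = 32 * (2 / r * c) * r ^+ 2.
  by rewrite /c; field; rewrite gt_eqF.
by apply: ler_wpM2r low; rewrite exprn_ge0// ltW.
Qed.
End AreaBound.

(** * Norm and inner product; boundedness of the derivative evaluations *)

Section BergmanSpace.
Variable R : realType.
Local Notation C := (Cplx R).
Local Notation nm := (@Normc.normc R).
Local Notation D := (@Ddisc R).

Lemma pi_gt0R : 0 < pi :> R. Proof. exact: pi_gt0. Qed.

Lemma A2normsq_ge0 (f : C -> C) : (0 <= A2normsq f)%E.
Proof.
apply: mule_ge0; last by rewrite lee_fin invr_ge0 ltW// pi_gt0R.
by apply: integral_ge0 => p _; rewrite lee_fin; exact: sqmod_ge0.
Qed.

(** The value bound costs one factor 1/r and Cauchy's estimate [k] more, where r is comparable to 1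
    - |w|; squaring gives the exponent [(k.+1).*2]. *)
Lemma eval_bound k : exists2 K : R, 0 < K & forall (f : C -> C) (w : C), holo_disc f -> nm w < 1 ->
  ((nm (cderiv k f w) ^+ 2 * (1 - nm w) ^+ (k.+1).*2)%:E <= K%:E * A2normsq f)%E.
Proof.
have [K0 K00 area] := area_bound R; have [K1 K10 cd] := @cderiv_bound R k.
have Kpos : 0 < (K1 ^+ 2 + 1) * K0 * 8 ^+ (k.+1).*2 * pi.
  have K11 : 0 < K1 ^+ 2 + 1 by rewrite ltr_wpDl// sqr_ge0.
  by apply: mulr_gt0 (pi_gt0R); apply: mulr_gt0; [exact: mulr_gt0|exact: exprn_gt0].
exists ((K1 ^+ 2 + 1) * K0 * 8 ^+ (k.+1).*2 * pi); first exact: Kpos.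
move=> f w hf w1.
(* The square of half side [r] reaches at most [2 * r] from [w], and the value bound at its points
   needs another [2 * r] inside the disc. *)
set r := (1 - nm w) / 8.
have r0 : 0 < r by rewrite divr_gt0// subr_gt0.
have dE : 1 - nm w = 8 * r by rewrite /r; field.
rewrite /A2normsq; set I := (\int[_]_(p in _) _)%E.
have I0 : (0 <= I)%E by apply: integral_ge0 => p _; rewrite lee_fin; exact: sqmod_ge0.
have pi0 := pi_gt0R.
have [Ify|If] := eqVneq I +oo%E.
  rewrite Ify gt0_mulye; last by rewrite lte_fin invr_gt0.
  by rewrite gt0_muley; [exact: leey|rewrite lte_fin].
have {If} IE : I = (fine I)%:E by rewrite fineK// ge0_fin_numE// ltey.
have {}area := fun w' wr => area f w' r hf r0 wr.
rewrite -/I IE in area *; move: (fine I) area IE => A area IE.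
have A0 : 0 <= A by rewrite IE lee_fin in I0.
rewrite -!EFinM lee_fin.
set M := Num.sqrt (K0 * A) / r.
have sM z : sqbox w r z -> nm (f z) <= M.
  move=> zb; have zw : nm z <= nm w + 2 * r.
    by rewrite -[z](subrK w); apply: le_trans (nmD _ _) _; have := sqbox_dist zb; lra.
  have := area z ltac:(lra); rewrite -EFinM lee_fin -exprMn => h.
  rewrite /M ler_pdivlMr//.
  have n0 : 0 <= nm (f z) * r by apply: mulr_ge0; [exact: nm_ge0|exact: ltW].
  by rewrite -(ger0_norm n0) -sqrtr_sqr ler_wsqrtr.
have := cd f w r M hf r0 ltac:(lra) sM.
set c := nm (cderiv k f w) => h.
have c0 : 0 <= c by exact: nm_ge0.
have M2 : M ^+ 2 * r ^+ 2 = K0 * A.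
  rewrite -exprMn /M divfK ?gt_eqF// sqr_sqrtr// mulr_ge0// ltW//.
have rk : 0 < r ^+ k by rewrite exprn_gt0.
have h2 : (c * r ^+ k) ^+ 2 <= (K1 * M) ^+ 2.
  have M0 : 0 <= M by apply: divr_ge0; [exact: sqrtr_ge0|exact: ltW].
  rewrite ler_sqr ?nnegrE; [|by apply: mulr_ge0; [exact: c0|exact: ltW]|exact: mulr_ge0].
  by rewrite -ler_pdivlMr; [exact: h|exact: rk].
have E8 : (8 * r) ^+ (k.+1).*2 = 8 ^+ (k.+1).*2 * (r ^+ k) ^+ 2 * r ^+ 2.
  rewrite exprMn -mulrA; congr (_ * _).
  by rewrite -exprM -exprD muln2 addn2 -doubleS.
rewrite dE E8; clear E8.
have : 0 <= 8 ^+ (k.+1).*2 :> R by rewrite exprn_ge0.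
move: (8 ^+ (k.+1).*2 : R) => E E0.
have -> : c ^+ 2 * (E * (r ^+ k) ^+ 2 * r ^+ 2) = E * ((c * r ^+ k) ^+ 2 * r ^+ 2).
  by move: (r ^+ k) => rho; ring.
have -> : (K1 ^+ 2 + 1) * K0 * E * pi * (A / pi) = E * ((K1 ^+ 2 + 1) * (K0 * A)).
  have pi1 : pi != 0 :> R by rewrite gt_eqF.
  by rewrite -(mulrA _ pi) (mulrC pi) divfK//; ring.
apply: ler_wpM2l; first exact: E0.
apply: (@le_trans _ _ ((K1 * M) ^+ 2 * r ^+ 2)).
  by rewrite ler_wpM2r ?exprn_ge0// ltW.
rewrite exprMn -mulrA M2; apply: ler_wpM2r; last by rewrite lerDl.
by rewrite mulr_ge0// ltW.
Qed.

Lemma ReMconj (a b : C) : complex.Re (a * b^*) =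
  complex.Re a * complex.Re b + complex.Im a * complex.Im b.
Proof. by case: a => a1 a2; case: b => b1 b2 /=; rewrite mulrN opprK. Qed.

Lemma ImMconj (a b : C) : complex.Im (a * b^*) =
  complex.Im a * complex.Re b - complex.Re a * complex.Im b.
Proof. by case: a => a1 a2; case: b => b1 b2 /=; ring. Qed.

Lemma nm_conj (a : C) : nm (a^*) = nm a.
Proof. by case: a => a1 a2; rewrite !nmE /= sqrrN. Qed.

Lemma inA2P (f : C -> C) : inA2 f <-> holo_disc f /\
  (@area R).-integrable D (EFin \o (fun p => sqmod (f (toC p)))).
Proof.
have pi0 := pi_gt0R.
split=> -[hf H]; split => //.
  apply/integrableP; split; first exact: measurable_sqmodE (holo_contD hf).
  under eq_integral do rewrite /= ger0_norm ?sqmod_ge0//.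
  move: H; rewrite /A2normsq; set I := (\int[_]_(p in _) _)%E => H.
  have I0 : (0 <= I)%E by apply: integral_ge0 => p _; rewrite lee_fin; exact: sqmod_ge0.
  rewrite ltNge leye_eq; apply/eqP => Ify.
  by move: H; rewrite Ify gt0_mulye ?lte_fin ?invr_gt0// ltxx.
rewrite /A2normsq; move/integrableP : H => [_].
under eq_integral do rewrite /= ger0_norm ?sqmod_ge0//.
by move=> h; rewrite muleC; apply: lte_mul_pinfty; rewrite ?lee_fin ?invr_ge0 ?(ltW pi0).
Qed.

Lemma area_integrableZ (f : R * R -> R) (r : R) : (@area R).-integrable D (EFin \o f) ->
  (@area R).-integrable D (EFin \o (fun p => r * f p)).
Proof. by move=> h; apply: integrable_EFinZl; [exact: measurable_Ddisc|exact: h]. Qed.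

Lemma area_integrableD (f g : R * R -> R) : (@area R).-integrable D (EFin \o f) ->
  (@area R).-integrable D (EFin \o g) ->
  (@area R).-integrable D (EFin \o (fun p => f p + g p)).
Proof.
move=> hf hg; have -> : EFin \o (fun p => f p + g p) = (EFin \o f) \+ (EFin \o g) by [].
by apply: integrableD; [exact: measurable_Ddisc|exact: hf|exact: hg].
Qed.

Lemma area_le_integrable (f g : R * R -> R) : measurable_fun D f ->
  (forall p, D p -> `|f p| <= g p) -> (@area R).-integrable D (EFin \o g) ->
  (@area R).-integrable D (EFin \o f).
Proof.
move=> mf fg; apply: le_integrable; [exact: measurable_Ddisc|exact/measurable_EFinP|].
move=> p Dp; rewrite /= lee_fin; apply: le_trans (fg p Dp) _; exact: ler_norm.
Qed.

Lemma sqmodD_le (a b : C) : sqmod (a + b) <= 2 * sqmod a + 2 * sqmod b.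
Proof.
rewrite /sqmod ReD ImD.
have := sqr_ge0 (complex.Re a - complex.Re b); have := sqr_ge0 (complex.Im a - complex.Im b).
by rewrite !sqrrB !sqrrD; lra.
Qed.

Lemma holo_discD (f g : C -> C) : holo_disc f -> holo_disc g -> holo_disc (fun z => f z + g z).
Proof.
move=> /holo_discP hf /holo_discP hg; apply/holo_discP => z z1.
by apply: holD; [exact: hf|exact: hg].
Qed.

Lemma holo_discM (f g : C -> C) : holo_disc f -> holo_disc g -> holo_disc (fun z => f z * g z).
Proof.
move=> /holo_discP hf /holo_discP hg; apply/holo_discP => z z1.
by apply: holM; [exact: hf|exact: hg].
Qed.

Lemma holo_disc_cst c : holo_disc (fun=> c : C).
Proof. by apply/holo_discP => z z1; exact: hol_cst. Qed.

Lemma inA2D (f g : C -> C) : inA2 f -> inA2 g -> inA2 (fun z => f z + g z).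
Proof.
move=> /inA2P[hf If] /inA2P[hg Ig]; apply/inA2P.
have hfg := holo_discD hf hg; split; first exact: hfg.
apply: area_le_integrable (area_integrableD (area_integrableZ 2 If) (area_integrableZ 2 Ig)).
  exact: measurable_sqmod (holo_contD hfg).
by move=> p _; rewrite ger0_norm ?sqmod_ge0//; exact: sqmodD_le.
Qed.

Lemma inA2Z (c : C) (f : C -> C) : inA2 f -> inA2 (fun z => c * f z).
Proof.
move=> /inA2P[hf If]; apply/inA2P.
have hcf := holo_discM (@holo_disc_cst c) hf; split; first exact: hcf.
apply: area_le_integrable (area_integrableZ (sqmod c) If).
  exact: measurable_sqmod (holo_contD hcf).
by move=> p _; rewrite ger0_norm ?sqmod_ge0// -!nm_sq nmM exprMn.
Qed.

Lemma inA2B (f g : C -> C) : inA2 f -> inA2 g -> inA2 (fun z => f z - g z).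
Proof.
move=> hf /(inA2Z (-1)) hg; have := inA2D hf hg.
by under [X in inA2 X -> _]eq_fun do rewrite mulN1r.
Qed.

Lemma inA2_0 : inA2 (fun=> 0 : C).
Proof.
apply/inA2P; split; first exact: holo_disc_cst.
have -> : EFin \o (fun p : R * R => sqmod (0 : C)) = cst (0%:E).
  by apply/funext => p /=; rewrite -nm_sq nm0 expr0n.
exact: integrable0.
Qed.

Lemma inA2_sum (I : Type) (s : seq I) (F : I -> C -> C) : (forall i, inA2 (F i)) ->
  inA2 (fun z => \sum_(i <- s) F i z).
Proof.
move=> H; elim: s => [|i s ih].
  by under [X in inA2 X]eq_fun do rewrite big_nil; exact: inA2_0.
by under [X in inA2 X]eq_fun do rewrite big_cons; exact: inA2D.
Qed.

Lemma cintegrable_ip (f g : C -> C) : inA2 f -> inA2 g ->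
  cintegrable (@area R) D (fun p => f (toC p) * (g (toC p))^*).
Proof.
move=> /inA2P[hf If] /inA2P[hg Ig].
have fR := measurable_Re (holo_contD hf); have fI := measurable_Im (holo_contD hf).
have gR := measurable_Re (holo_contD hg); have gI := measurable_Im (holo_contD hg).
have bnd p : nm (f (toC p) * (g (toC p))^*) <= sqmod (f (toC p)) + sqmod (g (toC p)).
  rewrite nmM nm_conj -!nm_sq.
  have := sqr_ge0 (nm (f (toC p)) - nm (g (toC p))); rewrite sqrrB.
  have := nm_ge0 (f (toC p)); have := nm_ge0 (g (toC p)).
  by move: (nm _) (nm _) => x y; nra.
split.
- apply: area_le_integrable (area_integrableD If Ig).
    under [X in measurable_fun _ X]eq_fun do rewrite ReMconj.
    by apply: measurable_funD; exact: measurable_funM.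
  by move=> p _; apply: le_trans (ler_Re _) _; exact: bnd.
- apply: area_le_integrable (area_integrableD If Ig).
    under [X in measurable_fun _ X]eq_fun do rewrite ImMconj.
    by apply: measurable_funB; exact: measurable_funM.
  by move=> p _; apply: le_trans (ler_Im _) _; exact: bnd.
Qed.

Lemma A2ipE (f g : C -> C) :
  A2ip f g = (pi^-1%:C)%C * cint (@area R) D (fun p => f (toC p) * (g (toC p))^*).
Proof. by apply: complex_ext; rewrite /= ?mul0r ?subr0 ?addr0 mulrC. Qed.

Lemma A2ipD (f g h : C -> C) : inA2 f -> inA2 g -> inA2 h ->
  A2ip (fun z => f z + g z) h = A2ip f h + A2ip g h.
Proof.
move=> hf hg hh; rewrite !A2ipE -mulrDr -cintD;
  [|exact: measurable_Ddisc|exact: cintegrable_ip|exact: cintegrable_ip].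
by congr (_ * _); apply: eq_cint => p _; rewrite mulrDl.
Qed.

Lemma A2ipZ (c : C) (f h : C -> C) : inA2 f -> inA2 h ->
  A2ip (fun z => c * f z) h = c * A2ip f h.
Proof.
move=> hf hh; rewrite !A2ipE [RHS]mulrCA -[X in _ = _ * X]cintZ;
  [|exact: measurable_Ddisc|exact: cintegrable_ip].
by congr (_ * _); apply: eq_cint => p _; rewrite mulrA.
Qed.

Lemma A2ipC (f g : C -> C) : inA2 f -> inA2 g -> A2ip g f = (A2ip f g)^*.
Proof.
move=> hf hg; have [iR iI] := cintegrable_ip hf hg.
apply: complex_ext => /=.
  by congr (_ / _); apply: eq_Rintegral => p _; rewrite !ReMconj; ring.
rewrite -mulNr; congr (_ / _); rewrite -mulN1r -RintegralZl; [|exact: measurable_Ddisc|exact: iI].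
by apply: eq_Rintegral => p _; rewrite !ImMconj; ring.
Qed.

(** The squared norm as a real number. It is faithful on [inA2] ([nsqE]); elsewhere [fine] would
    turn an infinite norm into 0. *)
Definition nsq (f : C -> C) : R := fine (A2normsq f).

Lemma nsqE (f : C -> C) : inA2 f -> A2normsq f = (nsq f)%:E.
Proof. by move=> [_ h]; rewrite /nsq fineK// ge0_fin_numE// A2normsq_ge0. Qed.

Lemma nsq_ge0 (f : C -> C) : 0 <= nsq f.
Proof. by rewrite fine_ge0// A2normsq_ge0. Qed.

Lemma A2ip_nsq (f : C -> C) : inA2 f -> A2ip f f = ((nsq f)%:C)%C.
Proof.
move=> hf; apply: complex_ext => /=.
- rewrite /nsq /A2normsq fineM//; last first.
    by have /inA2P[_ I] := hf; apply: integrable_fin_num; [exact: measurable_Ddisc|exact: I].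
  by congr (_ * _); apply: eq_Rintegral => p _; rewrite ReMconj.
- rewrite (_ : Rintegral _ _ _ = 0) ?mul0r//.
  rewrite (@eq_Rintegral _ _ _ _ _ (fun=> 0));
    first by rewrite Rintegral_cst ?mul0r//; exact: measurable_Ddisc.
  by move=> p _; rewrite ImMconj mulrC subrr.
Qed.
End BergmanSpace.

(** * Uniform limits of holomorphic functions *)

Section UniformLimit.
Variable R : realType.
Local Notation C := (Cplx R).
Local Notation nm := (@Normc.normc R).

(** Weierstrass' theorem: Cauchy's formula passes to the limit, so [g] is the quotient of two Cauchy
    integrals, and such integrals are differentiable for merely continuous [g]. *)
Lemma hol_unif_lim (g : C -> C) (F : nat -> C -> C) w rho : 0 < rho -> nm w + rho < 1 ->
  (forall N, holo_disc (F N)) ->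
  (forall eps, 0 < eps -> exists N, forall z, nm (z - w) < rho -> nm (g z - F N z) <= eps) ->
  hol g w.
Proof.
move=> rho0 wrho hF gF.
pose r := rho / 4; have r0 : 0 < r by rewrite divr_gt0.
have rE : rho = 4 * r by rewrite /r; field.
have box_near z : sqbox w r z -> nm (z - w) < rho.
  by move=> /sqbox_dist h; rewrite rE; lra.
have box_disc z : sqbox w r z -> nm z < 1.
  by apply: sqbox_disc; move: wrho; rewrite rE; lra.
have contg z : nm (z - w) < rho -> {for z, continuous g}.
  move=> zw; apply/continuousCP => e e0.
  have e3 : 0 < e / 4 by rewrite divr_gt0.
  have [N gN] := gF _ e3.
  have z1 : nm z < 1.
    by rewrite -[z](subrK w); apply: le_lt_trans (nmD _ _) _; lra.
  have /continuousCP /(_ _ e3) [d d0 dH] := holo_contD (hF N) z1.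
  exists (Num.min d (rho - nm (z - w))); first by rewrite lt_min d0 subr_gt0.
  move=> y; rewrite lt_min => /andP[yd yr].
  have yw : nm (y - w) < rho.
    have -> : y - w = (y - z) + (z - w) by ring.
    by apply: le_lt_trans (nmD _ _) _; lra.
  have -> : g y - g z = (g y - F N y) + ((F N y - F N z) - (g z - F N z)) by ring.
  apply: le_lt_trans (nmD _ _) _.
  have := nmD (F N y - F N z) (- (g z - F N z)); rewrite nmN.
  have := gN _ yw; have := gN _ zw; have := dH _ yd; lra.
have x01 : complex.Re w - r <= complex.Re w + r by lra.
have y01 : complex.Im w - r <= complex.Im w + r by lra.
pose T := cauchyT (complex.Re w - r) (complex.Re w + r) (complex.Im w - r) (complex.Im w + r).
have bg : bcont g (complex.Re w - r) (complex.Re w + r) (complex.Im w - r) (complex.Im w + r).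
  by move=> z /bdry_cbox /box_near /contg.
have bF N : bcont (F N) (complex.Re w - r) (complex.Re w + r) (complex.Im w - r) (complex.Im w + r).
  by move=> z /bdry_cbox /box_disc; exact: holo_contD.
have b1 : bcont (fun=> 1 : C)
    (complex.Re w - r) (complex.Re w + r) (complex.Im w - r) (complex.Im w + r).
  by move=> z _; exact: cst_continuous.
have kappa_neq0 d b : 0 < d -> within (complex.Re w - r) (complex.Re w + r)
  (complex.Im w - r) (complex.Im w + r) d b -> T 1 (fun=> 1) b != 0.
  move=> d0 wb; have [d1 d2 d3 d4] := wb.
  rewrite -nm_gt0; apply: lt_le_trans (@winding_ge _ _ _ _ _ _ _ (2 * r) d0 wb _ _ _); last 3 first.
  - lra.
  - lra.
  - lra.
  by rewrite divr_gt0// exprn_gt0// mulr_gt0.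
have formula d b : 0 < d -> within (complex.Re w - r) (complex.Re w + r)
  (complex.Im w - r) (complex.Im w + r) d b -> T 1 g b = g b * T 1 (fun=> 1) b.
  move=> d0 wb; have [d1 d2 d3 d4] := wb.
  have bb : sqbox w r b by split; apply/andP; split; lra.
  apply/eqP; rewrite -subr_eq0 -nm_eq0 eq_le nm_ge0 andbT.
  (* If [g] and [F N] differ by at most e, the defect in the formula is at most [e * Q]: the first
     term bounds the change of the integral, the second that of the value at [b]. *)
  set Q := 4 * (d^-1 ^+ 1 * 1) * (4 * r) + nm (T 1 (fun=> 1) b).
  have Q0 : 0 <= Q.
    apply: addr_ge0; last exact: nm_ge0.
    by rewrite !mulr_ge0// ?exprn_ge0// ?invr_ge0 ltW.
  have Q1 : 0 < Q + 1 by rewrite ltr_wpDl.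
  apply/ler_addgt0Pl => eps eps0; rewrite addr0.
  have eq0 : 0 < eps / (Q + 1) by rewrite divr_gt0.
  have [N gN] := gF _ eq0; set e := eps / (Q + 1) in eq0 gN.
  have CF : T 1 (F N) b = F N b * T 1 (fun=> 1) b.
    apply: (cauchy_formula d0 wb) => z /box_disc.
    by have /holo_discP := hF N; apply.
  have -> : T 1 g b - g b * T 1 (fun=> 1) b =
      (T 1 g b - T 1 (F N) b) - (g b - F N b) * T 1 (fun=> 1) b.
    by rewrite CF; ring.
  have kg := @bcont_kernel _ _ _ _ _ 1 _ _ _ d0 wb bg.
  have kF := @bcont_kernel _ _ _ _ _ 1 _ _ _ d0 wb (bF N).
  have bgF : bcont (fun z => g z - F N z)
      (complex.Re w - r) (complex.Re w + r) (complex.Im w - r) (complex.Im w + r).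
    by move=> z zb; exact: contB (bg z zb) (bF N z zb).
  have TE : T 1 g b - T 1 (F N) b = T 1 (fun z => g z - F N z) b.
    rewrite /T /cauchyT -(rectIB x01 y01 kg kF).
    by apply: (eq_rectI x01 y01) => z _; rewrite mulrBr.
  have t1 := @cauchyT_le _ _ _ _ _ x01 y01 1 _ _ _ e d0 wb bgF
    (fun z zb => gN z (box_near z (bdry_cbox zb))).
  have sE : complex.Re w + r - (complex.Re w - r) + (complex.Im w + r - (complex.Im w - r)) = 4 * r.
    by ring.
  rewrite sE -/T -TE in t1.
  have t2 : nm ((g b - F N b) * T 1 (fun=> 1) b) <= e * nm (T 1 (fun=> 1) b).
    by rewrite nmM; apply: ler_wpM2r; [exact: nm_ge0|apply: gN; exact: box_near].
  apply: (@le_trans _ _ (e * Q)).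
    apply: le_trans (nmD _ _) _; rewrite nmN.
    have -> : e * Q = 4 * (d^-1 ^+ 1 * e) * (4 * r) + e * nm (T 1 (fun=> 1) b) by rewrite /Q; ring.
    exact: lerD.
  by rewrite /e mulrAC ler_pdivrMr// ler_pM2l// lerDl.
have r20 : 0 < r / 2 by rewrite divr_gt0.
have wr := within_sqbox w r.
apply: (@near_hol _ (fun b => T 1 g b / T 1 (fun=> 1) b) _ _ _ r20).
  move=> b bw; have wb := within_near wr (ltW bw); rewrite subrK in wb.
  by rewrite (formula _ _ r20 wb) mulfK//; exact: kappa_neq0 r20 wb.
apply: holM; first by case: (is_derive_cauchyT x01 y01 r0 wr bg (or_introl erefl)).
apply: holV; last exact: kappa_neq0 r0 wr.
by case: (is_derive_cauchyT x01 y01 r0 wr b1 (or_introl erefl)).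
Qed.

(** Completeness with an explicit rate: the intervals of centre [x N] and radius [t N] meet
    pairwise, so the supremum of their left ends lies in all of them. *)
Lemma real_lim_point (x t : nat -> R) : (forall N M, (N <= M)%N -> `|x M - x N| <= t N) ->
  exists l, forall N, `|l - x N| <= t N.
Proof.
move=> H.
have key N M : x N - t N <= x M + t M.
  have h1 := H N (maxn N M) (leq_maxl _ _); have h2 := H M (maxn N M) (leq_maxr _ _).
  by move: h1 h2; rewrite !ler_norml => /andP[? ?] /andP[? ?]; lra.
exists (sup (range (fun N => x N - t N))) => N.
have up : sup (range (fun N => x N - t N)) <= x N + t N.
  apply: ge_sup; first by exists (x 0%N - t 0%N); exists 0%N.
  by move=> _ [M _ <-]; exact: key.
have lo : x N - t N <= sup (range (fun N => x N - t N)).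
  apply: sup_ubound; last by exists N.
  by exists (x 0%N + t 0%N) => _ [M _ <-]; exact: key.
by rewrite ler_norml; apply/andP; split; lra.
Qed.

Lemma complex_lim_point (x : nat -> C) (t : nat -> R) :
  (forall N M, (N <= M)%N -> nm (x M - x N) <= t N) ->
  exists l, forall N, nm (l - x N) <= 2 * t N.
Proof.
move=> H.
have [a aP] : exists l, forall N, `|l - complex.Re (x N)| <= t N.
  apply: (real_lim_point (x := fun N => complex.Re (x N))) => N M NM.
  by rewrite -ReB; apply: le_trans (ler_Re _) (H _ _ NM).
have [b bP] : exists l, forall N, `|l - complex.Im (x N)| <= t N.
  apply: (real_lim_point (x := fun N => complex.Im (x N))) => N M NM.
  by rewrite -ImB; apply: le_trans (ler_Im _) (H _ _ NM).
exists (Complex a b) => N; apply: le_trans (nm_le_ReIm _) _.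
by rewrite ReB ImB /= mulr_natl mulr2n lerD.
Qed.
End UniformLimit.

(** * Orthonormal systems in the Bergman space *)

Section Orthonormal.
Variable R : realType.
Local Notation C := (Cplx R).
Local Notation nm := (@Normc.normc R).
Local Notation D := (@Ddisc R).

Lemma A2ipDr (f g h : C -> C) : inA2 f -> inA2 g -> inA2 h ->
  A2ip h (fun z => f z + g z) = A2ip h f + A2ip h g.
Proof.
move=> hf hg hh; have hfg := inA2D hf hg.
by rewrite (A2ipC hfg hh) (A2ipC hf hh) (A2ipC hg hh) A2ipD// rmorphD.
Qed.

Lemma A2ipZr (c : C) (f h : C -> C) : inA2 f -> inA2 h ->
  A2ip h (fun z => c * f z) = c^* * A2ip h f.
Proof.
move=> hf hh; have hcf := inA2Z c hf.
by rewrite (A2ipC hcf hh) (A2ipC hf hh) A2ipZ// rmorphM.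
Qed.

Lemma nsqD (f g : C -> C) : inA2 f -> inA2 g ->
  nsq (fun z => f z + g z) = nsq f + nsq g + 2 * complex.Re (A2ip f g).
Proof.
move=> hf hg; have hfg := inA2D hf hg.
have := A2ip_nsq hfg; rewrite A2ipD// !A2ipDr// (A2ipC hf hg) !A2ip_nsq//.
have Rc (x : C) : complex.Re (x^*) = complex.Re x by case: x.
move: (A2ip f g) => x /(congr1 (@complex.Re R)); rewrite !ReD Rc /= => <-.
by ring.
Qed.

Lemma nsqZ (c : C) (f : C -> C) : inA2 f -> nsq (fun z => c * f z) = sqmod c * nsq f.
Proof.
move=> hf; have hcf := inA2Z c hf.
have := A2ip_nsq hcf; rewrite A2ipZ// A2ipZr// A2ip_nsq// => /(congr1 (@complex.Re R)).
have Rr (x : R) : complex.Re (x%:C)%C = x by [].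
have Ir (x : R) : complex.Im (x%:C)%C = 0 by [].
by rewrite mulrA ReM ReMconj ImMconj !Rr Ir mulr0 subr0 -!expr2 => <-.
Qed.

Lemma nsqN (f : C -> C) : inA2 f -> nsq (fun z => - f z) = nsq f.
Proof.
move=> hf; have -> : (fun z => - f z) = (fun z => (-1) * f z) by apply/funext => z; rewrite mulN1r.
by rewrite nsqZ// -nm_sq nmN nm1 expr1n mul1r.
Qed.

Lemma nsq_eq (f g : C -> C) : (forall z, nm z < 1 -> f z = g z) -> nsq f = nsq g.
Proof.
move=> fg; rewrite /nsq /A2normsq; congr (fine (_ * _)%E).
by apply: eq_integral => p /set_mem /DdiscE p1; rewrite fg.
Qed.

(* A form of Cauchy-Schwarz that avoids square roots; one optimises over [lam]. *)
Lemma A2ip_le (f g : C -> C) lam : inA2 f -> inA2 g -> 0 < lam ->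
  nm (A2ip f g) <= lam * nsq f + lam^-1 * nsq g.
Proof.
move=> hf hg lam0.
have /inA2P[_ If] := hf; have /inA2P[_ Ig] := hg.
have pi0 := pi_gt0R R.
(* The weights are halved to absorb the factor 2 of [nm_cint_le]. *)
have I2 := area_integrableD (area_integrableZ (lam / 2) If) (area_integrableZ (lam^-1 / 2) Ig).
have nsqR (h : C -> C) : inA2 h -> Rintegral (@area R) D (fun p => sqmod (h (toC p))) = nsq h * pi.
  move=> hh; rewrite /nsq /A2normsq fineM//; last first.
    by have /inA2P[_ I] := hh; apply: integrable_fin_num; [exact: measurable_Ddisc|exact: I].
  by rewrite /= divfK// gt_eqF.
have pt p : D p -> nm (f (toC p) * (g (toC p))^*) <=
    lam / 2 * sqmod (f (toC p)) + lam^-1 / 2 * sqmod (g (toC p)).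
  move=> _; rewrite nmM nm_conj -!nm_sq -(ler_pM2l lam0).
  have h := sqr_ge0 (lam * nm (f (toC p)) - nm (g (toC p))).
  have -> : lam * (lam / 2 * nm (f (toC p)) ^+ 2 + lam^-1 / 2 * nm (g (toC p)) ^+ 2) =
     (lam ^+ 2 * nm (f (toC p)) ^+ 2 + nm (g (toC p)) ^+ 2) / 2 by field; rewrite gt_eqF.
  by move: h; rewrite sqrrB exprMn; lra.
have le := @nm_cint_le _ _ _ (@area R) D (fun p => f (toC p) * (g (toC p))^*) _
  (@measurable_Ddisc R) (cintegrable_ip hf hg) I2 pt.
rewrite A2ipE nmM nm_real ger0_norm ?invr_ge0 ?(ltW pi0)//.
rewrite mulrC ler_pdivrMr//; apply: le_trans le _.
rewrite RintegralD; [|exact: measurable_Ddisc|exact: area_integrableZ|exact: area_integrableZ].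
rewrite !RintegralZl; [|exact: measurable_Ddisc|exact: Ig|exact: measurable_Ddisc|exact: If].
by rewrite !nsqR// le_eqVlt; apply/orP; left; apply/eqP; field; rewrite gt_eqF.
Qed.

Section family.
Variable e : nat -> C -> C.
Hypothesis eA2 : forall i, inA2 (e i).
Hypothesis eON : forall i j, A2ip (e i) (e j) = (i == j)%:R.

Definition comb (a : nat -> C) (s : seq nat) : C -> C := fun z => \sum_(i <- s) a i * e i z.

Lemma comb_cons a i s : comb a (i :: s) = (fun z => a i * e i z + comb a s z).
Proof. by apply/funext => z; rewrite /comb big_cons. Qed.

Lemma inA2_comb a s : inA2 (comb a s).
Proof. by apply: inA2_sum => i; exact: inA2Z. Qed.
Hint Resolve inA2_comb eA2 : core.

Lemma A2ip0l (h : C -> C) : inA2 h -> A2ip (fun=> 0) h = 0.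
Proof.
move=> hh; have -> : (fun=> 0 : C) = (fun z : C => 0 * h z) by apply/funext => z; rewrite mul0r.
by rewrite A2ipZ// mul0r.
Qed.

Lemma comb_nil a : comb a [::] = (fun=> 0).
Proof. by apply/funext => z; rewrite /comb big_nil. Qed.

Lemma A2ip_comb a s j : uniq s -> A2ip (comb a s) (e j) = if j \in s then a j else 0.
Proof.
elim: s => [|i s ih]; first by rewrite comb_nil A2ip0l.
move=> /= /andP[nis us]; rewrite comb_cons A2ipD//; last exact: inA2Z.
rewrite A2ipZ// eON ih// inE; have [<-|ji] := eqVneq i j.
  by rewrite (negbTE nis) /= mulr1 addr0.
by rewrite /= mulr0 add0r.
Qed.

Lemma A2ip_comb_r a s h : inA2 h -> A2ip h (comb a s) = \sum_(i <- s) (a i)^* * A2ip h (e i).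
Proof.
move=> hh; elim: s => [|i s ih].
  by rewrite comb_nil big_nil (A2ipC (@inA2_0 R) hh) A2ip0l// rmorph0.
by rewrite comb_cons A2ipDr//; [rewrite A2ipZr// big_cons ih|exact: inA2Z].
Qed.

Lemma nsq_e i : nsq (e i) = 1.
Proof. by have := A2ip_nsq (eA2 i); rewrite eON eqxx => /(congr1 (@complex.Re R)). Qed.

Lemma nsq_comb a s : uniq s -> nsq (comb a s) = \sum_(i <- s) sqmod (a i).
Proof.
elim: s => [|i s ih].
  rewrite comb_nil big_nil; have -> : (fun=> 0 : C) = (fun z : C => 0 * e 0%N z).
    by apply/funext => z; rewrite mul0r.
  by rewrite nsqZ// -nm_sq nm0 expr0n mul0r.
move=> /= /andP[nis us]; rewrite comb_cons nsqD//; last exact: inA2Z.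
rewrite nsqZ// nsq_e mulr1 big_cons ih// A2ipZ// (A2ipC (inA2_comb a s) (eA2 i)).
by rewrite A2ip_comb// (negbTE nis) rmorph0 mulr0 mulr0 addr0.
Qed.

(** Pythagoras: the remainder is orthogonal to each [e i] with [i] in [s]. Bessel's inequality is
    the nonnegativity of the left side. *)
Lemma nsq_proj f s : inA2 f -> uniq s ->
  nsq (fun z => f z - comb (fun i => A2ip f (e i)) s z) =
  nsq f - \sum_(i <- s) sqmod (A2ip f (e i)).
Proof.
move=> hf us; pose a i := A2ip f (e i); pose g z := f z - comb a s z.
change (nsq g = nsq f - \sum_(i <- s) sqmod (a i)).
have hg : inA2 g by exact: inA2B.
have fE : f = (fun z => g z + comb a s z) by apply/funext => z; rewrite /g subrK.
rewrite [in RHS]fE nsqD// nsq_comb// A2ip_comb_r//.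
have g0 i : i \in s -> A2ip g (e i) = 0.
  move=> si; have : A2ip f (e i) = A2ip g (e i) + A2ip (comb a s) (e i).
    by rewrite -A2ipD// -fE.
  rewrite A2ip_comb// si -/(a i) => /eqP; rewrite -subr_eq subrr => /eqP <- //.
rewrite [X in 2 * complex.Re X]big1_seq ?mulr0 ?addr0; last first.
  by move=> i /= si; rewrite g0// mulr0.
by rewrite /= ?mulr0 ?addr0 addrK.
Qed.

Lemma bessel f s : inA2 f -> uniq s -> \sum_(i <- s) sqmod (A2ip f (e i)) <= nsq f.
Proof. by move=> hf us; rewrite -subr_ge0 -nsq_proj//; exact: nsq_ge0. Qed.

Definition psum a N := comb a (index_iota 0 N).

Lemma inA2_psum a N : inA2 (psum a N). Proof. exact: inA2_comb. Qed.
Hint Resolve inA2_psum : core.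

Lemma nsq_psumB a N M : (N <= M)%N ->
  nsq (fun z => psum a M z - psum a N z) =
  \sum_(0 <= i < M) sqmod (a i) - \sum_(0 <= i < N) sqmod (a i).
Proof.
move=> NM; have -> : (fun z => psum a M z - psum a N z) = comb a (index_iota N M).
  apply/funext => z; rewrite /psum /comb.
  by rewrite (big_cat_nat (leq0n N) NM)/= addrAC subrr add0r.
rewrite nsq_comb ?iota_uniq// [X in _ = X - _](big_cat_nat (leq0n N) NM)/=.
by rewrite addrAC subrr add0r.
Qed.

(** Completeness is proved along the way. By [eval_bound] the partial sums converge locally
    uniformly, so their pointwise limit is holomorphic; Fatou's lemma then bounds the norm of what
    remains by the tail of the series. *)
Lemma riesz_fischer (a : nat -> C) B : (forall N, \sum_(0 <= i < N) sqmod (a i) <= B) ->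
  exists g, inA2 g /\ forall eps, 0 < eps -> exists N0, forall N, (N0 <= N)%N ->
    nsq (fun z => g z - psum a N z) <= eps.
Proof.
move=> PB; pose P N := \sum_(0 <= i < N) sqmod (a i).
have Pmono N M : (N <= M)%N -> P N <= P M.
  move=> NM; rewrite /P [leRHS](big_cat_nat (leq0n N) NM)/= lerDl.
  by apply: sumr_ge0 => i _; exact: sqmod_ge0.
pose L := sup (range P).
have hasub : has_sup (range P).
  by split; [exists (P 0%N); exists 0%N|exists B => _ [N _ <-]; exact: PB].
have PL N : P N <= L by apply: sup_ubound; [exact: hasub.2|exists N].
pose tail N := L - P N.
have tail0 N : 0 <= tail N by rewrite subr_ge0.
have tail_small eps : 0 < eps -> exists N0, forall N, (N0 <= N)%N -> tail N <= eps.
  move=> eps0; have [_ [N0 _ <-] h] := sup_adherent eps0 hasub.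
  by exists N0 => N /Pmono; rewrite /tail; move: h; rewrite -/L; lra.
have [K K0 ev] := eval_bound R 0.
pose t N (z : C) := Num.sqrt (K * tail N) / (1 - nm z).
have step N M z : nm z < 1 -> (N <= M)%N -> nm (psum a M z - psum a N z) <= t N z.
  move=> z1 NM; have d0 : 0 < 1 - nm z by rewrite subr_gt0.
  have hB : inA2 (fun z => psum a M z - psum a N z) by exact: inA2B.
  have := ev _ z hB.1 z1; rewrite nsqE// -EFinM lee_fin nsq_psumB// -/(P M) -/(P N).
  rewrite /cderiv derive1n0 -exprMn => h.
  have n0 : 0 <= nm (psum a M z - psum a N z) * (1 - nm z).
    by apply: mulr_ge0; [exact: nm_ge0|exact: ltW].
  rewrite /t ler_pdivlMr// -(ger0_norm n0) -sqrtr_sqr ler_wsqrtr//.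
  apply: le_trans h _; rewrite ler_pM2l// /tail lerD2r; exact: PL.
(* Outside the disc the limit function takes the default value 0. *)
have /choice[g gP] : forall z : C, exists l : C, nm z < 1 ->
    forall N, nm (l - psum a N z) <= 2 * t N z.
  move=> z; have [z1|z1] := ltP (nm z) 1; last by exists 0.
  have [l lP] := @complex_lim_point _ (fun N => psum a N z) (fun N => t N z)
    (fun N M => step N M z z1).
  by exists l.
have t_small z eps : nm z < 1 -> 0 < eps -> exists N0, forall N, (N0 <= N)%N -> t N z <= eps.
  move=> z1 eps0; have d0 : 0 < 1 - nm z by rewrite subr_gt0.
  have e1 : 0 < (eps * (1 - nm z)) ^+ 2 / K by rewrite divr_gt0// exprn_gt0// mulr_gt0.
  have [N0 N0P] := tail_small _ e1; exists N0 => N /N0P.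
  rewrite ler_pdivlMr// mulrC => h; rewrite /t ler_pdivrMr//.
  apply: le_trans (ler_wsqrtr h) _; rewrite sqrtr_sqr ger0_norm//.
  by apply: mulr_ge0; exact: ltW.
have holg : holo_disc g.
  apply/holo_discP => w w1.
  have d0 : 0 < 1 - nm w by rewrite subr_gt0.
  pose rho := (1 - nm w) / 2; have rho0 : 0 < rho by rewrite divr_gt0.
  apply: (@hol_unif_lim _ g (psum a) w rho rho0); first by rewrite /rho; lra.
    by move=> N; exact: (inA2_psum a N).1.
  move=> eps eps0; have e1 : 0 < (eps / 2 * rho) ^+ 2 / K.
    by rewrite divr_gt0// exprn_gt0// mulr_gt0// divr_gt0.
  have [N0 N0P] := tail_small _ e1; exists N0 => z zw.
  have zr : nm z <= 1 - rho.
    by rewrite -[z](subrK w); apply: le_trans (nmD _ _) _; move: zw; rewrite /rho; lra.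
  have z1 : nm z < 1 by lra.
  apply: le_trans (gP z z1 N0) _.
  have h := N0P N0 (leqnn _); rewrite ler_pdivlMr// mulrC in h.
  have : t N0 z <= eps / 2; last by lra.
  rewrite /t ler_pdivrMr ?subr_gt0//.
  apply: le_trans (ler_wsqrtr h) _; rewrite sqrtr_sqr ger0_norm; last first.
    by apply: mulr_ge0; [apply: divr_ge0 => //; exact: ltW|exact: ltW].
  by apply: ler_wpM2l; [apply: divr_ge0 => //; exact: ltW|lra].
have fat (N : nat) : (A2normsq (fun z : C => (g z - psum a N z)%R) <= (tail N)%:E)%E.
  pose F M (p : R * R) := (sqmod (psum a M (toC p) - psum a N (toC p)))%:E.
  have F0 M p : D p -> (0 <= F M p)%E by move=> _; rewrite lee_fin; exact: sqmod_ge0.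
  have mF M : measurable_fun D (F M).
    have h := inA2B (inA2_psum a M) (inA2_psum a N).
    exact: (measurable_sqmodE (holo_contD h.1)).
  have fa := fatou (@area R) (@measurable_Ddisc R) mF F0.
  have lim p : D p -> limn_einf (F^~ p) = (sqmod (g (toC p) - psum a N (toC p)))%:E.
    move=> /DdiscE p1; set z := toC p in p1 *.
    apply: (cvg_limn_einf_sup _).1; apply: cvg_EFin; first by apply: nearW.
    rewrite -nm_sq.
    have -> : fine \o F^~ p =
        (fun M => nm (psum a M z - psum a N z) * nm (psum a M z - psum a N z)).
      by apply/funext => M; rewrite /F /= -nm_sq.
    have c1 : (fun M => nm (psum a M z - psum a N z)) @ \oo --> nm (g z - psum a N z).
      apply/cvgrPdist_le => eps eps0.
      have e2 : 0 < eps / 2 by rewrite divr_gt0.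
      have [N0 N0P] := t_small z (eps / 2) p1 e2; exists N0 => // M /= /N0P tM.
      have gM := gP z p1 M.
      have h1 := nmB_ge (g z - psum a N z) (psum a M z - psum a N z).
      have h2 := nmB_ge (psum a M z - psum a N z) (g z - psum a N z).
      have E1 : g z - psum a N z - (psum a M z - psum a N z) = g z - psum a M z by ring.
      have E2 : psum a M z - psum a N z - (g z - psum a N z) = psum a M z - g z by ring.
      rewrite E1 in h1; rewrite E2 (nmBC (psum a M z) (g z)) in h2.
      by rewrite ler_norml; apply/andP; split; lra.
    by rewrite expr2; exact: (cvgM c1 c1).
  rewrite /A2normsq; set I := (\int[_]_(p in _) _)%E.
  have pi0 := pi_gt0R R.
  have up : (I <= (tail N * pi)%:E)%E.
    apply: (@le_trans _ _ (\int[@area R]_(p in D) limn_einf (F^~ p))%E).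
      rewrite le_eqVlt; apply/orP; left; apply/eqP.
      by apply: eq_integral => p /set_mem Dp; rewrite lim.
    apply: le_trans fa _; rewrite limn_einf_lim.
    apply: lime_le; first exact: is_cvg_einfs.
    apply: nearW => m; apply: (@le_trans _ _ (\int[@area R]_(p in D) F (maxn m N) p)%E).
      by apply: ereal_inf_lbound; exists (maxn m N) => //=; exact: leq_maxl.
    have h := inA2B (inA2_psum a (maxn m N)) (inA2_psum a N).
    have := nsqE h; rewrite nsq_psumB ?leq_maxr// /A2normsq.
    have /inA2P[_ Ih] := h.
    have fin : (\int[@area R]_(p in D) F (maxn m N) p)%E \is a fin_num.
      by apply: integrable_fin_num; [exact: measurable_Ddisc|exact: Ih].
    rewrite -/(P _) -/(P N) -(fineK fin) -EFinM => -[] E.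
    rewrite lee_fin -ler_pdivrMr// E /tail lerD2r; exact: PL.
  apply: (@le_trans _ _ ((tail N * pi)%:E * (pi^-1)%:E)%E).
    by apply: lee_wpmul2r => //; rewrite lee_fin invr_ge0 ltW.
  by rewrite -EFinM mulfK// gt_eqF.
have hgN (N : nat) : inA2 (fun z : C => g z - psum a N z).
  split; last by apply: le_lt_trans (fat N) _; exact: ltry.
  have := (inA2_psum a N).1 => h; apply/holo_discP => z z1; apply: holB.
    by move/holo_discP: holg; apply.
  by move/holo_discP: h; apply.
exists g; split.
  have := inA2D (hgN 0%N) (inA2_psum a 0%N).
  by under [X in inA2 X -> _]eq_fun do rewrite subrK.
move=> eps /tail_small[N0 N0P]; exists N0 => N /N0P h.
by rewrite -lee_fin -nsqE//; apply: le_trans (fat N) _; rewrite lee_fin.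
Qed.
End family.
End Orthonormal.

(** * Bounded functionals and orthonormal bases *)

Section Functionals.
Variable R : realType.
Local Notation C := (Cplx R).
Local Notation nm := (@Normc.normc R).

(** Undoes the weighted arithmetic-geometric inequality: [lam = x / A] is optimal. If [A = 0] and
    [x > 0], the large value [(B + 1) / x] is contradictory. *)
Lemma sq_le_of_amgm (x A B : R) : 0 <= x -> 0 <= A -> 0 <= B ->
  (forall lam, 0 < lam -> 2 * x <= lam * A + lam^-1 * B) -> x ^+ 2 <= A * B.
Proof.
move=> x0 A0 B0 H.
have [->|xn0] := eqVneq x 0; first by rewrite expr0n mulr_ge0.
have xp : 0 < x by rewrite lt0r xn0.
have [A00|An0] := eqVneq A 0.
  have l0 : 0 < (B + 1) / x by rewrite divr_gt0// ltr_wpDl.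
  have := H _ l0; rewrite A00 mulr0 add0r mul0r invf_div mulrAC.
  rewrite ler_pdivlMr ?ltr_wpDl// => h.
  have : x * (B + 2) <= 0 by nra.
  by rewrite pmulr_rle0// leNgt ltr_wpDl.
have Ap : 0 < A by rewrite lt0r An0.
have l0 : 0 < x / A by rewrite divr_gt0.
have := H _ l0; rewrite divfK// invf_div mulrAC => h.
have : x <= A * B / x by lra.
by rewrite ler_pdivlMr// expr2.
Qed.

(* [K] bounds the square of the norm of the functional [l]. *)
Definition bfun (l : (C -> C) -> C) (K : R) :=
  [/\ forall f g, inA2 f -> inA2 g -> l (fun z => f z + g z) = l f + l g,
      forall c f, inA2 f -> l (fun z => c * f z) = c * l f &
      forall f, inA2 f -> nm (l f) ^+ 2 <= K * nsq f].

Lemma bfunD l1 l2 K1 K2 : bfun l1 K1 -> bfun l2 K2 ->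
  bfun (fun f => l1 f + l2 f) (2 * K1 + 2 * K2).
Proof.
move=> [a1 s1 b1] [a2 s2 b2]; split.
- by move=> f g hf hg; rewrite a1// a2// addrACA.
- by move=> c f hf; rewrite s1// s2// mulrDr.
- move=> f hf; have := b1 f hf; have := b2 f hf; rewrite !nm_sq.
  have := sqmodD_le (l1 f) (l2 f); lra.
Qed.

Lemma bfunZ c l K : bfun l K -> bfun (fun f => c * l f) (sqmod c * K).
Proof.
move=> [a s b]; split.
- by move=> f g hf hg; rewrite a// mulrDr.
- by move=> c' f hf; rewrite s// mulrCA.
- move=> f hf; rewrite nmM exprMn nm_sq -mulrA; apply: ler_wpM2l; first exact: sqmod_ge0.
  exact: b.
Qed.

Lemma bfun_cderiv k w : nm w < 1 -> exists K, bfun (fun f => cderiv k f w) K.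
Proof.
move=> w1; have [K K0 ev] := eval_bound R k.
have d0 : 0 < (1 - nm w) ^+ (k.+1).*2 by rewrite exprn_gt0// subr_gt0.
exists (K / (1 - nm w) ^+ (k.+1).*2); split.
- by move=> f g hf hg; apply: cderivD w1; [exact: hf.1|exact: hg.1].
- by move=> c f hf; apply: cderivZ w1; exact: hf.1.
- move=> f hf; have := ev f w hf.1 w1; rewrite nsqE// -EFinM lee_fin => h.
  by rewrite (mulrAC K) ler_pdivlMr.
Qed.

Lemma bfun_sum n (c : nat -> C) w : nm w < 1 ->
  exists K, bfun (fun f => \sum_(k < n) c k * cderiv k f w) K.
Proof.
move=> w1; elim: n => [|n [K ih]].
  exists 0; split.
  - by move=> f g _ _; rewrite !big_ord0 addr0.
  - by move=> c' f _; rewrite !big_ord0 mulr0.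
  - by move=> f _; rewrite big_ord0 nm0 expr0n mul0r.
have [K' h] := bfun_cderiv n w1.
exists (2 * K + 2 * (sqmod (c n) * K')).
have := bfunD ih (bfunZ (c n) h).
by under [X in bfun X _ -> _]eq_fun do
  rewrite -[_ + _](big_ord_recr n (fun k => c k * cderiv k _ w)).
Qed.

Section orthonormal.
Variables (e : nat -> C -> C) (l : (C -> C) -> C) (K : R).
Hypothesis eA2 : forall i, inA2 (e i).
Hypothesis eON : forall i j, A2ip (e i) (e j) = (i == j)%:R.
Hypothesis lK : bfun l K.

Lemma bfun_comb a s : l (comb e a s) = \sum_(i <- s) a i * l (e i).
Proof.
have [add scal _] := lK; elim: s => [|i s ih].
  rewrite big_nil comb_nil; have -> : (fun=> 0 : C) = (fun z : C => 0 * e 0%N z).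
    by apply/funext => z; rewrite mul0r.
  by rewrite scal// mul0r.
rewrite comb_cons big_cons add; [|exact: inA2Z|exact: inA2_comb].
by rewrite scal// ih.
Qed.

(** Testing [l] on the combination with conjugate coefficients gives a vector whose image and
    squared norm are both the sum [S], so that S^2 <= K S. *)
Lemma bfun_sum_le N : \sum_(0 <= i < N) sqmod (l (e i)) <= K.
Proof.
have [_ _ bnd] := lK.
set s := index_iota 0 N; pose a i := (l (e i))^*.
have us : uniq s by exact: iota_uniq.
set S := \sum_(i <- s) _.
have S0 : 0 <= S by apply: sumr_ge0 => i _; exact: sqmod_ge0.
have lE : nm (l (comb e a s)) = S.
  have -> : l (comb e a s) = (S%:C)%C.
    rewrite bfun_comb rmorph_sum; apply: eq_bigr => i _.
    by rewrite /a mulrC; apply: complex_ext; rewrite ?ReMconj ?ImMconj /= -?expr2// mulrC subrr.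
  by rewrite nm_real ger0_norm.
have nE : nsq (comb e a s) = S.
  rewrite nsq_comb//; apply: eq_bigr => i _.
  by rewrite -!nm_sq nm_conj.
have := bnd _ (inA2_comb eA2 a s); rewrite lE nE => h.
(* If [S = 0] the claim is [0 <= K], which follows from the bound on the unit vector [e 0]. *)
have [->|Sn0] := eqVneq S 0; last by move: h; rewrite expr2 ler_pM2r// lt0r Sn0.
have := bnd _ (eA2 0%N); rewrite nsq_e// mulr1; apply: le_trans.
by rewrite exprn_ge0.
Qed.
End orthonormal.

(** [A2_ONB] expresses maximality, while density is wanted. The Riesz-Fischer sum of the Fourier
    coefficients of [f] has the same coefficients as [f], hence equals [f] on the disc. *)
Lemma onb_approx (e : nat -> C -> C) (f : C -> C) eps : A2_ONB e -> inA2 f -> 0 < eps ->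
  exists N, nsq (fun z => f z - psum e (fun i => A2ip f (e i)) N z) <= eps.
Proof.
move=> [eA2 eON emax] hf eps0; pose a i := A2ip f (e i).
have [g [hg gP]] := riesz_fischer eA2 eON
  (fun N => bessel eA2 eON hf (iota_uniq 0 (N - 0)) : \sum_(0 <= i < N) sqmod (a i) <= nsq f).
have ga i : A2ip g (e i) = a i.
  apply/eqP; rewrite -subr_eq0 -nm_eq0 eq_le nm_ge0 andbT.
  apply/ler_addgt0Pl => eta eta0; rewrite addr0.
  have e2 : 0 < eta ^+ 2 / 4 by rewrite divr_gt0// exprn_gt0.
  have [N0 N0P] := gP _ e2.
  (* [N] exceeds [i], so the coefficient of the partial sum along [e i] is already [a i]. *)
  set N := maxn N0 i.+1; have := N0P N (leq_maxl _ _) => small.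
  have hp := inA2_psum eA2 a N.
  have hgp := inA2B hg hp.
  have E : A2ip g (e i) = A2ip (fun z => g z - psum e a N z) (e i) + a i.
    have {1}-> : g = (fun z => (g z - psum e a N z) + psum e a N z).
      by apply/funext => z; rewrite subrK.
    rewrite A2ipD//; congr (_ + _).
    by rewrite /psum A2ip_comb ?iota_uniq// mem_index_iota /= leq_maxr.
  rewrite E addrK.
  (* With a squared norm of at most [eta ^+ 2 / 4], this weight makes both terms of [A2ip_le] at
     most [eta / 2]. *)
  have l0 : 0 < 2 / eta by rewrite divr_gt0.
  apply: le_trans (A2ip_le hgp (eA2 i) l0) _.
  rewrite nsq_e// mulr1 invf_div.
  apply: (@le_trans _ _ (2 / eta * (eta ^+ 2 / 4) + eta / 2)).
    by rewrite lerD2r; apply: ler_wpM2l small; exact: ltW.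
  by rewrite le_eqVlt; apply/orP; left; apply/eqP; field; rewrite gt_eqF.
have hfg := inA2B hf hg.
have fg z : nm z < 1 -> f z = g z.
  move=> z1; apply/eqP; rewrite -subr_eq0; apply/eqP.
  apply: (emax (fun z => f z - g z)) => //; last by rewrite lt1_norm.
  move=> i; have : A2ip f (e i) = A2ip (fun z => f z - g z) (e i) + A2ip g (e i).
    have E : (fun z => (f z - g z) + g z) = f by apply/funext => y; rewrite subrK.
    by have := A2ipD hfg hg (eA2 i); rewrite E.
  by rewrite ga -/(a i) => /eqP; rewrite -subr_eq subrr => /eqP <-.
have [N0 N0P] := gP _ eps0; exists N0; apply: le_trans (N0P N0 (leqnn _)).
rewrite le_eqVlt; apply/orP; left; apply/eqP; apply: nsq_eq => z z1.
by rewrite fg.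
Qed.

(** Cauchy-Schwarz for coefficients on the partial sums of [f]. The bound [K] serves only to neglect
    the remainder, so it disappears from the conclusion. *)
Lemma bfun_le (e : nat -> C -> C) l K (f : C -> C) B : A2_ONB e -> bfun l K -> inA2 f ->
  (forall N, \sum_(0 <= i < N) sqmod (l (e i)) <= B) -> nm (l f) ^+ 2 <= nsq f * B.
Proof.
move=> onb lK hf HB; have [eA2 eON _] := onb; have [add scal bnd] := lK.
have B0 : 0 <= B by apply: le_trans (HB 0%N); rewrite big_geq.
apply: sq_le_of_amgm => //; [exact: nm_ge0|exact: nsq_ge0|].
move=> lam lam0; apply/ler_addgt0Pl => eta eta0.
pose a i := A2ip f (e i).
have K1 : 0 < `|K| + 1 by rewrite ltr_wpDl.
(* Makes the value of [l] on the remainder at most [eta / 2]; its double is the allowed error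
   [eta]. *)
have eps0 : 0 < (eta / 2) ^+ 2 / (`|K| + 1) by rewrite divr_gt0// exprn_gt0// divr_gt0.
have [N NP] := onb_approx onb hf eps0.
have hp := inA2_psum eA2 a N; have hfp := inA2B hf hp.
have -> : l f = l (fun z => f z - psum e a N z) + l (psum e a N).
  by rewrite -add//; congr l; apply/funext => z; rewrite subrK.
have h1 : nm (l (fun z => f z - psum e a N z)) <= eta / 2.
  rewrite -ler_sqr ?nnegrE ?divr_ge0 ?(ltW eta0)//.
  apply: le_trans (bnd _ hfp) _; rewrite ler_pdivlMr// in NP.
  apply: le_trans NP; rewrite mulrC; apply: ler_wpM2l; first exact: nsq_ge0.
  by apply: le_trans (ler_norm K) _; rewrite lerDl.
have h2 : 2 * nm (l (psum e a N)) <= lam * nsq f + lam^-1 * B.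
  rewrite /psum (bfun_comb eA2 lK).
  apply: (@le_trans _ _ (\sum_(0 <= i < N) (lam * sqmod (a i) + lam^-1 * sqmod (l (e i))))).
    apply: (@le_trans _ _ (2 * \sum_(0 <= i < N) nm (a i * l (e i)))).
      by rewrite ler_pM2l//; exact: nm_sum.
    rewrite mulr_sumr; apply: ler_sum => i _; rewrite nmM -!nm_sq.
    have h := sqr_ge0 (lam * nm (a i) - nm (l (e i))).
    rewrite -(ler_pM2l lam0).
    have -> : lam * (lam * nm (a i) ^+ 2 + lam^-1 * nm (l (e i)) ^+ 2) =
       lam ^+ 2 * nm (a i) ^+ 2 + nm (l (e i)) ^+ 2 by field; rewrite gt_eqF.
    by move: h; rewrite sqrrB exprMn; lra.
  rewrite big_split /= -!mulr_sumr; apply: lerD; apply: ler_wpM2l.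
  - exact: ltW.
  - exact: (bessel eA2 eON hf (iota_uniq 0 (N - 0))).
  - by rewrite invr_ge0 ltW.
  - exact: HB.
have := nmD (l (fun z => f z - psum e a N z)) (l (psum e a N)); lra.
Qed.
End Functionals.

(** * Lower bounds for combinations of derivative evaluations *)

Section TestFunctions.
Variable R : realType.
Local Notation C := (Cplx R).
Local Notation nm := (@Normc.normc R).
Local Notation D := (@Ddisc R).
Local Notation leb := (@lebesgue_measure R).

(** [pi] times the density of the Cauchy distribution of centre [c] and scale [del]. *)
Definition cauchy_density (del c x : R) : R := del / (del ^+ 2 + (x - c) ^+ 2).

Lemma cauchy_density_ge0 del c x : 0 < del -> 0 <= cauchy_density del c x.
Proof. by move=> d0; rewrite divr_ge0 ?addr_ge0 ?sqr_ge0// ltW. Qed.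

Lemma cauchy_density2_ge0 del a b x y : 0 < del ->
  0 <= 4 * cauchy_density del a x * cauchy_density del b y.
Proof.
move=> d0; apply: mulr_ge0; last exact: cauchy_density_ge0.
by apply: mulr_ge0; [by []|exact: cauchy_density_ge0].
Qed.

Lemma continuous_cauchy_density del c : 0 < del -> continuous (cauchy_density del c).
Proof.
move=> d0 x; rewrite /cauchy_density.
have cd : {for x, continuous (fun x : R => del ^+ 2 + (x - c) ^+ 2)}.
  apply: (@continuousD _ _ _ (cst (del ^+ 2)) (fun x => (x - c) ^+ 2)); first exact: cst_continuous.
  have c1 : {for x, continuous (fun x : R => x - c)}.
    by apply: (@continuousB _ _ _ id (cst c)); [exact: cvg_id|exact: cst_continuous].
  by apply: continuousM.
apply: (@continuousM _ _ (cst del) (fun x => (del ^+ 2 + (x - c) ^+ 2)^-1));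
  first exact: cst_continuous.
apply: (@continuousV _ _ (fun x => del ^+ 2 + (x - c) ^+ 2)) => //.
by rewrite gt_eqF// ltr_pwDl ?exprn_gt0// sqr_ge0.
Qed.

(** An antiderivative is the arctangent of [(x - c) / del], whose values lie in an interval of
    length [pi] whatever [c] and [del]. *)
Lemma cauchy_density_integral (del c : R) : 0 < del ->
  (\int[leb]_(x in `[(-1)%R, 1%R]) (cauchy_density del c x)%:E <= pi%:E)%E.
Proof.
move=> d0.
pose F (x : R) := atan ((x - c) / del).
have dF (x : R) : is_derive x (1 : R) F (cauchy_density del c x).
  have dg : is_derive x (1 : R) (fun x : R => (x - c) / del) (del^-1).
    have h := is_deriveM (is_deriveB (is_derive_id x (1 : R)) (is_derive_cst c x (1 : R)))
      (is_derive_cst (del^-1) x (1 : R)).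
    by apply: (is_derive_eq h); rewrite /GRing.scale /= mulr0 add0r subr0 mulr1.
  have da : is_derive ((x - c) / del) (1 : R) (@atan R) (1 + ((x - c) / del) ^+ 2)^-1.
    by rewrite -derive1_atan derive1E; apply: derivableP; exact: derivable_atan.
  have h := @is_derive1_comp _ (@atan R) (fun x : R => (x - c) / del) x _ _ da dg.
  apply: (is_derive_eq h).
  have q0 : del ^+ 2 + (x - c) ^+ 2 != 0 by rewrite gt_eqF// ltr_pwDl ?exprn_gt0// sqr_ge0.
  have E : 1 + ((x - c) / del) ^+ 2 = (del ^+ 2 + (x - c) ^+ 2) / del ^+ 2.
    by field; rewrite gt_eqF.
  rewrite E /cauchy_density; field.
  by rewrite q0 gt_eqF.
have cF (x : R) : {for x, continuous F}.
  by apply: differentiable_continuous; apply/derivable1_diffP; case: (dF x).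
have lt11 : -1 < 1 :> R by lra.
have cw : {within `[-1, 1], continuous (cauchy_density del c)}.
  by apply: continuous_in_subspaceT => x _; exact: continuous_cauchy_density.
have LR : derivable_oo_LRcontinuous F (-1) 1.
  split.
  - by move=> x _; case: (dF x).
  - by apply: cvg_at_right_filter; exact: cF.
  - by apply: cvg_at_left_filter; exact: cF.
have F' : {in `]-1, 1[, derive1 F =1 cauchy_density del c}.
  by move=> x _; rewrite derive1E; case: (dF x).
rewrite (continuous_FTC2 lt11 cw LR F').
rewrite -EFinB lee_fin /F.
have := atan_ltpi2 ((1 - c) / del); have := atan_gtNpi2 ((-1 - c) / del); lra.
Qed.

(** Enlarging the disc to the square of side 2 makes the integral factor by Tonelli's theorem. *)
Lemma poisson_disc_integral del a b : 0 < del ->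
  (\int[@area R]_(p in D) (4 * cauchy_density del a p.1 * cauchy_density del b p.2)%:E
    <= (4 * pi ^+ 2)%:E)%E.
Proof.
move=> d0.
pose I : set R := [set` `[-1, 1]].
pose Q : set (R * R) := I `*` I.
have mI : measurable I by exact: measurable_itv.
have mQ : measurable Q by exact: measurableX.
have DQ : D `<=` Q.
  move=> p /DdiscE p1; have := ler_Re (toC p); have := ler_Im (toC p).
  rewrite !ler_norml /= => /andP[? ?] /andP[? ?].
  have II x : -1 <= x <= 1 -> I x by move=> h; rewrite /I /= in_itv.
  by split; apply: II; apply/andP; split; lra.
pose G (p : R * R) := (4 * cauchy_density del a p.1 * cauchy_density del b p.2)%:E.
have G0 p : (0 <= G p)%E by rewrite lee_fin; exact: cauchy_density2_ge0.
have mc c : measurable_fun setT (cauchy_density del c).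
  by apply: continuous_measurable_fun; exact: continuous_cauchy_density.
have mG : measurable_fun setT G.
  apply/measurable_EFinP; apply: measurable_funM.
    apply: measurable_funM => //.
    by apply: (measurableT_comp (mc a)); exact: measurable_fst.
  by apply: (measurableT_comp (mc b)); exact: measurable_snd.
apply: (@le_trans _ _ (\int[@area R]_(p in Q) G p)%E).
  apply: ge0_subset_integral; [exact: measurable_Ddisc|exact: mQ| |
    by move=> p _; exact: G0|exact: DQ].
  exact: (measurable_funS measurableT (@subsetT _ Q) mG).
rewrite integral_mkcond.
have mF : measurable_fun setT (G \_ Q).
  by apply: (measurable_restrictT _ mQ).1; exact: (measurable_funS measurableT (@subsetT _ Q) mG).
have F0 p : (0 <= (G \_ Q) p)%E by rewrite patchE; case: ifP.
have -> : (\int[@area R]_p (G \_ Q) p = \int[leb]_x fubini_F leb (G \_ Q) x)%E :=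
    fubini_tonelli1 (m1 := leb) (m2 := leb) (G \_ Q) mF F0.
have mca : measurable_fun I (EFin \o cauchy_density del a).
  by apply/measurable_EFinP; exact: measurable_funS (mc a).
have mcb : measurable_fun I (EFin \o cauchy_density del b).
  by apply/measurable_EFinP; exact: measurable_funS (mc b).
have pi0 := pi_gt0R R.
have inner x : (fubini_F leb (G \_ Q) x <=
    ((fun x => (4 * pi * cauchy_density del a x)%:E) \_ I) x)%E.
  rewrite /fubini_F patchE; case: ifPn => xI; last first.
    rewrite integral0_eq// => y _; rewrite patchE in_setX (negbTE xI) //.
  rewrite (_ : (fun y => (G \_ Q) (x, y)) =
     ((fun y => (4 * cauchy_density del a x)%:E * (cauchy_density del b y)%:E)%E \_ I)); last first.
    by apply/funext => y; rewrite !patchE in_setX xI.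
  have k0 : 0 <= 4 * cauchy_density del a x by apply: mulr_ge0; [by []|exact: cauchy_density_ge0].
  rewrite -integral_mkcond ge0_integralZl//; last first.
    by move=> y _; rewrite lee_fin; exact: cauchy_density_ge0.
  have -> : 4 * pi * cauchy_density del a x = 4 * cauchy_density del a x * pi by rewrite mulrAC.
  rewrite [leRHS]EFinM; apply: lee_wpmul2l; first by rewrite lee_fin.
  exact: cauchy_density_integral.
apply: (@le_trans _ _ (\int[leb]_x ((fun x => (4 * pi * cauchy_density del a x)%:E) \_ I) x)%E).
  apply: ge0_le_integral => //.
  - by move=> x _; apply: integral_ge0 => y _; exact: F0.
  - exact: (measurable_fun_fubini_tonelli_F (m2 := leb) (G \_ Q) mF F0).
  - apply: (measurable_restrictT _ mI).1; apply/measurable_EFinP.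
    by apply: measurable_funM => //; exact: measurable_funS (mc a).
rewrite -integral_mkcond.
under eq_integral do rewrite EFinM.
have p40 : 0 <= 4 * pi :> R by rewrite mulr_ge0// ltW.
rewrite ge0_integralZl//; last by move=> y _; rewrite lee_fin; exact: cauchy_density_ge0.
have -> : 4 * pi ^+ 2 = 4 * pi * pi :> R by rewrite expr2 mulrA.
by rewrite [leRHS]EFinM; apply: lee_wpmul2l; [rewrite lee_fin|exact: cauchy_density_integral].
Qed.

(** For [w] and [z] in the disc the right side is nonnegative, so the Moebius quotient has modulus
    at most 1. *)
Lemma sqmod_mobius (w z : C) :
  sqmod (1 - w^* * z) - sqmod (z - w) = (1 - sqmod w) * (1 - sqmod z).
Proof. by case: w => a b; case: z => x y; rewrite /sqmod /=; ring. Qed.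

(* The normalised Bergman kernel times a power of the Moebius quotient [(z - w) / (1 - w^* z)],
   whose modulus is at most 1. *)
Definition tfun (w : C) (j : nat) : C -> C :=
  fun z => (z - w) ^+ j * (((1 - nm w)%:C)%C * ((1 - w^* * z)^-1) ^+ j.+2).

Lemma one_sub_ge (w z : C) : nm w < 1 -> nm z < 1 -> 1 - nm w <= nm (1 - w^* * z).
Proof.
move=> w1 z1; apply: le_trans (nmB_ge _ _); rewrite nm1 nmM nm_conj lerD2l lerN2.
by rewrite ler_piMr// ltW.
Qed.

Lemma one_sub_neq0 (w z : C) : nm w < 1 -> nm z < 1 -> 1 - w^* * z != 0.
Proof.
move=> w1 z1; rewrite -nm_gt0; apply: lt_le_trans (one_sub_ge w1 z1).
by rewrite subr_gt0.
Qed.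

Lemma holo_tfun_aux w j : nm w < 1 ->
  holo_disc (fun z : C => ((1 - nm w)%:C)%C * ((1 - w^* * z)^-1) ^+ j.+2).
Proof.
move=> w1; apply/holo_discP => z z1; apply: holM; first exact: hol_cst.
apply: holX; apply: holV; last exact: one_sub_neq0.
apply: holB; first exact: hol_cst.
by apply: holM; [exact: hol_cst|exact: hol_id].
Qed.

Lemma holo_subX (w : C) j : holo_disc (fun z : C => (z - w) ^+ j).
Proof.
apply/holo_discP => z z1; apply: holX.
by apply: holB; [exact: hol_id|exact: hol_cst].
Qed.

Lemma holo_tfun w j : nm w < 1 -> holo_disc (tfun w j).
Proof. by move=> w1; apply: holo_discM; [exact: holo_subX|exact: holo_tfun_aux]. Qed.

(* With d = 1 - |w|, both d and |z - w| are at most |1 - w^* z|, so the kernel is dominated by a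
   product of two one-dimensional Cauchy densities, whose integrals are explicit. *)
Lemma tfun_bound w j p : nm w < 1 -> D p ->
  sqmod (tfun w j (toC p)) <= 4 * cauchy_density (1 - nm w) (complex.Re w) p.1 *
     cauchy_density (1 - nm w) (complex.Im w) p.2.
Proof.
move=> w1 /DdiscE z1; set z := toC p in z1 *.
have d0 : 0 < 1 - nm w by rewrite subr_gt0.
have qd := one_sub_ge w1 z1.
have q0 : 0 < nm (1 - w^* * z) by apply: lt_le_trans qd.
have zq : nm (z - w) ^+ 2 <= nm (1 - w^* * z) ^+ 2.
  have sq1 (x : C) : nm x < 1 -> 0 <= 1 - sqmod x.
    by move=> x1; rewrite -nm_sq subr_ge0; apply: exprn_ile1; [exact: nm_ge0|exact: ltW].
  by rewrite !nm_sq -subr_ge0 sqmod_mobius; apply: mulr_ge0; exact: sq1.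
have tE : nm (z - w) ^+ 2 = (p.1 - complex.Re w) ^+ 2 + (p.2 - complex.Im w) ^+ 2.
  by rewrite nm_sq /sqmod ReB ImB.
have -> : sqmod (tfun w j z) = ((nm (z - w) / nm (1 - w^* * z)) ^+ j) ^+ 2 *
    ((1 - nm w) / nm (1 - w^* * z) ^+ 2) ^+ 2.
  rewrite -nm_sq /tfun nmM nmX nmM nmX nmV nm_real ger0_norm ?(ltW d0)// -exprMn; congr (_ ^+ 2).
  rewrite expr_div_n -addn2 exprD !exprVn.
  by move: (nm _ ^+ j) (nm _ ^+ j) => X Y; ring.
move: zq qd q0 tE; set q := nm (1 - w^* * z); set t := nm (z - w).
set u := p.1 - _; set v := p.2 - _; set d := 1 - nm w in d0 *.
move=> tq dq q0 tE.
have t0 : 0 <= t by exact: nm_ge0.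
have rat : t / q <= 1.
  by rewrite ler_pdivrMr// mul1r -ler_sqr ?nnegrE// ltW.
have r1 : ((t / q) ^+ j) ^+ 2 <= 1.
  have rj : 0 <= t / q by rewrite divr_ge0// ltW.
  by rewrite expr_le1// ?exprn_ile1// exprn_ge0.
apply: (@le_trans _ _ (1 * (d / q ^+ 2) ^+ 2)); first by rewrite ler_wpM2r// sqr_ge0.
have d2q : d ^+ 2 <= q ^+ 2 by rewrite ler_sqr ?nnegrE; [exact: dq|exact: ltW|exact: ltW].
have u0 := sqr_ge0 u; have v0 := sqr_ge0 v.
have dd0 : 0 < d ^+ 2 by rewrite exprn_gt0.
(* Both [d] and [t] are at most [q], and [t ^+ 2 = u ^+ 2 + v ^+ 2]. The product of these two bounds
   turns [d ^+ 2 / q ^+ 4] into the densities, with the factor 4. *)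
have uq : d ^+ 2 + u ^+ 2 <= 2 * q ^+ 2 by lra.
have vq : d ^+ 2 + v ^+ 2 <= 2 * q ^+ 2 by lra.
have du : 0 < d ^+ 2 + u ^+ 2 by lra.
have dv : 0 < d ^+ 2 + v ^+ 2 by lra.
have q2 : 0 < q ^+ 2 by rewrite exprn_gt0.
have -> : 4 * cauchy_density d (complex.Re w) p.1 * cauchy_density d (complex.Im w) p.2 =
    4 * d ^+ 2 / ((d ^+ 2 + u ^+ 2) * (d ^+ 2 + v ^+ 2)).
  by rewrite /cauchy_density -/u -/v; field; rewrite !gt_eqF.
rewrite mul1r expr_div_n ler_pdivlMr ?mulr_gt0// mulrAC ler_pdivrMr ?exprn_gt0//.
have : (d ^+ 2 + u ^+ 2) * (d ^+ 2 + v ^+ 2) <= (2 * q ^+ 2) * (2 * q ^+ 2).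
  by apply: ler_pM => //; exact: ltW.
move=> h; apply: (@le_trans _ _ (d ^+ 2 * ((2 * q ^+ 2) * (2 * q ^+ 2)))).
  by rewrite ler_pM2l.
by rewrite le_eqVlt; apply/orP; left; apply/eqP; ring.
Qed.

Lemma A2normsq_tfun w j : nm w < 1 -> (A2normsq (tfun w j) <= (4 * pi)%:E)%E.
Proof.
move=> w1; have pi0 := pi_gt0R R.
have d0 : 0 < 1 - nm w by rewrite subr_gt0.
rewrite /A2normsq.
apply: (@le_trans _ _ ((4 * pi ^+ 2)%:E * (pi^-1)%:E)%E).
  apply: lee_wpmul2r; first by rewrite lee_fin invr_ge0 ltW.
  apply: le_trans (poisson_disc_integral (complex.Re w) (complex.Im w) d0).
  apply: ge0_le_integral.
  - exact: measurable_Ddisc.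
  - by move=> p _; rewrite lee_fin; exact: sqmod_ge0.
  - exact: (measurable_sqmodE (holo_contD (@holo_tfun w j w1))).
  - have mc c : measurable_fun setT (cauchy_density (1 - nm w) c).
      by apply: continuous_measurable_fun; exact: continuous_cauchy_density.
    apply/measurable_EFinP; apply: (measurable_funS measurableT (@subsetT _ _)).
    apply: measurable_funM.
      apply: measurable_funM => //.
      by apply: (measurableT_comp (mc _)); exact: measurable_fst.
    by apply: (measurableT_comp (mc _)); exact: measurable_snd.
  - by move=> p Dp; rewrite lee_fin; exact: tfun_bound.
by rewrite -EFinM lee_fin expr2 mulrA mulfK// gt_eqF.
Qed.

Lemma inA2_tfun w j : nm w < 1 -> inA2 (tfun w j).
Proof.
move=> w1; split; first exact: holo_tfun.
by apply: le_lt_trans (A2normsq_tfun j w1) _; exact: ltry.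
Qed.

Lemma nsq_tfun w j : nm w < 1 -> nsq (tfun w j) <= 4 * pi.
Proof. by move=> w1; rewrite -lee_fin -nsqE; [exact: A2normsq_tfun|exact: inA2_tfun]. Qed.

(** Leibniz' rule stops after two terms for a linear factor. For [i = 0] the index [i.-1] is 0 and
    the coefficient kills the second term. *)
Lemma cderiv_subM (w : C) (h : C -> C) i z : holo_disc h -> nm z < 1 ->
  cderiv i (fun x => (x - w) * h x) z = (z - w) * cderiv i h z + i%:R * cderiv i.-1 h z.
Proof.
move=> hh; elim: i z => [|i ih] z z1.
  by rewrite /cderiv !derive1n0 mul0r addr0.
have hol_i k : hol (cderiv k h) z.
  by have /holo_discP := @holo_disc_cderiv R k _ hh; apply.
have hsub : hol (fun x : C => x - w) z by apply: holB; [exact: hol_id|exact: hol_cst].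
have dsub : derive1 (fun x : C => x - w) z = 1.
  apply: etrans (derive1D (@hol_id R z) (@hol_cst R (- w) z)) _.
  by rewrite derive1_idhol derive1_csthol addr0.
rewrite {1}/cderiv derive1nS.
have r0 : 0 < 1 - nm z by lra.
have -> : derive1 (derive1n i (fun x => (x - w) * h x)) z =
    derive1 (fun x => (x - w) * cderiv i h x + i%:R * cderiv i.-1 h x) z.
  apply: (near_derive1 r0) => y yz; apply: ih.
  by rewrite -[y](subrK z); apply: le_lt_trans (nmD _ _) _; lra.
have hA := holM hsub (hol_i i).
have hB := holM (@hol_cst R i%:R z) (hol_i i.-1).
have P1 : derive1 (fun x : C => (x - w) * cderiv i h x) z =
    (z - w) * derive1 (cderiv i h) z + cderiv i h z.
  apply: etrans (derive1M hsub (hol_i i)) _; congr (_ + _).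
  by apply: etrans (congr1 (fun t => cderiv i h z * t) dsub) _; exact: mulr1.
have P2 : derive1 (fun x : C => i%:R * cderiv i.-1 h x) z = i%:R * derive1 (cderiv i.-1 h) z.
  apply: etrans (derive1M (@hol_cst R i%:R z) (hol_i i.-1)) _.
  apply: etrans (congr1 (fun t => _ + cderiv i.-1 h z * t) (@derive1_csthol R i%:R z)) _.
  by rewrite mulr0 addr0.
apply: etrans (derive1D hA hB) _; apply: etrans (congr2 +%R P1 P2) _.
have dS k : derive1 (cderiv k h) z = cderiv k.+1 h z by rewrite /cderiv derive1nS.
rewrite (dS i) (dS i.-1) -addrA; congr (_ + _).
clear; case: i => [|i] /=; first by rewrite mul0r addr0 mul1r.
by rewrite [in RHS]mulrS mulrDl mul1r.
Qed.

(** At [w] only the second term of [cderiv_subM] survives, so one factor z - w and one derivative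
    are removed together. *)
Lemma cderiv_subX (w : C) (h : C -> C) j i : holo_disc h -> nm w < 1 -> (i <= j)%N ->
  cderiv i (fun z => (z - w) ^+ j * h z) w = if i == j then (j`!)%:R * h w else 0.
Proof.
move=> hh w1; elim: j i => [|j ih] i ij.
  move: ij; rewrite leqn0 => /eqP ->; rewrite /cderiv derive1n0 eqxx.
  by rewrite expr0 fact0.
have -> : (fun z => (z - w) ^+ j.+1 * h z) = (fun z => (z - w) * ((z - w) ^+ j * h z)).
  by apply/funext => z; rewrite exprS mulrA.
have hj : holo_disc (fun z : C => (z - w) ^+ j * h z).
  by apply: holo_discM; [exact: holo_subX|exact: hh].
rewrite (cderiv_subM w i hj w1) subrr mul0r add0r.
case: i ij => [|i] ij; first by rewrite mul0r.
rewrite [i.+1.-1]/= (ih i ij) eqSS; case: eqP => [->|_]; last by rewrite mulr0.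
by rewrite mulrA -natrM -factS.
Qed.

Lemma cderiv_tfun_lt w j i : nm w < 1 -> (i < j)%N -> cderiv i (tfun w j) w = 0.
Proof.
by move=> w1 ij; rewrite /tfun (cderiv_subX (@holo_tfun_aux w j w1) w1 (ltnW ij)) ltn_eqF.
Qed.

(** Since 1 - |w|^2 = (1 - |w|)(1 + |w|), the powers of 1 - |w| cancel exactly; what remains is j! /
    (1 + |w|)^(j+2), with 1 + |w| <= 2. *)
Lemma cderiv_tfun_eq w j : nm w < 1 ->
  2^-1 ^+ j.+2 <= nm (cderiv j (tfun w j) w) * (1 - nm w) ^+ j.+1.
Proof.
move=> w1; have d0 : 0 < 1 - nm w by rewrite subr_gt0.
rewrite /tfun (cderiv_subX (@holo_tfun_aux w j w1) w1 (leqnn j)) eqxx.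
rewrite (nmM (j`!%:R)) (nmM ((1 - nm w)%:C)%C) nmX nmV nm_real ger0_norm ?(ltW d0)//.
have wE : 1 - w^* * w = ((1 - nm w ^+ 2)%:C)%C.
  rewrite nm_sq; apply: complex_ext; case: w {w1 d0} => a b; rewrite /sqmod /=; ring.
have q0 : 0 < 1 - nm w ^+ 2 by rewrite subr_gt0 expr_lt1.
rewrite wE nm_real ger0_norm ?(ltW q0)//.
have f1 : 1 <= nm (j`!%:R : C).
  have -> : nm (j`!%:R : C) = j`!%:R.
    by have := @nm_real R (j`!%:R); rewrite rmorph_nat ger0_norm// ler0n.
  by rewrite ler1n fact_gt0.
have E : 1 - nm w ^+ 2 = (1 - nm w) * (1 + nm w) by ring.
rewrite E; set d := 1 - nm w in d0 *.
have l0 : 0 < 1 + nm w by have := nm_ge0 w; lra.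
have -> : nm (j`!%:R : C) * (d * (d * (1 + nm w))^-1 ^+ j.+2) * d ^+ j.+1 =
   nm (j`!%:R : C) * (1 + nm w)^-1 ^+ j.+2.
  have u : d * d ^+ j.+1 * d^-1 ^+ j.+2 = 1.
    by rewrite -exprS -exprMn divff ?gt_eqF// expr1n.
  rewrite invfM exprMn; move: u.
  move: (d ^+ j.+1) (d^-1 ^+ j.+2) ((1 + nm w)^-1 ^+ j.+2) => A B E' u.
  by rewrite -[RHS]mulr1 -u; ring.
rewrite -[leLHS]mul1r; apply: ler_pM; [exact: ler01|by rewrite exprn_ge0|exact: f1|].
apply: lerXn2r; rewrite ?nnegrE ?invr_ge0 ?(ltW l0)//.
by rewrite lef_pV2 ?posrE//; lra.
Qed.
End TestFunctions.

(** * Uniform comparison of the derivative evaluations with their combinations *)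

Section Frames.
Variable R : realType.
Local Notation C := (Cplx R).
Local Notation nm := (@Normc.normc R).

Lemma cderiv_frame_upper k : exists2 K : R, 0 < K & forall (e : nat -> C -> C) (w : C),
  A2_ONB e -> nm w < 1 -> forall N,
  (\sum_(0 <= i < N) sqmod (cderiv k (e i) w)) * (1 - nm w) ^+ (k.+1).*2 <= K.
Proof.
have [K K0 ev] := eval_bound R k; exists K => // e w [eA2 eON _] w1 N.
have d0 : 0 < (1 - nm w) ^+ (k.+1).*2 by rewrite exprn_gt0// subr_gt0.
rewrite -ler_pdivlMr//.
apply: (bfun_sum_le (l := fun f => cderiv k f w) eA2 eON); split.
- by move=> f g hf hg; apply: cderivD w1; [exact: hf.1|exact: hg.1].
- by move=> c f hf; apply: cderivZ w1; exact: hf.1.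
- move=> f hf; have := ev f w hf.1 w1; rewrite nsqE// -EFinM lee_fin => h.
  by rewrite (mulrAC K) ler_pdivlMr.
Qed.

(* The coefficients are recovered from the last one downwards: [tfun w j] is annihilated by
   the derivatives of order less than [j] at [w]. *)
Lemma cderiv_frame_lower n m : exists2 K : R, 0 <= K &
  forall (e : nat -> C -> C) (c : nat -> C) (w : C) (B : R), A2_ONB e -> nm w < 1 -> 0 <= B ->
  (forall N, \sum_(0 <= i < N) sqmod (\sum_(k < n.+1) c k * cderiv k (e i) w) <= B) ->
  forall k, (k <= n)%N -> (n < k + m)%N -> nm (c k) <= K * Num.sqrt B * (1 - nm w) ^+ k.+1.
Proof.
have /choice[ev evP] : forall k, exists K : R, 0 < K /\
    forall (f : C -> C) (w : C), holo_disc f -> nm w < 1 ->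
    ((nm (cderiv k f w) ^+ 2 * (1 - nm w) ^+ (k.+1).*2)%:E <= K%:E * A2normsq f)%E.
  by move=> k; have [K K0 H] := eval_bound R k; exists K.
pose M k := Num.sqrt (ev k * (4 * pi)).
have M0 k : 0 <= M k by exact: sqrtr_ge0.
have pi0 := pi_gt0R R.
(* [m] counts the coefficients already controlled, from the top: [n < k + m] selects the last [m]
   indices. *)
elim: m => [|m [K K0 IH]].
  by exists 0 => // e c w B _ _ _ _ k kn; rewrite addn0 ltnNge kn.
pose j := (n - m)%N.
(* The power of 2 inverts the lower bound of [cderiv_tfun_eq]. In the bracket, the root bounds the
   combination on [tfun w j], the sum the terms of order above [j]. *)
pose K' := 2 ^+ j.+2 * (Num.sqrt (4 * pi) + \sum_(k < n.+1) K * M k).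
have S0 : 0 <= \sum_(k < n.+1) K * M k by apply: sumr_ge0 => k _; exact: mulr_ge0.
have K'0 : 0 <= K'.
  by apply: mulr_ge0; [exact: exprn_ge0|apply: addr_ge0; [exact: sqrtr_ge0|exact: S0]].
exists (K + K'); first exact: addr_ge0.
move=> e c w B onb w1 B0 HB k kn; rewrite addnS ltnS leq_eqVlt => /orP[|nkm]; last first.
  apply: le_trans (IH e c w B onb w1 B0 HB k kn nkm) _.
  apply: ler_wpM2r; first by rewrite exprn_ge0// subr_ge0 ltW.
  by apply: ler_wpM2r; [exact: sqrtr_ge0|rewrite lerDl].
move=> /eqP nE; have kj : k = j by rewrite /j nE addnK.
rewrite {}kj in kn *; clear k nE.
have d0 : 0 < 1 - nm w by rewrite subr_gt0.
set d := 1 - nm w in d0 *; set s := Num.sqrt B.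
have s0 : 0 <= s by exact: sqrtr_ge0.
pose X k := cderiv k (tfun w j) w.
have Xbnd k : nm (X k) * d ^+ k.+1 <= M k.
  have n0 : 0 <= nm (X k) * d ^+ k.+1.
    by apply: mulr_ge0; [exact: nm_ge0|rewrite exprn_ge0// ltW].
  rewrite -(ger0_norm n0) -sqrtr_sqr ler_wsqrtr// exprMn -exprM muln2.
  have [evk h] := evP k; have := h _ _ (@holo_tfun R w j w1) w1.
  rewrite (nsqE (inA2_tfun j w1)) -EFinM lee_fin; move/le_trans; apply.
  by rewrite ler_pM2l//; exact: nsq_tfun.
have [Kl lK] := @bfun_sum R n.+1 c w w1.
have lj := bfun_le onb lK (inA2_tfun j w1) HB.
set l := \sum_(k < n.+1) _ in lj.
have nl : nm l <= Num.sqrt (4 * pi) * s.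
  rewrite -(ger0_norm (nm_ge0 l)) -sqrtr_sqr -sqrtrM; last by rewrite mulr_ge0// ltW.
  rewrite ler_wsqrtr//; apply: le_trans lj _; apply: (ler_wpM2r B0); exact: nsq_tfun.
have jn : (j < n.+1)%N by rewrite ltnS.
have lE : l = c j * X j + \sum_(k < n.+1 | k != Ordinal jn) c k * X k.
  by rewrite /l (bigD1 (Ordinal jn)).
have rest : nm (\sum_(k < n.+1 | k != Ordinal jn) c k * X k) <= (\sum_(k < n.+1) K * M k) * s.
  apply: (@le_trans _ _ (\sum_(k < n.+1 | k != Ordinal jn) nm (c k * X k))).
    elim/big_ind2 : _ => [|x1 y1 x2 y2 h1 h2|//]; first by rewrite nm0.
    by apply: le_trans (nmD _ _) _; exact: lerD.
  apply: (@le_trans _ _ (\sum_(k < n.+1 | k != Ordinal jn) (K * M k) * s)).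
    (* Orders below [j] vanish on [tfun w j]. Above [j], the weight in the bound on [c k] from the
       induction cancels the growth of the derivative. *)
    apply: ler_sum => k kj; have [klt|kge] := ltnP k j.
      rewrite /X cderiv_tfun_lt// mulr0 nm0.
      by apply: mulr_ge0 s0; exact: mulr_ge0.
    have kgt : (j < k)%N.
      by rewrite ltn_neqAle kge andbT eq_sym; apply: contra kj => /eqP kE; apply/eqP/val_inj.
    have ck : nm (c k) <= K * s * d ^+ k.+1.
      apply: (IH e c w B onb w1 B0 HB); first by rewrite -ltnS; exact: ltn_ord.
      by apply: (@leq_ltn_trans (j + m)); [rewrite addnC -leq_subLR|rewrite ltn_add2r].
    rewrite nmM; apply: (@le_trans _ _ (K * s * d ^+ k.+1 * nm (X k))).
      by apply: ler_wpM2r ck; exact: nm_ge0.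
    have -> : K * s * d ^+ k.+1 * nm (X k) = (K * s) * (nm (X k) * d ^+ k.+1) by ring.
    rewrite [leRHS]mulrAC; exact: (ler_wpM2l (mulr_ge0 K0 s0) (Xbnd k)).
  rewrite -mulr_suml; apply: (ler_wpM2r s0).
  rewrite [leRHS](bigD1 (Ordinal jn))//= lerDr; exact: mulr_ge0.
have cX : nm (c j) * nm (X j) <= (Num.sqrt (4 * pi) + \sum_(k < n.+1) K * M k) * s.
  rewrite -nmM; have -> : c j * X j = l - \sum_(k < n.+1 | k != Ordinal jn) c k * X k.
    by rewrite lE addrK.
  apply: le_trans (nmD _ _) _; rewrite nmN mulrDl; exact: lerD.
have low := cderiv_tfun_eq j w1; rewrite -/d -/(X j) in low.
have dj : 0 < d ^+ j.+1 by rewrite exprn_gt0.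
have p2 : 0 < (2 : R) ^+ j.+2 by rewrite exprn_gt0.
have c1 : nm (c j) <= 2 ^+ j.+2 * (nm (c j) * nm (X j)) * d ^+ j.+1.
  rewrite exprVn -(ler_pM2l p2) divff ?gt_eqF// in low.
  have := nm_ge0 (c j); move: low => low c0.
  have := ler_wpM2l c0 low; rewrite mulr1 => /le_trans; apply.
  by rewrite le_eqVlt; apply/orP; left; apply/eqP; ring.
apply: le_trans c1 _; apply: ler_wpM2r; first exact: ltW.
apply: (@le_trans _ _ (K' * s)).
  by rewrite /K' -mulrA; apply: ler_wpM2l cX; exact: ltW.
by apply: (ler_wpM2r s0); rewrite lerDr.
Qed.

(** The weights cancel: |c k|^2 is at most a multiple of (1 - |w|)^(2(k+1)), and the squared norm of
    the k-th evaluation at most a multiple of its inverse. Thus [K] depends on [n] alone. *)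
Lemma frame_compare n : exists2 K : R, 0 < K &
  forall (e e' : nat -> C -> C) (c : nat -> C) (w : C) (B : R), A2_ONB e -> A2_ONB e' -> nm w < 1 ->
  (forall N, \sum_(0 <= i < N) sqmod (\sum_(k < n.+1) c k * cderiv k (e' i) w) <= B) ->
  forall k, (k <= n)%N -> forall N, \sum_(0 <= i < N) sqmod (c k * cderiv k (e i) w) <= K * B.
Proof.
(* [m = n.+1] covers all the indices [k <= n]. *)
have [K1 K10 low] := cderiv_frame_lower n n.+1.
have /choice[U UP] : forall k, exists U : R, 0 < U /\
  forall (e : nat -> C -> C) (w : C), A2_ONB e -> nm w < 1 -> forall N,
  (\sum_(0 <= i < N) sqmod (cderiv k (e i) w)) * (1 - nm w) ^+ (k.+1).*2 <= U.
  by move=> k; have [K K0 H] := cderiv_frame_upper k; exists K.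
have U0 k : 0 < U k by have [] := UP k.
exists ((K1 ^+ 2 + 1) * \sum_(k < n.+1) U k).
  apply: mulr_gt0; first by rewrite ltr_wpDl// sqr_ge0.
  rewrite big_ord_recl /=; apply: ltr_pwDl; first exact: U0.
  by apply: sumr_ge0 => i _; exact: ltW.
move=> e e' c w B onb onb' w1 HB k kn N.
have B0 : 0 <= B by apply: le_trans (HB 0%N); rewrite big_geq.
have ck := low e' c w B onb' w1 B0 HB k kn ltac:(by rewrite addnS ltnS leq_addl).
have d0 : 0 < 1 - nm w by rewrite subr_gt0.
set d := 1 - nm w in d0 ck.
have dk : 0 < d ^+ k.+1 by rewrite exprn_gt0.
have ck2 : sqmod (c k) <= K1 ^+ 2 * B * d ^+ (k.+1).*2.
  have -> : K1 ^+ 2 * B * d ^+ (k.+1).*2 = (K1 * Num.sqrt B * d ^+ k.+1) ^+ 2.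
    by rewrite !exprMn sqr_sqrtr// -exprM muln2.
  rewrite -nm_sq; apply: lerXn2r ck; rewrite ?nnegrE//.
  by apply: mulr_ge0; [apply: mulr_ge0 => //; exact: sqrtr_ge0|exact: ltW].
have up := (UP k).2 e w onb w1 N; rewrite -/d in up.
have -> : \sum_(0 <= i < N) sqmod (c k * cderiv k (e i) w) =
    sqmod (c k) * \sum_(0 <= i < N) sqmod (cderiv k (e i) w).
  by rewrite mulr_sumr; apply: eq_bigr => i _; rewrite -!nm_sq nmM exprMn.
set S := \sum_(0 <= i < N) _ in up *.
have S0 : 0 <= S by apply: sumr_ge0 => i _; exact: sqmod_ge0.
apply: le_trans (ler_wpM2r S0 ck2) _.
have -> : K1 ^+ 2 * B * d ^+ (k.+1).*2 * S = K1 ^+ 2 * B * (S * d ^+ (k.+1).*2) by ring.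
have -> : (K1 ^+ 2 + 1) * (\sum_(k < n.+1) U k) * B =
    (K1 ^+ 2 + 1) * B * \sum_(k < n.+1) U k by ring.
have kn1 : (k < n.+1)%N by rewrite ltnS.
have US : U k <= \sum_(k < n.+1) U k.
  rewrite (bigD1 (Ordinal kn1))//= lerDl; apply: sumr_ge0 => i _; exact: ltW.
have K2 := sqr_ge0 K1.
apply: ler_pM.
- exact: mulr_ge0.
- by apply: (mulr_ge0 S0); rewrite exprn_ge0// ltW.
- by apply: (ler_wpM2r B0); rewrite lerDl.
- exact: le_trans up US.
Qed.
End Frames.

(** * Hilbert-Schmidt operators *)

Section HilbertSchmidt.
Variable R : realType.
Local Notation C := (Cplx R).
Local Notation nm := (@Normc.normc R).
Local Notation D := (@Ddisc R).

Lemma A2normsqE (f : C -> C) : holo_disc f ->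
  A2normsq f = (\int[@area R]_(p in D) ((sqmod (f (toC p)))%:E * (pi^-1)%:E))%E.
Proof.
move=> hf; rewrite /A2normsq ge0_integralZr//.
- exact: measurable_Ddisc.
- exact: (measurable_sqmodE (holo_contD hf)).
- by move=> p _; rewrite lee_fin; exact: sqmod_ge0.
- by rewrite lee_fin invr_ge0 ltW// pi_gt0R.
Qed.

Lemma hs_sumE (g : nat -> C -> C) : (forall i, holo_disc (g i)) ->
  (\sum_(0 <= i <oo) A2normsq (g i) =
   \int[@area R]_(p in D) (\sum_(0 <= i <oo) ((sqmod (g i (toC p)))%:E * (pi^-1)%:E)))%E.
Proof.
move=> hg; rewrite integral_nneseries.
- by apply: eq_eseriesr => i _; exact: A2normsqE.
- exact: measurable_Ddisc.
- by move=> i; apply: emeasurable_funM => //; exact: (measurable_sqmodE (holo_contD (hg i))).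
- by move=> i p _; rewrite mule_ge0// lee_fin ?sqmod_ge0// invr_ge0 ltW// pi_gt0R.
Qed.

(** Passes from real bounds on partial sums to extended series. If the series on the right diverges,
    [K > 0] makes the claim trivial. *)
Lemma sq_series_le (a b : nat -> R) (K : R) : 0 < K ->
  (forall i, 0 <= a i) -> (forall i, 0 <= b i) ->
  (forall B, (forall N, \sum_(0 <= i < N) b i <= B) -> forall N, \sum_(0 <= i < N) a i <= K * B) ->
  (\sum_(0 <= i <oo) (a i)%:E <= K%:E * \sum_(0 <= i <oo) (b i)%:E)%E.
Proof.
move=> K0 a0 b0 H.
set S := (\sum_(0 <= i <oo) (b i)%:E)%E.
have S0 : (0 <= S)%E by apply: nneseries_ge0 => i _ _; rewrite lee_fin.
have [Sy|Sy] := eqVneq S +oo%E; first by rewrite Sy gt0_muley ?leey// lte_fin.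
have SE : S = (fine S)%:E by rewrite fineK// ge0_fin_numE// ltey.
rewrite SE -EFinM; apply: lime_le.
  by apply: is_cvg_nneseries => i _ _; rewrite lee_fin.
apply: nearW => N; rewrite sumEFin lee_fin; apply: H => M.
rewrite -lee_fin -SE -sumEFin; apply: nneseries_lim_ge => i _ _; by rewrite lee_fin.
Qed.

(** A constant independent of [z] is what allows the pointwise comparison to be integrated over the
    disc. *)
Lemma hs_sum_compare (g g' : nat -> C -> C) (K : R) : 0 < K ->
  (forall i, holo_disc (g i)) -> (forall i, holo_disc (g' i)) ->
  (forall z, nm z < 1 -> forall B, (forall N, \sum_(0 <= i < N) sqmod (g' i z) <= B) ->
     forall N, \sum_(0 <= i < N) sqmod (g i z) <= K * B) ->
  (\sum_(0 <= i <oo) A2normsq (g' i) < +oo)%E -> (\sum_(0 <= i <oo) A2normsq (g i) < +oo)%E.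
Proof.
move=> K0 hg hg' H.
rewrite !hs_sumE// => fin.
have ip0 : 0 <= pi^-1 :> R by rewrite invr_ge0 ltW// pi_gt0R.
have mser (h : nat -> C -> C) : (forall i, holo_disc (h i)) ->
    measurable_fun D (fun p => (\sum_(0 <= i <oo) ((sqmod (h i (toC p)))%:E * (pi^-1)%:E))%E).
  move=> hh; apply: (@ge0_emeasurable_sum _ _ _ D
      (fun i p => ((sqmod (h i (toC p)))%:E * (pi^-1)%:E)%E) xpredT).
  - by move=> i p _ _; rewrite mule_ge0// lee_fin ?sqmod_ge0.
  - by move=> i _; apply: emeasurable_funM => //; exact: (measurable_sqmodE (holo_contD (hh i))).
have ser0 (h : nat -> C -> C) p :
    (0 <= \sum_(0 <= i <oo) ((sqmod (h i (toC p)))%:E * (pi^-1)%:E))%E.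
  by apply: nneseries_ge0 => i _ _; rewrite mule_ge0// lee_fin ?sqmod_ge0.
apply: (@le_lt_trans _ _ (\int[@area R]_(p in D)
    (K%:E * \sum_(0 <= i <oo) ((sqmod (g' i (toC p)))%:E * (pi^-1)%:E)))%E).
  apply: ge0_le_integral.
  - exact: measurable_Ddisc.
  - by move=> p _; exact: ser0.
  - exact: mser.
  - by apply: emeasurable_funM => //; exact: mser.
  - move=> p /DdiscE p1.
    under eq_eseriesr do rewrite -EFinM.
    under [X in (_ <= _ * X)%E]eq_eseriesr do rewrite -EFinM.
    apply: sq_series_le => //.
    + by move=> i; rewrite mulr_ge0// sqmod_ge0.
    + by move=> i; rewrite mulr_ge0// sqmod_ge0.
    (* Each term carries the factor [pi^-1], so the bare partial sums are bounded by [B * pi]. *)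
    move=> B HB N; rewrite -mulr_suml ler_pdivrMr ?pi_gt0R// -mulrA.
    apply: H => // M; rewrite -ler_pdivrMr ?pi_gt0R// mulr_suml; exact: HB.
rewrite ge0_integralZl//.
- by apply: lte_mul_pinfty => //; rewrite lee_fin ltW.
- exact: measurable_Ddisc.
- exact: mser.
- by rewrite lee_fin ltW.
Qed.

(** Integrating |T f(z)|^2 <= ||f||^2 sum_i |T e_i(z)|^2 gives a bound by the Hilbert-Schmidt sum.
    The bound on the functional at [z] may depend on [z], since [bfun_le] removes it. *)
Lemma hs_bounded (T : (C -> C) -> C -> C) (e : nat -> C -> C) : A2_ONB e ->
  (forall f, inA2 f -> holo_disc (T f)) ->
  (forall z, nm z < 1 -> exists K, bfun (fun f => T f z) K) ->
  (\sum_(0 <= i <oo) A2normsq (T (e i)) < +oo)%E -> bounded_A2 T.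
Proof.
move=> onb hT bT fin; have [eA2 eON _] := onb.
set S := (\sum_(0 <= i <oo) _)%E in fin.
have S0 : (0 <= S)%E by apply: nneseries_ge0 => i _ _; exact: A2normsq_ge0.
have SE : S = (fine S)%:E by rewrite fineK// ge0_fin_numE.
suff main f : inA2 f -> (A2normsq (T f) <= (fine S)%:E * A2normsq f)%E.
  split; last by exists (fine S).
  move=> f hf; split; first exact: hT.
  by apply: le_lt_trans (main f hf) _; rewrite (nsqE hf) -EFinM ltry.
move=> hf.
have ip0 : 0 <= pi^-1 :> R by rewrite invr_ge0 ltW// pi_gt0R.
have hTe i : holo_disc (T (e i)) by exact: hT.
rewrite -SE /S hs_sumE// (nsqE hf) muleC -ge0_integralZl; last 4 first.
- exact: measurable_Ddisc.
- apply: (@ge0_emeasurable_sum _ _ _ D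
      (fun i p => ((sqmod (T (e i) (toC p)))%:E * (pi^-1)%:E)%E) xpredT).
  + by move=> i p _ _; rewrite mule_ge0// lee_fin ?sqmod_ge0.
  + by move=> i _; apply: emeasurable_funM => //; exact: (measurable_sqmodE (holo_contD (hTe i))).
- by move=> p _; apply: nneseries_ge0 => i _ _; rewrite mule_ge0// lee_fin ?sqmod_ge0.
- by rewrite lee_fin nsq_ge0.
rewrite A2normsqE; last exact: hT.
apply: ge0_le_integral.
- exact: measurable_Ddisc.
- by move=> p _; rewrite mule_ge0// lee_fin ?sqmod_ge0.
- by apply: emeasurable_funM => //; exact: (measurable_sqmodE (holo_contD (hT _ hf))).
- apply: emeasurable_funM => //.
  apply: (@ge0_emeasurable_sum _ _ _ D
      (fun i p => ((sqmod (T (e i) (toC p)))%:E * (pi^-1)%:E)%E) xpredT).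
  + by move=> i p _ _; rewrite mule_ge0// lee_fin ?sqmod_ge0.
  + by move=> i _; apply: emeasurable_funM => //; exact: (measurable_sqmodE (holo_contD (hTe i))).
move=> p /DdiscE p1; have [K lK] := bT _ p1; set z := toC p in p1 lK *.
have [_ _ bnd] := lK.
(* If the norm of [f] is 0, the right side is 0 times a possibly infinite sum; boundedness of the
   functional then forces [T f z = 0]. *)
have [n0|n0] := eqVneq (nsq f) 0.
  have := bnd f hf; rewrite n0 mulr0 nm_sq => h.
  have -> : sqmod (T f z) = 0 by apply/eqP; rewrite eq_le h sqmod_ge0.
  by rewrite mul0e mul0e.
have np : 0 < nsq f by rewrite lt0r n0 nsq_ge0.
set Q := (\sum_(0 <= i <oo) _)%E.
have Q0 : (0 <= Q)%E by apply: nneseries_ge0 => i _ _; rewrite mule_ge0// lee_fin ?sqmod_ge0.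
have [Qy|Qy] := eqVneq Q +oo%E; first by rewrite Qy gt0_muley ?leey// lte_fin.
have QE : Q = (fine Q)%:E by rewrite fineK// ge0_fin_numE// ltey.
rewrite QE -!EFinM lee_fin ler_pdivrMr ?pi_gt0R// -mulrA -nm_sq.
apply: (bfun_le onb lK hf) => N.
rewrite -ler_pdivrMr ?pi_gt0R// mulr_suml -lee_fin -QE -sumEFin.
under eq_bigr do rewrite EFinM.
by apply: nneseries_lim_ge => i _ _; rewrite mule_ge0// lee_fin ?sqmod_ge0.
Qed.

(** The parallelogram law, with the squared norm of the difference dropped. *)
Lemma A2normsqD_le (f g : C -> C) : inA2 f -> inA2 g ->
  (A2normsq (fun z => (f z + g z)%R) <= 2%:E * (A2normsq f + A2normsq g))%E.
Proof.
move=> hf hg; have hfg := inA2D hf hg; have hfg' := inA2B hf hg.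
rewrite !nsqE// -EFinD -EFinM lee_fin.
have h1 := nsqD hf hg.
have hN : inA2 (fun z => - g z).
  by under [X in inA2 X]eq_fun do rewrite -mulN1r; exact: inA2Z.
have h2 := nsqD hf hN.
have E : A2ip f (fun z => - g z) = - A2ip f g.
  have -> : (fun z => - g z) = (fun z => (-1) * g z) by apply/funext => z; rewrite mulN1r.
  by rewrite A2ipZr// rmorphN1 mulN1r.
rewrite E nsqN// ReN in h2.
have := nsq_ge0 (fun z => f z + - g z); rewrite h2 h1; lra.
Qed.
End HilbertSchmidt.

(** * The weighted composition operators and their sum *)

Section Operators.
Variable R : realType.
Variables (u : nat -> Cplx R -> Cplx R) (phi : Cplx R -> Cplx R) (n : nat).
Local Notation C := (Cplx R).
Local Notation nm := (@Normc.normc R).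
Hypothesis hu : forall k, (k <= n)%N -> holo_disc (u k).
Hypothesis hphi : analytic_selfmap phi.

Lemma phi_disc z : nm z < 1 -> nm (phi z) < 1.
Proof. by have [_ h] := hphi; rewrite -!lt1_norm; exact: h. Qed.

Lemma holo_Wop k f : (k <= n)%N -> holo_disc f -> holo_disc (Wop (u k) phi k f).
Proof.
move=> kn hf; apply: holo_discM; first exact: hu.
apply/holo_discP => z z1; apply: hol_comp.
  by have [/holo_discP h _] := hphi; exact: h.
by have /holo_discP h := @holo_disc_cderiv R k _ hf; apply: h; exact: phi_disc.
Qed.

Lemma holo_Lop m f : (m <= n)%N -> holo_disc f -> holo_disc (Lop u phi m f).
Proof.
move=> mn hf; apply/holo_discP => z z1; apply: (@hol_sum R m.+1 (fun k => Wop (u k) phi k f)).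
move=> k km; have kn : (k <= n)%N by apply: leq_trans mn.
by have /holo_discP h := holo_Wop kn hf; exact: h.
Qed.

Lemma bfun_Lop m z : nm z < 1 -> exists K, bfun (fun f => Lop u phi m f z) K.
Proof. by move=> z1; exact: (bfun_sum m.+1 (fun k => u k z) (phi_disc z1)). Qed.

Lemma bfun_Wop k z : nm z < 1 -> exists K, bfun (fun f => Wop (u k) phi k f z) K.
Proof.
move=> z1; have [K h] := bfun_cderiv k (phi_disc z1).
by exists (sqmod (u k z) * K); exact: bfunZ.
Qed.

Lemma hs_Wop k e : (k <= n)%N -> A2_ONB e ->
  (\sum_(0 <= i <oo) A2normsq (Wop (u k) phi k (e i)) < +oo)%E ->
  hilbert_schmidt_A2 (Wop (u k) phi k).
Proof.
move=> kn onb fin; split; last by exists e.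
apply: hs_bounded onb _ _ fin; first by move=> f hf; exact: holo_Wop kn hf.1.
exact: bfun_Wop.
Qed.

Lemma hs_Lop_Wop k : (k <= n)%N -> hilbert_schmidt_A2 (Lop u phi n) ->
  hilbert_schmidt_A2 (Wop (u k) phi k).
Proof.
move=> kn [_ [e [onb fin]]]; apply: (hs_Wop kn onb).
have [eA2 _ _] := onb; have [K K0 cmp] := frame_compare R n.
apply: hs_sum_compare K0 _ _ _ fin.
- by move=> i; exact: holo_Wop kn (eA2 i).1.
- by move=> i; exact: holo_Lop (leqnn n) (eA2 i).1.
move=> z z1 B HB N.
exact: (cmp e e (fun k => u k z) (phi z) B onb onb (phi_disc z1) HB k kn N).
Qed.

(** Independence of the basis: [frame_compare] is applied to the coefficients that vanish except at
    [k], where the combination is [Wop] itself. *)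
Lemma hs_Wop_basis k e : (k <= n)%N -> A2_ONB e -> hilbert_schmidt_A2 (Wop (u k) phi k) ->
  (\sum_(0 <= i <oo) A2normsq (Wop (u k) phi k (e i)) < +oo)%E.
Proof.
move=> kn onb [_ [e' [onb' fin]]].
have [eA2 _ _] := onb; have [e'A2 _ _] := onb'; have [K K0 cmp] := frame_compare R n.
apply: hs_sum_compare K0 _ _ _ fin.
- by move=> i; exact: holo_Wop kn (eA2 i).1.
- by move=> i; exact: holo_Wop kn (e'A2 i).1.
move=> z z1 B HB N.
have kn1 : (k < n.+1)%N by rewrite ltnS.
have := cmp e e' (fun j => if j == k then u k z else 0) (phi z) B onb onb' (phi_disc z1) _ k kn N.
rewrite eqxx; apply => M; apply: le_trans (HB M).
rewrite le_eqVlt; apply/orP; left; apply/eqP; apply: eq_bigr => i _; congr sqmod.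
rewrite (bigD1 (Ordinal kn1))//= eqxx big1 ?addr0// => j jk.
rewrite ifF ?mul0r//; apply: contraNF jk => /eqP jE; apply/eqP/val_inj => //.
Qed.

(** Induction on the number of terms, with [n] fixed. Membership in the Bergman space is carried
    along because [A2normsqD_le] requires it of both summands. *)
Lemma hs_sum_Lop m e : (m <= n)%N -> A2_ONB e ->
  (forall k, (k <= n)%N -> hilbert_schmidt_A2 (Wop (u k) phi k)) ->
  (forall i, inA2 (Lop u phi m (e i))) /\
  (\sum_(0 <= i <oo) A2normsq (Lop u phi m (e i)) < +oo)%E.
Proof.
move=> mn onb hW; have [eA2 _ _] := onb.
elim: m mn => [|m ih] mn.
  have E i : Lop u phi 0 (e i) = Wop (u 0%N) phi 0 (e i).
    by apply/funext => z; rewrite /Lop big_ord_recl big_ord0 addr0.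
  split; first by move=> i; rewrite E; apply: (hW 0%N (leq0n n)).1.1.
  under eq_eseriesr do rewrite E.
  exact: (hs_Wop_basis (leq0n n) onb (hW 0%N (leq0n n))).
have [iL fL] := ih (ltnW mn).
have E i : Lop u phi m.+1 (e i) = (fun z => Lop u phi m (e i) z + Wop (u m.+1) phi m.+1 (e i) z).
  by apply/funext => z; rewrite /Lop big_ord_recr.
have iW i : inA2 (Wop (u m.+1) phi m.+1 (e i)) by apply: (hW m.+1 mn).1.1.
have fW := hs_Wop_basis mn onb (hW m.+1 mn).
split; first by move=> i; rewrite E; exact: inA2D.
apply: (@le_lt_trans _ _ (\sum_(0 <= i <oo) (2%:E * (A2normsq (Lop u phi m (e i)) +
    A2normsq (Wop (u m.+1) phi m.+1 (e i)))))%E).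
  apply: lee_nneseries; first by move=> i _ _; exact: A2normsq_ge0.
  by move=> i _; rewrite E; exact: A2normsqD_le.
rewrite nneseriesZl; last by move=> i _; rewrite adde_ge0// A2normsq_ge0.
rewrite nneseriesD; [|by move=> i _ _; exact: A2normsq_ge0|by move=> i _ _; exact: A2normsq_ge0].
by apply: lte_mul_pinfty; [rewrite lee_fin|by []|exact: lte_add_pinfty].
Qed.
End Operators.

Theorem theorem1p9 (R : realType) (n : nat) (u : nat -> Cplx R -> Cplx R)
    (phi : Cplx R -> Cplx R) :
  (0 < n)%N ->
  (forall k, (k <= n)%N -> holo_disc (u k)) ->
  analytic_selfmap phi ->
  hilbert_schmidt_A2 (Lop u phi n) <->
  (forall k, (k <= n)%N -> hilbert_schmidt_A2 (Wop (u k) phi k)).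
Proof.
move=> _ hu hphi; split=> [hL k kn|hW]; first exact: hs_Lop_Wop hu hphi k kn hL.
(* The basis attached to index 0 is used for all the terms; [hs_sum_Lop] transports the other sums
   to it. *)
have [_ [e [onb _]]] := hW 0%N (leq0n n).
have [iL fL] := hs_sum_Lop hu hphi (leqnn n) onb hW.
split; last by exists e.
apply: hs_bounded onb _ _ fL; last exact: bfun_Lop hphi n.
by move=> f hf; exact: holo_Lop hu hphi n f (leqnn n) hf.1.
Qed.
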